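(* Let $l_N$ be the average number of 2-protected nodes in a random digital search tree of size $N$. There is a periodic function $\delta:\mathbb{R}\to\mathbb{R}$ of period $1$, having a Fourier expansion with zero constant term, i.e. $\delta(x)=\sum_{j\in\mathbb{Z}\setminus\{0\}}c_j e^{2\pi i j x}$, such that, as $N\to\infty$, $$l_N= N\cdot \frac{1}{Q_\infty}\sum_{m\ge0}a_{m+1}b_m+N\cdot\delta(\log_2N)+O(1),$$ where the numerical constant evaluates to $$\frac{1}{Q_\infty}\sum_{m\ge0}a_{m+1}b_m=0.30707981393605921828549\dots.$$
   Context: Digital search trees (DSTs): given a finite sequence of (infinite) binary strings, the first string is placed in the root node; of the remaining strings, those starting with $0$ are directed to the left subtree and those starting with $1$ to the right subtree, and each subtree is constructed recursively by the same procedure from its strings (in the given order) with their first bits removed; an empty sequence gives the empty tree. A DST built from $N$ strings thus has $N$ nodes and is said to have size $N$. A random DST of size $N$ is one built from $N$ strings whose bits are independent fair coin tosses (each decision to go left or right is made with probability $\frac12$, independently). Thus, in a random DST of size $n+1$, the left and right subtrees have sizes $k$ and $n-k$ with probability $\binom nk 2^{-n}$, and, given the sizes, they are independent random DSTs of these sizes. A leaf is a node without children. A node is 2-protected if its distance (number of edges) to every leaf among itself and its descendants is at least $2$; equivalently, it is not a leaf and none of its children is a leaf. $l_N$ is the expected number of 2-protected nodes in a random DST of size $N$ (so $l_0=l_1=l_2=0$, $l_3=\frac12$). Notation: $\log$ is the natural logarithm, $L=\log 2$, $$Q_m=\prod_{k=1}^m\Big(1-\frac1{2^k}\Big)\ (Q_0=1),\qquad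 Q_\infty=\prod_{k=1}^\infty\Big(1-\frac1{2^k}\Big),\qquad a_{m+1}=\frac{(-1)^m2^{-\binom{m+1}{2}}}{Q_m}\quad(m\ge0).$$ For $m\ge1$, $$b_m=\frac{1}{4L}\,\frac{B(2^{-m})}{(2^{-m}-1)^3(2^{-m}-2)^2},$$ where $$B(x)=16L-48xL+48x^2L-16x^3L-20+60x-69x^2+36x^3-7x^4-8x\log x+12x^2\log x-10x^3\log x+4x^4\log x,$$ and for $m=0$ the value is interpreted as a limit (replacing $2^{-m}$ by $x$ and letting $x\to1$): $b_0=\frac{37}{12L}-4$. *)

(* Defs.v *)
From HB Require Import structures.
From mathcomp Require Import all_boot all_order all_algebra.
From mathcomp Require Import finmap complex.
From mathcomp Require Import all_classical all_reals all_analysis.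
From mathcomp.analysis.showcase Require summability.
Import Order.TTheory GRing.Theory Num.Theory.
Import numFieldNormedType.Exports.

Set Implicit Arguments.
Unset Strict Implicit.
Unset Printing Implicit Defensive.

Definition bitstring := nat -> bool.

Inductive bintree := BEmpty | BNode of bintree & bintree.

(* Only the shape of the tree is recorded, not the string stored in each node.
   The first argument is fuel; [dst_cons] below is the intended recursion. *)
Fixpoint dst_fuel (n : nat) (s : seq bitstring) : bintree :=
  match n, s with
  | n'.+1, _ :: s' =>
      let tails b := [seq (fun j => x j.+1) : bitstring | x <- s' & x 0 == b] in
      BNode (dst_fuel n' (tails false)) (dst_fuel n' (tails true))
  | _, _ => BEmpty
  end.

Definition dst (s : seq bitstring) : bintree := dst_fuel (size s) s.

Lemma dst_fuelE n s : size s <= n -> dst_fuel n s = dst s.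
Proof.
have H : forall m k (t : seq bitstring), size t <= m -> size t <= k ->
    dst_fuel m t = dst_fuel k t.
  elim=> [|m IH] [|k] [|x t] //= hm hk.
  have le b p : size t <= p ->
      size [seq (fun j => y j.+1) : bitstring | y <- t & y 0 == b] <= p.
    by move=> h; rewrite size_map size_filter (leq_trans (count_size _ _)).
  by congr BNode; apply: IH; apply: le.
by move=> h; apply: H.
Qed.

Lemma dst_nil : dst [::] = BEmpty.
Proof. by []. Qed.

Lemma dst_cons (x : bitstring) (s : seq bitstring) :
  dst (x :: s) =
  BNode (dst [seq (fun j => y j.+1) : bitstring | y <- s & y 0 == false])
       (dst [seq (fun j => y j.+1) : bitstring | y <- s & y 0 == true]).
Proof.
by rewrite {1}/dst /=; congr BNode; apply: dst_fuelE;
  rewrite size_map size_filter count_size.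
Qed.

(* The distances from the root to the leaves of the tree. *)
Fixpoint leaf_depths (t : bintree) : seq nat :=
  match t with
  | BEmpty => [::]
  | BNode BEmpty BEmpty => [:: 0]
  | BNode l r => [seq n.+1 | n <- leaf_depths l ++ leaf_depths r]
  end.

Definition root_protected (k : nat) (t : bintree) : bool :=
  if t is BNode _ _ then all (leq k) (leaf_depths t) else false.

Fixpoint nb_protected (k : nat) (t : bintree) : nat :=
  match t with
  | BEmpty => 0
  | BNode l r => root_protected k t + nb_protected k l + nb_protected k r
  end.

Local Open Scope classical_set_scope.
Local Open Scope ring_scope.

(* [X i j] is bit [j] of string [i].  The third clause, required for all
   prescribed values [v], is mutual independence of the whole family. *)
Definition independent_fair_bits (R : realType) (d : measure_display)
    (T : measurableType d) (P : probability T R)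
    (X : nat -> nat -> T -> bool) : Prop :=
  [/\ forall i j, measurable_fun [set: T] (X i j),
      forall i j b, P [set w | X i j w = b] = (2^-1)%:E
    & forall (A : {fset nat * nat}) (v : nat * nat -> bool),
        P (\bigcap_(p in [set` A]) [set w | X p.1 p.2 w = v p])
        = (\prod_(p <- A) P [set w | X p.1 p.2 w = v p])%E].

Definition random_dst (T : Type) (X : nat -> nat -> T -> bool) (N : nat) (w : T)
  : bintree := dst (mkseq (fun i j => X i j w) N).

Definition mean_2protected (R : realType) (d : measure_display)
    (T : measurableType d) (P : probability T R)
    (X : nat -> nat -> T -> bool) (N : nat) : R :=
  fine 'E_P[fun w => (nb_protected 2 (random_dst X N w))%:R]%E.

#[global] Existing Instance summability.totally_filter.

Section Constant.
Variable R : realType.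

Definition log2 (x : R) : R := ln x / ln 2.

Definition Qfin (m : nat) : R := \prod_(1 <= k < m.+1) (1 - 2 ^- k).

Definition Qinf : R := limn Qfin.

(* [coefa m] is the coefficient of index m + 1, i.e. a_{m+1}. *)
Definition coefa (m : nat) : R := (-1) ^+ m * 2 ^- 'C(m.+1, 2) / Qfin m.

Definition Bfun (x : R) : R :=
  let L := ln 2 in
  16 * L - 48 * x * L + 48 * x ^+ 2 * L - 16 * x ^+ 3 * L
  - 20 + 60 * x - 69 * x ^+ 2 + 36 * x ^+ 3 - 7 * x ^+ 4
  - 8 * x * ln x + 12 * x ^+ 2 * ln x - 10 * x ^+ 3 * ln x
  + 4 * x ^+ 4 * ln x.

Definition bfun (x : R) : R :=
  (4 * ln 2)^-1 * (Bfun x / ((x - 1) ^+ 3 * (x - 2) ^+ 2)).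

(* At m = 0 the formula has the removable singularity x = 1; the limit there is
   37 / (12 ln 2) - 4. *)
Definition coefb (m : nat) : R :=
  if m is 0 then lim (bfun x @[x --> (1 : R)^']) else bfun (2 ^- m).

Definition cst_series : R^nat := series (fun m => coefa m * coefb m).

Definition dst_constant : R := Qinf^-1 * limn cst_series.

(* The number 0.d1 d2 d3 ... with the given decimal digits. *)
Definition decimal (s : seq nat) : R :=
  \sum_(i < size s) (nth 0%N s i)%:R / 10 ^+ i.+1.

(* e^{2 pi i t} *)
Definition expi2pi (t : R) : R[i] :=
  Complex (cos (2 * pi * t)) (sin (2 * pi * t)).

(* delta(x) is the sum over all nonzero integers j of c_j e^{2 pi i j x}; as the
   index set is unordered, the sum is the limit along the finite sets of nonzero
   integers directed by inclusion. *)
Definition fourier_expansion0 (delta : R -> R) (c : int -> R[i]) : Prop :=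
  forall x : R,
    (summability.partial_sum (fun j : {j : int | j != 0} =>
       c (val j) * expi2pi ((val j)%:~R * x) : R[i]^o) A : R[i]^o)
      @[A --> summability.totally] --> (real_complex R (delta x) : R[i]^o).

End Constant.

(* Main.v *)
Require Import Defs.
From HB Require Import structures.
From mathcomp Require Import all_boot all_order all_algebra.
From mathcomp Require Import finmap complex.
From mathcomp Require Import all_classical all_reals all_analysis.
From mathcomp Require Import measurable_realfun ssrZ ring lra zify.
From Stdlib Require ZArith.
Import Order.TTheory GRing.Theory Num.Theory.
Import numFieldNormedType.Exports.
Set Implicit Arguments.
Unset Strict Implicit.
Unset Printing Implicit Defensive.
Local Open Scope classical_set_scope.
Local Open Scope ring_scope.

(** Write l_N for the mean number of 2-protected nodes. The branching rule gives
    l_{n+1} = toll n + 2 E l_K with K binomial of parameters n and 1/2, where toll n is the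
    probability that the root is 2-protected (mean_2protectedE). Toll and solution are
    combinations of terms p^d N(N-1)...(N-d+1) (1 - a p)^(N-d), which binomial thinning
    maps to themselves with p halved (bmean_atom). For N p = v they are finite versions of
    v^d exp(-a v), and in this dictionary the recurrence becomes a differential equation
    with one factor 1 + 2^-i d/dv for each level i. Partial fractions of the product of the
    inverse factors, with coefficients a_{m+1} / Q_{k-m}, give an exact formula for l_N as a
    sum over the levels k of the tree and over m <= k (lseqE).

    On level k the exact terms may be replaced by functions Gfun m of v = N 2^-k, and the
    coefficients by their limits A_m = a_{m+1} / Q_inf, for O(1) in total. The two facts
    behind this are that the approximation of the binomial terms gains a factor 2^-k, and
    that the A_m add up to 1 just as the coefficients of each level do, so that only
    differences of Gfun m with a step function in v matter. Levels of negative index can be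
    added for another O(1) (lseq_Phi). With x = log2 N this reads
      l_N = N sum_m A_m sum_{k in Z} h_m (x - k) + O(1),  h_m (y) = Gfun m (2^y) / 2^y.

    The function h_m is the sum of a combination of three fixed profiles, smooth and
    exponentially small at both ends, and of differences between integer translates
    (Gfun_two). The differences telescope to a constant, called drift. The periodization of
    the profiles is a periodic function whose mean is the integral of the profiles. Up to
    that mean it is delta, and mean plus drift is b_m (coefbE), so the constant of the
    theorem appears.

    The periodization has bounded second differences, hence Fourier coefficients O(1/j^2):
    a translation by half a wave length changes the sign of the wave (decay_wave). Fejer
    sums converge to the function (fejer_error), and together these facts show that the
    series converges to it, over any exhausting family of finite sets of frequencies
    (fourier_expansionP).

    For the digits, coefbE turns the constant into (V / ln 2 + U) / Q_inf, where U, V and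
    Q_inf are sums of rational series a_{m+1} g_m. As a_{m+1} is (-1)^m divided by the
    product of the 2^k - 1, k <= m, fifteen terms suffice. They and 31 terms of the series
    of 2 artanh (1/3) are computed in integer fixed-point arithmetic
    (dst_constant_bounds). *)

(** * The recurrence for the mean number of protected nodes *)

Section BinomialMean.
Variable R : realType.
Implicit Types f g : nat -> R.

Definition bmean (n : nat) f : R := \sum_(k < n.+1) ('C(n, k))%:R / 2 ^+ n * f k.

Lemma eq_bmean n f g : (forall k, (k <= n)%N -> f k = g k) -> bmean n f = bmean n g.
Proof. by move=> fg; apply: eq_bigr => k _; rewrite fg // -ltnS. Qed.

Lemma bmeanD n f g : bmean n (fun k => f k + g k) = bmean n f + bmean n g.
Proof. by rewrite /bmean -big_split; apply: eq_bigr => k _; rewrite mulrDr. Qed.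

Lemma bmeanZ n a f : bmean n (fun k => a * f k) = a * bmean n f.
Proof. by rewrite /bmean mulr_sumr; apply: eq_bigr => k _; rewrite mulrCA. Qed.

Lemma bmean_sum n (I : Type) (r : seq I) (F : I -> nat -> R) :
  bmean n (fun k => \sum_(i <- r) F i k) = \sum_(i <- r) bmean n (F i).
Proof.
by rewrite /bmean exchange_big; apply: eq_bigr => k _; rewrite mulr_sumr.
Qed.

Lemma bmeanS n f : bmean n.+1 f = 2^-1 * (bmean n f + bmean n (f \o succn)).
Proof.
have e2 : 2 ^+ n.+1 != 0 :> R by rewrite expf_neq0.
rewrite /bmean big_ord_recl [X in _ = _ * (X + _)]big_ord_recl !bin0.
under eq_bigr => i _ do rewrite lift0 binS natrD mulrDl mulrDl.
rewrite big_split /= [X in _ + (X + _)]big_ord_recr /= bin_small // !mul0r addr0.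
rewrite !mulrDr !mulr_sumr !addrA; congr (_ + _ + _).
- by rewrite exprS invfM; ring.
- by apply: eq_bigr => i _; rewrite /bump add1n exprS invfM; ring.
- by apply: eq_bigr => i _; rewrite exprS invfM; ring.
Qed.

End BinomialMean.

Section FiniteMeans.
Variable R : realType.
Implicit Types (h : bitstring -> R) (g : seq bitstring -> R).

Definition bcons (b : bool) (u : bitstring) : bitstring :=
  fun j => if j is j'.+1 then u j' else b.

Definition tails (b : bool) (s : seq bitstring) : seq bitstring :=
  [seq (fun j => x j.+1) : bitstring | x <- s & x 0 == b].

(** The mean over the prefixes of length D of a uniform string, padded by zeros. By
    recursion on D, conditioning on the first bit is definitional. *)
Fixpoint smean (D : nat) h : R :=
  if D is D'.+1 then
    2^-1 * (smean D' (h \o bcons false) + smean D' (h \o bcons true))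
  else h (fun=> false).

Fixpoint tmean (D n : nat) g : R :=
  if n is n'.+1 then smean D (fun x => tmean D n' (fun s => g (x :: s)))
  else g [::].

Lemma eq_smean D h h' : h =1 h' -> smean D h = smean D h'.
Proof.
elim: D h h' => [|D IH] h h' e //=.
by congr (_ * (_ + _)); apply: IH => u /=.
Qed.

Lemma smeanD D h h' : smean D (fun u => h u + h' u) = smean D h + smean D h'.
Proof.
elim: D h h' => [|D IH] h h' //=; rewrite -mulrDr; congr (_ * _).
by rewrite [LHS](congr2 +%R (IH _ _) (IH _ _)) addrACA.
Qed.

Lemma smeanZ D a h : smean D (fun u => a * h u) = a * smean D h.
Proof.
elim: D h => [|D IH] h //=.
by rewrite [X in _ * X](congr2 +%R (IH _) (IH _)) -mulrDr mulrCA.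
Qed.

Lemma smean_cst D a : smean D (fun=> a) = a.
Proof.
elim: D => [|D IH] //=; rewrite /comp IH; lra.
Qed.

Lemma smean_bmean D n (F : bitstring -> nat -> R) :
  smean D (fun u => bmean n (F u)) = bmean n (fun k => smean D (F^~ k)).
Proof.
rewrite /bmean; elim: (n.+1) {2}(n.+1) (leqnn n.+1) => [|m IH] p.
  by move=> _; under eq_smean do rewrite big_ord0; rewrite big_ord0 smean_cst.
move=> _; under eq_smean do rewrite big_ord_recr.
by rewrite smeanD (IH m) // big_ord_recr /= smeanZ.
Qed.

Lemma eq_tmean D n g g' : (forall s, size s = n -> g s = g' s) ->
  tmean D n g = tmean D n g'.
Proof.
elim: n g g' => [|n IH] g g' e /=; first exact: e.
by apply: eq_smean => x; apply: IH => s ss; apply: e; rewrite /= ss.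
Qed.

Lemma tmeanD D n g g' :
  tmean D n (fun s => g s + g' s) = tmean D n g + tmean D n g'.
Proof.
elim: n g g' => [|n IH] g g' //=.
by rewrite -smeanD; apply: eq_smean => x; rewrite IH.
Qed.

Lemma tmean_size D n (f : nat -> R) : tmean D n (fun s => f (size s)) = f n.
Proof.
elim: n f => [|n IH] f //=.
under eq_smean do rewrite (IH (fun k => f k.+1)).
exact: smean_cst.
Qed.

(** Among n strings, the number that start with a given bit is binomial, and
    the tails of these strings are again uniform: the branching rule of random
    digital search trees. *)
Lemma tmean_tails D n b g :
  tmean D.+1 n (fun s => g (tails b s)) = bmean n (fun k => tmean D k g).
Proof.
elim: n g => [|n IH] g.
  by rewrite /bmean big_ord_recl big_ord0 /= bin0 expr0; lra.
have step c : smean D ((fun x => tmean D.+1 n (fun s => g (tails b (x :: s))))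
      \o bcons c) = if c == b then bmean n (fun k => tmean D k.+1 g)
      else bmean n (fun k => tmean D k g).
  rewrite /comp /tails /=; case: (c == b) => /=; last first.
    under eq_smean do rewrite IH.
    exact: smean_cst.
  under eq_smean => u do rewrite (IH (fun s => g (u :: s))).
  by rewrite smean_bmean.
by rewrite /= !step bmeanS; case: b {IH step} => //=; rewrite addrC.
Qed.

(** Of the n + 1 strings, n go to the subtrees and k of them to the left; the root
    is 2-protected unless it is a leaf or a subtree is a single node. *)
Definition toll (n : nat) : R :=
  bmean n (fun k => ((n != 0%N) && (k != 1%N) && (n - k != 1)%N)%:R).

(** K is fuel: for K >= N this is the recurrence for the mean number of
    2-protected nodes, for smaller K only the first K levels of the tree count. *)
Fixpoint lseq (K N : nat) : R :=
  match K, N with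
  | K'.+1, n.+1 => toll n + 2 * bmean n (lseq K')
  | _, _ => 0
  end.

Lemma size_tails s : (size (tails false s) + size (tails true s))%N = size s.
Proof.
rewrite !size_map !size_filter -(count_predC (fun x : bitstring => x 0 == false)).
congr addn; apply: eq_count => x /=; by case: (x 0).
Qed.

Lemma leaf_depths1 s : all (leq 1) (leaf_depths (dst s)) = (size s != 1%N).
Proof.
case: s => [//|x s]; rewrite dst_cons -!/(tails _ _) /=.
have := size_tails s.
case: (tails false s) => [|y u]; case: (tails true s) => [|z v];
  rewrite ?dst_nil ?dst_cons /=; move=> <- //; rewrite ?addn0 ?add0n ?addnS //=.
all: by rewrite all_map; apply/allP.
Qed.

Lemma root_protected2 x s : root_protected 2 (dst (x :: s)) =
  (size s != 0%N) && (size (tails false s) != 1%N) && (size (tails true s) != 1%N).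
Proof.
rewrite dst_cons -!/(tails _ _) -!leaf_depths1.
have := size_tails s.
case: (tails false s) => [|y u]; case: (tails true s) => [|z v];
  rewrite ?dst_nil ?[dst (_ :: _)]dst_cons; move=> <- //.
all: rewrite /root_protected /leaf_depths -/leaf_depths all_map all_cat /=.
all: rewrite -!/leaf_depths ?addnS //=.
Qed.

Lemma tmean_nb_protected K n : (n <= K)%N ->
  tmean K n (fun s => (nb_protected 2 (dst s))%:R) = lseq K n.
Proof.
elim: K n => [|K IH] [|n] //; rewrite ltnS => nK.
have -> : tmean K.+1 n.+1 (fun s => (nb_protected 2 (dst s))%:R) =
  smean K.+1 (fun x => tmean K.+1 n (fun s => (nb_protected 2 (dst (x :: s)))%:R)).
  by [].
pose h k : R := ((n != 0%N) && (k != 1%N) && (n - k != 1)%N)%:R.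
pose nb s : R := (nb_protected 2 (dst s))%:R.
have nbE b : tmean K.+1 n (fun s => nb (tails b s)) = bmean n (lseq K).
  by rewrite tmean_tails; apply: eq_bmean => k kn; apply: IH; apply: leq_trans nK.
rewrite [LHS](@eq_smean _ _ (fun=> lseq K.+1 n.+1)) ?smean_cst // => x.
rewrite (@eq_tmean _ _ _ (fun s => (h (size (tails false s)) + nb (tails false s))
  + nb (tails true s))); last first.
  move=> s sn; rewrite /h /nb.
  have -> : nb_protected 2 (dst (x :: s)) = (root_protected 2 (dst (x :: s)) +
     nb_protected 2 (dst (tails false s)) + nb_protected 2 (dst (tails true s)))%N.
    by rewrite dst_cons.
  rewrite root_protected2 !natrD sn.
  suff -> : size (tails true s) = (n - size (tails false s))%N by [].
  by rewrite -sn -(size_tails s) addKn.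
rewrite !tmeanD !nbE (tmean_tails _ _ _ (fun u => h (size u))).
under eq_bmean do rewrite tmean_size.
rewrite /= /toll -/h; lra.
Qed.

Definition trunc (D : nat) (u : bitstring) : bitstring :=
  fun j => if (j < D)%N then u j else false.

(** A tree of D nodes has height less than D, so the strings are never read beyond
    their first D bits. *)
Lemma dst_trunc D s : (size s <= D)%N -> dst (map (trunc D) s) = dst s.
Proof.
elim: D s => [|D IH] [|x s] //=; rewrite ltnS => sD.
have tE b : tails b (map (trunc D.+1) s) = map (trunc D) (tails b s).
  rewrite /tails filter_map -!map_comp; congr map.
rewrite !dst_cons -!/(tails _ _) !tE !IH //;
  by rewrite size_map size_filter (leq_trans (count_size _ _)).
Qed.

End FiniteMeans.

Section TupleSums.
Variable R : realType.

Lemma sum_tupleS (T : finType) (n : nat) (F : n.+1.-tuple T -> R) :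
  \sum_t F t = \sum_x \sum_s F (cons_tuple x s).
Proof.
rewrite pair_bigA /=.
rewrite (reindex (fun p : T * n.-tuple T => cons_tuple p.1 p.2)) //=.
exists (fun t : n.+1.-tuple T => (thead t, behead_tuple t)) => [[x s] _|t _] /=.
  by congr pair; apply/val_inj.
by rewrite [RHS]tuple_eta; apply/val_inj.
Qed.

Lemma smeanE (D : nat) (h : bitstring -> R) :
  smean D h = 2 ^- D * \sum_(u : D.-tuple bool) h (nth false u).
Proof.
elim: D h => [|D IH] h /=.
  rewrite (big_pred1 [tuple]) => [|t]; last by apply/esym/eqP/tuple0.
  by rewrite expr0 invr1 mul1r; congr h; apply/funext => -[|j].
rewrite !IH sum_tupleS big_bool /= exprS invfM -mulrA -mulrDr; congr (_ * (_ * _)).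
rewrite addrC; congr (_ + _); apply: eq_bigr => u _ /=;
  by congr h; apply/funext => -[|j].
Qed.

Lemma tmeanE (D n : nat) (g : seq bitstring -> R) :
  tmean D n g = 2 ^- (n * D) *
    \sum_(t : n.-tuple (D.-tuple bool)) g [seq nth false (u : D.-tuple bool) | u <- t].
Proof.
elim: n g => [|n IH] g /=.
  rewrite (big_pred1 [tuple]) => [|t]; last by apply/esym/eqP/tuple0.
  by rewrite mul0n expr0 invr1 mul1r.
under eq_smean do rewrite IH.
by rewrite smeanZ smeanE sum_tupleS mulSn exprD invfM mulrA [X in X * _]mulrC.
Qed.

End TupleSums.

Section Expectation.
Context (R : realType) (d : measure_display) (T : measurableType d).
Variables (P : probability T R) (X : nat -> nat -> T -> bool).
Hypothesis HX : independent_fair_bits P X.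

Definition cells (N D : nat) : {fset nat * nat} :=
  [fset p in allpairs pair (iota 0 N) (iota 0 D)]%fset.

Lemma in_cells N D p : (p \in cells N D) = (p.1 < N)%N && (p.2 < D)%N.
Proof.
rewrite in_fset; apply/allpairsP/andP => [[q [/= q1 q2 ->]]|[p1 p2]].
  by rewrite !mem_iota in q1 q2.
by exists p; rewrite !mem_iota -surjective_pairing.
Qed.

Definition tbl (N D : nat) (t : N.-tuple (D.-tuple bool)) (p : nat * nat) : bool :=
  nth false (nth [::] (map val t) p.1) p.2.

Definition cylinder (N D : nat) (t : N.-tuple (D.-tuple bool)) : set T :=
  \bigcap_(p in [set` cells N D]) [set w | X p.1 p.2 w = tbl t p].

Lemma measurable_cylinder N D (t : N.-tuple (D.-tuple bool)) :
  measurable (cylinder t).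
Proof.
apply: fin_bigcap_measurable => // p _; case: HX => mX _ _.
have mb : measurable [set tbl t p] by [].
by have := mX p.1 p.2 measurableT _ mb; rewrite setTI.
Qed.

Lemma prob_cylinder N D (t : N.-tuple (D.-tuple bool)) :
  P (cylinder t) = (2 ^- (N * D))%:E.
Proof.
case: HX => _ fair indep; rewrite /cylinder indep.
under eq_bigr do rewrite fair.
rewrite prodEFin big_const_seq count_predT -[size _]/(#|` cells N D|%fset).
rewrite card_fseq undup_id; last first.
  by apply: allpairs_uniq; rewrite ?iota_uniq // => -[? ?] [? ?] _ _ [-> ->].
by rewrite size_allpairs !size_iota -exprVn iter_mulr_1.
Qed.

Definition table (N D : nat) (w : T) : N.-tuple (D.-tuple bool) :=
  [tuple [tuple X i j w | j < D] | i < N].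

Lemma cylinderE N D (t : N.-tuple (D.-tuple bool)) w :
  \1_(cylinder t) w = (t == table N D w)%:R :> R.
Proof.
rewrite indicE; congr (_ (_ : bool))%:R; apply/idP/eqP.
  rewrite inE => tw; apply/eq_from_tnth => i; apply/eq_from_tnth => j.
  have := tw (val i, val j); rewrite /= in_cells /= !ltn_ord => /(_ isT).
  rewrite !tnth_mktuple => ->; rewrite /tbl /=.
  by rewrite (nth_map (tnth t i)) ?size_tuple // -!tnth_nth.
move=> ->; rewrite inE => -[i j] /=; rewrite in_cells /= => /andP[iN jD].
rewrite /tbl /= -map_comp (nth_map (Ordinal iN)) ?size_enum_ord //=.
rewrite (nth_map (Ordinal jD)) ?size_enum_ord //=.
by rewrite !nth_enum_ord.
Qed.

Lemma random_dst_table N D w : (N <= D)%N ->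
  random_dst X N w = dst [seq nth false (u : D.-tuple bool) | u <- table N D w].
Proof.
move=> ND; rewrite /random_dst -(@dst_trunc D) ?size_mkseq //; congr dst.
apply: (@eq_from_nth _ (fun=> false)) => [|i]; first by rewrite !size_map size_iota -enumT size_enum_ord.
rewrite size_map size_mkseq => iN; rewrite (nth_map (fun=> false)) ?size_mkseq // nth_mkseq //.
rewrite (nth_map [tuple of nseq D false]) ?size_tuple //.
rewrite (nth_map (Ordinal iN)) ?size_enum_ord //=.
apply/funext => j; rewrite /trunc; case: ltnP => jD.
  by rewrite (nth_map (Ordinal jD)) ?size_enum_ord //= !nth_enum_ord.
by rewrite nth_default // size_map size_enum_ord.
Qed.

(** The tree depends on the N * K first bits only, so the expectation is a finite
    sum over tables of bits, which all have probability 2 ^ - (N * K). *)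
Lemma mean_2protectedE N K : (N <= K)%N -> mean_2protected P X N = lseq R K N.
Proof.
move=> NK; rewrite -tmean_nb_protected // tmeanE /mean_2protected unlock.
pose nb (t : N.-tuple (K.-tuple bool)) : R :=
  (nb_protected 2 (dst [seq nth false (u : K.-tuple bool) | u <- t]))%:R.
rewrite (eq_integral (fun w => \sum_t ((nb t * \1_(cylinder t) w)%:E)))%E; last first.
  move=> w _; rewrite sumEFin (@random_dst_table N K) // -/(nb _); congr EFin.
  rewrite (bigD1 (table N K w)) //= cylinderE eqxx mulr1 big1 ?addr0 // => t tw.
  by rewrite cylinderE (negbTE tw) mulr0.
rewrite ge0_integral_sum //; last 2 first.
- move=> t; apply/measurable_EFinP; apply: measurable_funM => //.
  exact/measurable_indic/measurable_cylinder.
- by move=> t w _; rewrite lee_fin mulr_ge0 // ler0n.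
rewrite (eq_bigr (fun t => (nb t * 2 ^- (N * K))%:E)) => [|t _].
  by rewrite sumEFin /= -mulr_suml mulrC.
under eq_integral do rewrite EFinM.
rewrite ge0_integralZl ?lee_fin ?ler0n //; last first.
  apply/measurable_EFinP; exact/measurable_indic/measurable_cylinder.
rewrite (integral_indic P measurableT (measurable_cylinder t)).
by rewrite setIT EFinM; congr (_ * _)%E; exact: prob_cylinder.
Qed.

End Expectation.

(** * Exact solution of the recurrence *)

Section ExactSolution.
Variable R : realType.
Implicit Types (a p : R) (d k m n N : nat).

(** The exact counterpart, at finite N, of v ^ d exp (- a v) with v = N p: the
    Poisson approximation is never made in the recurrence itself. *)
Definition atom a d N p : R := p ^+ d * (N ^_ d)%:R * (1 - a * p) ^+ (N - d).

Lemma atom0S a N p : atom a 0 N.+1 p = (1 - a * p) * atom a 0 N p.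
Proof. by rewrite /atom !ffactn0 !expr0 !subn0 exprS; ring. Qed.

Lemma atomSS a d N p : atom a d.+1 N.+1 p =
  (1 - a * p) * atom a d.+1 N p + d.+1%:R * p * atom a d N p.
Proof.
rewrite /atom ffactSS ffactnSr subSS.
have [Nd|Nd|->] := ltngtP N d.
- by rewrite ffact_small // !(muln0, mul0n, mulr0, mul0r) addr0.
- rewrite subnS -[in LHS](prednK (_ : 0 < N - d)%N) ?subn_gt0 //.
  rewrite [in LHS]exprS -[in X in _ + _ * X](prednK (_ : 0 < N - d)%N) ?subn_gt0 //.
  rewrite exprS exprS !natrM natrB ?(ltnW Nd) // -(@natr1 R N) -(@natr1 R d); ring.
- by rewrite subnn muln0 !(mul0r, mulr0) add0r natrM exprS; ring.
Qed.

Lemma bmean0 (f : nat -> R) : bmean 0 f = f 0.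
Proof. by rewrite /bmean big_ord_recl big_ord0 /= bin0 expr0; lra. Qed.

(** Keeping each of N items with probability one half halves p; this is why p
    is kept apart from N. *)
Lemma bmean_atom a d N p : bmean N (fun k => atom a d k p) = atom a d N (p / 2).
Proof.
elim: N d => [|N IH] d.
  rewrite bmean0 /atom; case: d => [|d]; last by rewrite ffact0n !mulr0 !mul0r.
  by rewrite !expr0.
rewrite bmeanS IH; case: d => [|d] /=.
  under eq_bmean do rewrite /= atom0S.
  by rewrite bmeanZ IH atom0S; field.
under eq_bmean do rewrite /= atomSS.
by rewrite bmeanD !bmeanZ !IH atomSS; field.
Qed.

(** The coefficients, in the functions v ^ d exp (- a v), of the solution of
    2 ^ - m G' + G = r with G 0 = 0, where r is the Poisson transform of the toll.
    At m = 0 the rate 2 ^ m of the homogeneous solution is a rate of r, and the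
    resonance raises the degree. *)
Definition cal m : R := 2 ^+ m / (2 ^+ m - 2^-1) ^+ 2.
Definition cal1 m : R := - (2 ^+ m / (2 ^+ m - 2^-1)).
Definition cbe2 m : R := if m is 0 then 0 else 2 ^+ m / (4 * (2 ^+ m - 1)).
Definition cbe1 m : R :=
  if m is 0 then -1 else - (2 ^+ m / (2 * (2 ^+ m - 1) ^+ 2)).
Definition cbe m : R := if m is 0 then - 5 else
  2 ^+ m / (2 * (2 ^+ m - 1) ^+ 3) - 2 ^+ m / (2 ^+ m - 1).
Definition cga m : R := if m is 0 then 12^-1 else 0.
Definition cc m : R := - (1 + cal m + cbe m).

(** The counterpart of G; the atom of rate 2 ^ m is the homogeneous solution, with
    the coefficient that makes Ghat0 true. *)
Definition Ghat m N p : R :=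
  1 + cal m * atom 2^-1 0 N p + cbe m * atom 1 0 N p + cc m * atom (2 ^+ m) 0 N p
  + cal1 m * atom 2^-1 1 N p + cbe1 m * atom 1 1 N p + cbe2 m * atom 1 2 N p
  + cga m * atom 1 3 N p.

Definition rhat N p : R :=
  1 - atom 2^-1 1 N p - atom 1 0 N p + 4^-1 * atom 1 2 N p.

Lemma exp2_gt1 m : 2 <= 2 ^+ m.+1 :> R.
Proof. by rewrite exprS ler_peMr // exprn_ege1 // ler1n. Qed.

Lemma exp2_ge1 m : 1 <= 2 ^+ m :> R.
Proof. by rewrite exprn_ege1 // ler1n. Qed.

Lemma exp2_gt0 m : 0 < 2 ^+ m :> R.
Proof. by rewrite exprn_gt0. Qed.

(** What GhatS requires of the coefficients of each atom. *)
Lemma coef_eqs m (y := 2 ^+ m : R) :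
  [/\ cal1 m - 2^-1 * cal m = - y * cal m,
      2^-1 * cal1 m = y * cal1 m + y,
      cbe1 m - cbe m = - y * cbe m - y,
      2 * cbe2 m - cbe1 m = - y * cbe1 m
    & 3 * cga m - cbe2 m = - y * cbe2 m + y / 4 /\ cga m = y * cga m].
Proof.
rewrite /y {y} /cal1 /cal /cbe1 /cbe2 /cbe /cga; case: m => [|m].
  by rewrite expr0; split; try field; split; field.
have := exp2_gt1 m; move: (2 ^+ m.+1) => y y2.
have h1 : y - 1 != 0 by apply: lt0r_neq0; lra.
have h2 : y - 2^-1 != 0 by apply: lt0r_neq0; lra.
have h3 : y * 2 - 1 != 0 by apply: lt0r_neq0; lra.
split; [field|field|field|field|split; field].
all: by rewrite ?h1 ?h2 ?h3.
Qed.

Lemma GhatS m N p :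
  Ghat m N.+1 p = (1 - 2 ^+ m * p) * Ghat m N p + 2 ^+ m * p * rhat N p.
Proof.
have [e1 e2 e3 e4 [e5 e6]] := coef_eqs m.
rewrite /Ghat /rhat !atom0S !atomSS; move: (2 ^+ m) e1 e2 e3 e4 e5 e6 => y.
set a1 := atom _ 0 N _; set a2 := atom _ 0 N _; set a3 := atom _ 0 N _.
set a4 := atom _ 1 N _; set a5 := atom _ 1 N _; set a6 := atom _ 2 N _.
set a7 := atom _ 3 N _ => e1 e2 e3 e4 e5 e6.
apply/eqP; rewrite -subr_eq0; apply/eqP.
transitivity (p * ((cal1 m - 2^-1 * cal m + y * cal m) * a1
  - (2^-1 * cal1 m - y * cal1 m - y) * a4 + (cbe1 m - cbe m + y * cbe m + y) * a2
  + (2 * cbe2 m - cbe1 m + y * cbe1 m) * a5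
  + (3 * cga m - cbe2 m + y * cbe2 m - y / 4) * a6 - (cga m - y * cga m) * a7)).
  by field.
by rewrite e1 e2 e3 e4 e5 -e6; field.
Qed.

Lemma Ghat0 m p : Ghat m 0 p = 0.
Proof.
by rewrite /Ghat /atom !ffact0n !sub0n !expr0 /cc /=; ring.
Qed.

Lemma bmean_cst N a : bmean N (fun=> a) = a.
Proof. by elim: N => [|N IH]; rewrite ?bmean0 // bmeanS /comp IH; field. Qed.

Lemma bmean_Ghat m N p : bmean N (fun j => Ghat m j p) = Ghat m N (p / 2).
Proof. by rewrite /Ghat !bmeanD !bmeanZ !bmean_atom bmean_cst. Qed.

Lemma bmean_pred1 n j : (j <= n)%N ->
  bmean n (fun k => (k == j)%:R) = 'C(n, j)%:R / 2 ^+ n :> R.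
Proof.
rewrite -ltnS => jn; rewrite /bmean (bigD1 (Ordinal jn)) //= eqxx mulr1.
by rewrite big1 ?addr0 // => i ij; rewrite -val_eqE in ij; rewrite (negbTE ij) mulr0.
Qed.

(** Inclusion and exclusion: each subtree has a single node with probability
    n / 2 ^ n, and both have one only for n = 2, which is the last term. *)
Lemma tollE n : toll R n = rhat n 1.
Proof.
rewrite /rhat /atom !mulr1 !expr1n !mul1r subrr /toll.
case: n => [|[|[|n]]].
- by rewrite bmean0 !ffact0n !expr0 /=; lra.
- rewrite !bmeanS !bmean0 (_ : 1 ^_ 2 = 0)%N // ffactn1 subnn expr0 subn0 expr1 /=; lra.
- rewrite !bmeanS !bmean0 (_ : 2 ^_ 2 = 2)%N // ffactn1 subnn expr0 subn0 expr1 expr2 /=; lra.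
rewrite (_ : n.+3 - 2 = n.+1)%N // subn0 !(exprS 0) !mul0r !mulr0 addr0 subr0.
rewrite (@eq_bmean _ _ _ (fun k => 1 + (- 1 * (k == 1%N)%:R + - 1 * (k == n.+2)%:R)));
  last first.
  move=> k kn /=; have -> : (n.+3 - k == 1)%N = (k == n.+2).
    by apply/eqP/eqP => h; lia.
  by case: eqVneq => [->|_] /=; [lra | case: eqVneq => _ /=; lra].
rewrite bmeanD bmean_cst bmeanD !bmeanZ !bmean_pred1 //.
rewrite (_ : 'C(n.+3, n.+2) = n.+3) ?bin1; last by rewrite -bin_sub ?subSnn ?bin1.
rewrite ffactn1 subSS subn0 (_ : 1 - 2^-1 = 2^-1); last by lra.
rewrite exprVn [2 ^+ n.+3]exprS.
have := exp2_gt0 n.+2; move: (2 ^+ n.+2) => y y0; field; lra.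
Qed.

(** * Partial fractions *)

(** The coefficient of 1 / (1 + 2 ^ - m s) in the partial fraction decomposition of
    the product of the 1 / (1 + 2 ^ - i s), i <= k. *)
Definition coefA k m : R := if (m <= k)%N then coefa R m / Qfin R (k - m) else 0.

Lemma QfinS n : Qfin R n.+1 = Qfin R n * (1 - 2 ^- n.+1).
Proof. by rewrite /Qfin big_nat_recr. Qed.

Lemma Qfin0 : Qfin R 0 = 1.
Proof. by rewrite /Qfin big_geq. Qed.

Lemma exp2V_lt1 n : 2 ^- n.+1 <= 2^-1 :> R.
Proof. by rewrite lef_pV2 ?posrE ?exp2_gt0 // exp2_gt1. Qed.

Lemma Qfin_gt0 n : 0 < Qfin R n.
Proof.
elim: n => [|n IH]; first by rewrite Qfin0.
by rewrite QfinS mulr_gt0 // subr_gt0 (le_lt_trans (exp2V_lt1 n)) //; lra.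
Qed.

Lemma Qfin_neq0 n : Qfin R n != 0.
Proof. exact/lt0r_neq0/Qfin_gt0. Qed.

Lemma exp2V_neq1 n : 1 - 2 ^- n.+1 != 0 :> R.
Proof. by apply: lt0r_neq0; have := exp2V_lt1 n; lra. Qed.

Lemma coefAS k m : coefA k.+1 m * (1 - 2 ^+ m * 2 ^- k.+1) = coefA k m.
Proof.
rewrite /coefA; have [mk|mk|->] := ltngtP m k.+1.
- rewrite -ltnS mk subSn // QfinS.
  have -> : 2 ^+ m * 2 ^- k.+1 = 2 ^- (k - m).+1 :> R.
    rewrite -subSn // -{1}(subnK (ltnW mk)) exprD invfM mulrCA divff ?mulr1 //.
  by rewrite invfM mulrA mulfVK // exp2V_neq1.
- by rewrite mul0r ifN // -ltnNge ltnW.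
- by rewrite divff ?expf_neq0 // subrr mulr0 ltnn.
Qed.

Lemma coefA_tele k n : (n <= k)%N ->
  (1 - 2 ^- k.+1) * \sum_(m < n.+1) coefA k.+1 m * 2 ^+ m =
  (-1) ^+ n * 2 ^- 'C(n.+1, 2) / (Qfin R n * Qfin R (k - n)).
Proof.
elim: n => [|n IH] nk.
  rewrite big_ord_recl big_ord0 addr0 /coefA /coefa /= !subn0 !expr0 Qfin0 QfinS.
  have := exp2V_neq1 k; move: (2 ^- _) => z z1.
  by field; rewrite Qfin_neq0.
rewrite big_ord_recr mulrDr IH ?(ltnW nk) //= /coefA /coefa leqW //.
have [j ->] : exists j, k = (n.+1 + j)%N by exists (k - n.+1)%N; rewrite subnKC.
have [-> -> ->] : [/\ n.+1 + j - n = j.+1, (n.+1 + j).+1 - n.+1 = j.+1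
  & n.+1 + j - n.+1 = j]%N by split; lia.
rewrite !QfinS.
rewrite (_ : 2 ^- (n.+1 + j).+1 = 2 ^- n.+1 * 2 ^- j.+1 :> R); last first.
  by rewrite -addnS exprD invfM.
rewrite (binS n.+1 1) bin1 addnC exprD invfM [(-1) ^+ n.+1]exprS.
have h1 := Qfin_neq0 n; have h2 := Qfin_neq0 j.
have : 2 ^+ 'C(n.+1, 2) != 0 :> R by rewrite expf_neq0.
have := exp2_gt1 n; have := exp2_gt1 j.
move: (2 ^+ 'C(_, _)) (2 ^+ n.+1) (2 ^+ j.+1) => w x z z2 x2 w0.
have [x0 z0 x1 z1] : [/\ x != 0, z != 0, x - 1 != 0 & z - 1 != 0].
  by split; apply: lt0r_neq0; lra.
by field; rewrite w0 h1 h2 x0 z0 x1 z1.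
Qed.

(** The product is O(s ^ - (k + 1)) at infinity, so for k > 0 it has no term in
    1 / s. *)
Lemma sum_coefA_exp k : \sum_(m < k.+1) coefA k m * 2 ^+ m = (k == 0%N)%:R.
Proof.
case: k => [|k].
  by rewrite big_ord_recl big_ord0 /coefA /coefa /= Qfin0 !expr0 invr1; field.
apply: (mulfI (exp2V_neq1 k)); rewrite mulr0 big_ord_recr mulrDr /=.
rewrite coefA_tele // /coefA leqnn !subnn /coefa QfinS Qfin0.
rewrite (binS k.+1 1) bin1 addnC exprD invfM [(-1) ^+ k.+1]exprS.
have h1 := Qfin_neq0 k; have := exp2V_neq1 k.
have : 2 ^+ k.+1 != 0 :> R by rewrite expf_neq0.
have : 2 ^+ 'C(k.+1, 2) != 0 :> R by rewrite expf_neq0.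
move: (2 ^+ 'C(_, _)) (2 ^+ k.+1) (2 ^- _) => u x w u0 x0 x1.
by field; rewrite x1 h1 u0 x0.
Qed.

(** The value of the decomposition at s = 0. *)
Lemma sum_coefA k : \sum_(m < k.+1) coefA k m = 1.
Proof.
elim: k => [|k IH].
  by rewrite big_ord_recl big_ord0 /coefA /coefa /= Qfin0 !expr0 invr1; field.
have := sum_coefA_exp k.+1; rewrite mulr0n => s0.
transitivity (\sum_(m < k.+2) coefA k.+1 m -
   (\sum_(m < k.+2) coefA k.+1 m * 2 ^+ m) * 2 ^- k.+1).
  by rewrite s0 mul0r subr0.
rewrite mulr_suml -sumrB -[RHS]IH big_ord_recr /=.
rewrite -[X in _ + X](_ : coefA k.+1 k.+1 * (1 - 2 ^+ k.+1 * 2 ^- k.+1) = _); last by ring.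
rewrite coefAS [coefA k k.+1]/coefA ltnn addr0; apply: eq_bigr => m _.
by rewrite -(coefAS k m) mulrBr mulr1 mulrA.
Qed.

(** Level k of the tree contributes 2 ^ k times the solution of the equation with
    operator the product of the (1 + 2 ^ - i d/dv), i <= k, and the partial fractions
    reduce it to the solutions for single factors. *)
Lemma lseqE K N : lseq R K N =
  \sum_(k < K) 2 ^+ k * \sum_(m < k.+1) coefA k m * Ghat m N (2 ^- k).
Proof.
elim: K N => [|K IH] [|N] /=; rewrite ?big_ord0 //.
  by rewrite big1 // => k _; rewrite big1 ?mulr0 // => m _; rewrite Ghat0 mulr0.
under [RHS]eq_bigr => k _ do under eq_bigr => m _ do rewrite GhatS mulrDr.
under [RHS]eq_bigr => k _ do rewrite big_split mulrDr.
rewrite big_split addrC tollE /=; congr (_ + _).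
  rewrite big_ord_recl /= [X in _ * X + _](_ : _ = 0); last first.
    by rewrite big_ord_recl big_ord0 /= expr0 invr1 mulr1 subrr mul0r mulr0 addr0.
  rewrite mulr0 add0r.
  under eq_bmean => k _ do rewrite IH.
  rewrite bmean_sum mulr_sumr; apply: eq_bigr => k _.
  rewrite /= bmeanZ bmean_sum /bump add1n [X in _ = X * _]exprS -mulrA; congr (_ * (_ * _)).
  rewrite [RHS]big_ord_recr /= mulrA coefAS [coefA k k.+1]/coefA ltnn mul0r addr0.
  apply: eq_bigr => m _; rewrite bmeanZ bmean_Ghat mulrA coefAS; congr (_ * Ghat _ _ _).
  by rewrite exprSr invfM.
rewrite big_ord_recl /= [X in _ + X]big1 ?addr0.
  rewrite big_ord_recl big_ord0 /= expr0 invr1 /coefA /coefa /= !expr0 Qfin0; by field.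
move=> k _; rewrite /bump add1n.
transitivity (rhat N (2 ^- k.+1) * \sum_(m < k.+2) coefA k.+1 m * 2 ^+ m).
  rewrite !mulr_sumr; apply: eq_bigr => m _.
  have : 2 ^+ k.+1 != 0 :> R by rewrite expf_neq0.
  move: (rhat _ _) => r; move: (2 ^+ k.+1) => y y0; field; exact: y0.
by rewrite sum_coefA_exp mulr0.
Qed.

End ExactSolution.

(** * Exponential approximation *)

Section Bounds.
Variable R : realType.
Implicit Types (a p v t x y : R) (d k m n N K : nat).

(** A summable envelope that is comparable to min (v, 1 / v) and telescopes along
    the geometric progressions v / 2 ^ k. *)
Definition mu v : R := v / ((1 + v) * (2 + v)).

Lemma mu_tele v : 0 <= v -> mu v = v / (1 + v) - (v / 2) / (1 + v / 2).
Proof.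
move=> v0; have h1 : 1 + v != 0 by apply: lt0r_neq0; lra.
have h2 : 2 + v != 0 by apply: lt0r_neq0; lra.
by rewrite /mu; field; rewrite h1 h2.
Qed.

Lemma mu_ge0 v : 0 <= v -> 0 <= mu v.
Proof. by move=> v0; rewrite divr_ge0 // mulr_ge0 //; lra. Qed.

Lemma mu_le v : 0 <= v -> mu v <= v.
Proof. by move=> v0; rewrite ler_pdivrMr; nra. Qed.

Lemma mu_leV v : 0 < v -> mu v <= v^-1.
Proof.
move=> v0; rewrite ler_pdivrMr ?mulr_gt0; [|lra..].
by rewrite mulrC ler_pdivlMr //; nra.
Qed.

Lemma mu_le1 v : 0 <= v -> mu v <= 1.
Proof. by move=> v0; rewrite ler_pdivrMr; nra. Qed.

Lemma le_mu c f v : 0 < v -> 0 <= c -> f <= c * v -> f * v <= c -> f <= 6 * c * mu v.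
Proof.
move=> v0 c0 h1 h2.
have p0 : 0 < (1 + v) * (2 + v) by rewrite mulr_gt0 //; lra.
rewrite mulrA ler_pdivlMr //.
have [v1|v1] := leP v 1.
  have [f0|f0] := leP 0 f; last first.
    apply: (@le_trans _ _ 0); last by rewrite !mulr_ge0 //; lra.
    by rewrite nmulr_rle0 // ltW.
  apply: (@le_trans _ _ (f * 6)); last by nra.
  by rewrite ler_wpM2l //; nra.
have [f0|f0] := leP 0 f; last first.
  apply: (@le_trans _ _ 0); last by rewrite !mulr_ge0 //; lra.
  by rewrite nmulr_rle0 // ltW.
apply: (@le_trans _ _ (f * (6 * v * v))).
  by rewrite ler_wpM2l //; nra.
by rewrite mulrA mulrCA -!mulrA ler_wpM2l // mulrA ler_wpM2r // ltW.
Qed.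

Lemma sum_mu v K : 0 < v -> \sum_(k < K) mu (v / 2 ^+ k) <= 1.
Proof.
move=> v0; suff -> : \sum_(k < K) mu (v / 2 ^+ k) =
    v / (1 + v) - v / 2 ^+ K / (1 + v / 2 ^+ K).
  have h : 0 <= v / 2 ^+ K by rewrite divr_ge0 // ?exprn_ge0 // ltW.
  have h2 : 0 <= v / 2 ^+ K / (1 + v / 2 ^+ K) by rewrite divr_ge0 //; lra.
  have h3 : v / (1 + v) <= 1 by rewrite ler_pdivrMr; lra.
  lra.
elim: K => [|K IH]; first by rewrite big_ord0 expr0 divr1 subrr.
rewrite big_ord_recr /= IH mu_tele; last first.
  by rewrite divr_ge0 // ?exprn_ge0 // ltW.
by rewrite (_ : v / 2 ^+ K / 2 = v / 2 ^+ K.+1) ?exprSr ?invfM ?mulrA //; ring.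
Qed.

Lemma exprn_expRN n x : 0 <= x -> x ^+ n * expR (- x) <= n%:R ^+ n.
Proof.
move=> x0; case: n => [|n]; first by rewrite !expr0 mul1r -expR0 ler_expR; lra.
have n0 : 0 < n.+1%:R :> R by rewrite ltr0n.
have -> : - x = n.+1%:R * (- (x / n.+1%:R)) by field; rewrite lt0r_neq0.
rewrite mulrC expRM_natl -exprMn lerXn2r ?nnegrE ?mulr_ge0 ?expR_ge0 //.
rewrite expRN ler_pdivrMl ?expR_gt0 // mulrC -ler_pdivrMl // mulrC.
have := expR_ge1Dx (x / n.+1%:R); move: (x / _) => u; lra.
Qed.

Definition catom a d v : R := v ^+ d * expR (- (a * v)).

Lemma catom_ge0 a d v : 0 <= v -> 0 <= catom a d v.
Proof. by move=> v0; rewrite mulr_ge0 ?exprn_ge0 ?expR_ge0. Qed.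

Lemma catom_le a d v : 2^-1 <= a -> 0 <= v -> catom a d v <= (2 * d%:R) ^+ d.
Proof.
move=> a2 v0.
apply: (@le_trans _ _ (2 ^+ d * ((v / 2) ^+ d * expR (- (v / 2))))).
  rewrite mulrA -exprMn [2 * _]mulrC divfK // /catom ler_wpM2l ?exprn_ge0 //.
  by rewrite ler_expR lerN2; nra.
by rewrite [leRHS]exprMn ler_wpM2l ?exprn_ge0 // exprn_expRN // divr_ge0.
Qed.

Definition cmu d : R := 6 * (2 * d.+2%:R) ^+ d.+2.

Lemma cmu_ge0 d : 0 <= cmu d.
Proof. by rewrite mulr_ge0 // exprn_ge0 // mulr_ge0. Qed.

Lemma catom_mu a d v : 2^-1 <= a -> 0 < v -> catom a d.+1 v <= cmu d * mu v.
Proof.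
move=> a2 v0; rewrite /cmu; apply: le_mu => //.
- have -> : catom a d.+1 v = catom a d v * v by rewrite /catom exprS; ring.
  rewrite ler_wpM2r ?(ltW v0) //; apply: le_trans (catom_le _ a2 (ltW v0)) _.
  apply: (@le_trans _ _ ((2 * d.+2%:R) ^+ d)).
    rewrite lerXn2r ?nnegrE ?mulr_ge0 // ler_wpM2l // ler_nat; lia.
  rewrite ler_weXn2l //; last lia.
  have : 2 <= d.+2%:R :> R by rewrite ler_nat.
  lra.
- have -> : catom a d.+1 v * v = catom a d.+2 v by rewrite /catom (exprSr v d.+1); ring.
  exact: catom_le (ltW v0).
Qed.

Lemma expRN_mu a v : 2^-1 <= a -> 1 <= v -> catom a 0 v <= cmu 0 * mu v.
Proof.
move=> a2 v1; apply: le_trans (catom_mu 0 a2 _); last lra.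
by rewrite /catom expr0 expr1 ler_wpM2r ?expR_ge0.
Qed.

Lemma expRN_sub1 x : 0 <= x -> 0 <= 1 - expR (- x) <= x.
Proof.
move=> x0; have := expR_ge1Dx (- x); have : expR (- x) <= 1.
  by rewrite -[leRHS]expR0 ler_expR; lra.
lra.
Qed.

Lemma bernoulli_ineq x n : 0 <= x -> x <= 1 -> 1 - n%:R * x <= (1 - x) ^+ n.
Proof.
move=> x0 x1; elim: n => [|n IH]; first by rewrite expr0; lra.
have : 0 <= n%:R * x by rewrite mulr_ge0.
rewrite exprS -(@natr1 R n) => nx.
have : (1 - x) * (1 - n%:R * x) <= (1 - x) * (1 - x) ^+ n by rewrite ler_wpM2l //; lra.
by nra.
Qed.

Lemma expRN_pow t n : 0 <= t -> t <= 1 ->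
  0 <= expR (- (t * n%:R)) - (1 - t) ^+ n <= n%:R * t ^+ 2 * expR (- (t * n%:R)).
Proof.
move=> t0 t1; have -> : - (t * n%:R) = n%:R * (- t) by ring.
rewrite expRM_natl; apply/andP; split.
  rewrite subr_ge0 lerXn2r ?nnegrE ?expR_ge0 //; first lra.
  by have := expR_ge1Dx (- t); lra.
have h : (1 - t ^+ 2) * expR (- t) <= 1 - t.
  have -> : 1 - t ^+ 2 = (1 - t) * (1 + t) by ring.
  rewrite -mulrA ler_piMr ?subr_ge0 //.
  have : (1 + t) * expR (- t) <= expR t * expR (- t).
    by rewrite ler_wpM2r ?expR_ge0 ?expR_ge1Dx.
  by rewrite expRxMexpNx_1.
have t2 : t ^+ 2 <= 1 by rewrite exprn_ile1.
have {h} : ((1 - t ^+ 2) * expR (- t)) ^+ n <= (1 - t) ^+ n.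
  by rewrite lerXn2r ?nnegrE ?mulr_ge0 ?expR_ge0 //; lra.
rewrite exprMn; have := bernoulli_ineq n (exprn_ge0 2 t0) t2.
have : 0 <= expR (- t) ^+ n by rewrite exprn_ge0 // expR_ge0.
move: (expR _ ^+ n) ((1 - _ ^+ 2) ^+ n) ((1 - t) ^+ n) (n%:R * _) => E b c s; nra.
Qed.

Lemma ffact_diff N d :
  (N ^_ d)%:R <= N%:R ^+ d :> R /\
  N%:R ^+ d - (N ^_ d)%:R <= (d * d.-1)%:R * N%:R ^+ d.-1 :> R.
Proof.
elim: d => [|d [IH1 IH2]]; first by rewrite ffactn0 expr0 mul0n mul0r subrr.
have NN : 0 <= N%:R :> R by [].
rewrite ffactnSr natrM exprSr /=.
have [Nd|dN] := ltnP N d.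
  rewrite ffact_small // mul0r subr0; split; first by rewrite mulr_ge0 // exprn_ge0.
  rewrite mulrC ler_wpM2r ?exprn_ge0 // ler_nat; nia.
rewrite natrB //; split.
  apply: ler_pM => //; rewrite ?subr_ge0 ?ler_nat //.
  by rewrite gerBl.
have h : N%:R * N%:R ^+ d.-1 * (d * d.-1)%:R <= N%:R ^+ d * (d * d.-1)%:R :> R.
  by case: (d) => [|e]; rewrite ?mul0n ?mulr0 // -exprS.
have h2 : N%:R * (N%:R ^+ d - (N ^_ d)%:R) <= N%:R * ((d * d.-1)%:R * N%:R ^+ d.-1) :> R.
  by rewrite ler_wpM2l.
have h3 : d%:R * (N ^_ d)%:R <= d%:R * N%:R ^+ d :> R by rewrite ler_wpM2l.
have -> : ((d.+1 * d)%:R : R) = (d * d.-1)%:R + 2 * d%:R.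
  by rewrite -natrM -natrD; congr (_%:R); case: (d) => //= e; lia.
have h4 : 0 <= d%:R * N%:R ^+ d :> R by rewrite mulr_ge0 // exprn_ge0.
move: (N ^_ d)%:R (N%:R ^+ d) (N%:R ^+ d.-1) (d * d.-1)%:R h h2 h3 h4 => f g g' c.
nra.
Qed.

(** With p = 2 ^ - k, the factor p of this bound and of the next one compensates the
    factor 2 ^ k of level k. *)
Lemma atom_catom0 a N p : 0 <= a -> 0 <= p -> a * p <= 1 ->
  `|atom a 0 N p - catom a 0 (N%:R * p)| <= a ^+ 2 * p * catom a 1 (N%:R * p).
Proof.
move=> a0 p0 ap1; rewrite /atom /catom !expr0 ffactn0 subn0 !mul1r distrC.
have := expRN_pow N (mulr_ge0 a0 p0) ap1.
rewrite (_ : a * p * N%:R = a * (N%:R * p)); last by ring.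
move=> /andP[h1 h2]; rewrite ger0_norm //; apply: le_trans h2 _.
by rewrite le_eqVlt; apply/orP; left; apply/eqP; ring.
Qed.

Lemma atom_catomS a d N p : 0 <= a -> a <= 1 -> 0 <= p -> p <= 1 ->
  `|atom a d.+1 N p - catom a d.+1 (N%:R * p)| <=
    p * (expR d.+1%:R * (catom a d.+2 (N%:R * p) + d.+1%:R * catom a d.+1 (N%:R * p))
         + (d.+1 * d)%:R * catom a d (N%:R * p)).
Proof.
move=> a0 a1 p0 p1; set v := N%:R * p; set D := d.+1.
have v0 : 0 <= v by rewrite mulr_ge0.
have [f1 f2] := ffact_diff N D.
set E := expR (- (a * v)).
have E0 : 0 <= E by rewrite expR_ge0.
set F : R := (N ^_ D)%:R; have F0 : 0 <= F by [].
have part2 : `|p ^+ D * F * E - catom a D v| <= p * ((d.+1 * d)%:R * catom a d v).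
  rewrite /catom -/E exprMn -mulrBl normrM (ger0_norm E0) distrC.
  rewrite [X in X - _]mulrC -mulrBr normrM (ger0_norm (exprn_ge0 _ p0)).
  rewrite ger0_norm ?subr_ge0 //.
  rewrite [leRHS](_ : _ = p ^+ D * ((d.+1 * d)%:R * N%:R ^+ d) * E); last first.
    by rewrite exprS /v exprMn; ring.
  by rewrite ler_wpM2r // ler_wpM2l // exprn_ge0.
have part1 : `|atom a D N p - p ^+ D * F * E| <=
   p * (expR D%:R * (catom a D.+1 v + D%:R * catom a D v)).
  rewrite /atom -mulrBr normrM ger0_norm ?mulr_ge0 ?exprn_ge0 //.
  have [ND|DN] := ltnP N D.
    rewrite /F ffact_small // mulr0 mul0r !mulr_ge0 ?expR_ge0 //.
    by apply: addr_ge0; [|apply: mulr_ge0 => //]; exact: catom_ge0.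
  have ap0 : 0 <= a * p by rewrite mulr_ge0.
  have ap1 : a * p <= 1 by rewrite mulr_ile1.
  have := expRN_pow (N - D) ap0 ap1.
  set y := (1 - a * p) ^+ (N - D); rewrite natrB //.
  have -> : expR (- (a * p * (N%:R - D%:R))) = expR (a * p * D%:R) * E.
    by rewrite /E -expRD; congr expR; rewrite /v; ring.
  set c := expR (a * p * D%:R).
  have c1 : 1 <= c by rewrite /c -expR0 ler_expR mulr_ge0.
  have cD : c <= expR D%:R by rewrite ler_expR ler_piMl.
  have c2 : c - 1 <= c * (a * p * D%:R).
    have /expRN_sub1/andP[_] : 0 <= a * p * D%:R by rewrite mulr_ge0.
    rewrite expRN -/c => h.
    have : c * (1 - c^-1) <= c * (a * p * D%:R) by rewrite ler_wpM2l //; lra.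
    by rewrite mulrBr mulr1 divff //; apply: lt0r_neq0; lra.
  move=> /andP[h1 h2].
  have hy : `|y - E| <= c * E * (v * p + p * D%:R).
    have a2 : a ^+ 2 <= 1 by rewrite exprn_ile1.
    have k1 : (N%:R - D%:R) * (a * p) ^+ 2 <= v * p.
      rewrite exprMn /v -mulrA [p * p]mulrC -expr2.
      apply: (@le_trans _ _ (N%:R * (a ^+ 2 * p ^+ 2))).
        by rewrite ler_wpM2r ?mulr_ge0 ?exprn_ge0 // gerBl.
      by rewrite ler_wpM2l // ler_piMl // exprn_ge0.
    have k2 : a * p * D%:R <= p * D%:R by rewrite ler_wpM2r // ler_piMl.
    have cE : 0 <= c * E by rewrite mulr_ge0 //; lra.
    have k3 : (N%:R - D%:R) * (a * p) ^+ 2 * (c * E) <= v * p * (c * E).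
      by rewrite ler_wpM2r.
    have k4 : (c - 1) * E <= c * (p * D%:R) * E.
      rewrite ler_wpM2r //; apply: le_trans c2 _; rewrite ler_wpM2l //; lra.
    have k5 : 0 <= (c - 1) * E by rewrite mulr_ge0 //; lra.
    have k6 : 0 <= v * p * (c * E) by apply: mulr_ge0 => //; exact: mulr_ge0.
    have k7 : 0 <= c * (p * D%:R) * E by rewrite !mulr_ge0 //; lra.
    rewrite ler_norml; apply/andP; split; nra.
  have pF : p ^+ D * F <= v ^+ D.
    by rewrite /v exprMn mulrC ler_wpM2r // exprn_ge0.
  apply: le_trans (ler_pM _ _ pF hy) _; rewrite ?mulr_ge0 ?exprn_ge0 //.
  rewrite /catom -/E exprSr.
  have : 0 <= v ^+ D * E * p * (v + D%:R) by rewrite !mulr_ge0 ?exprn_ge0 ?addr_ge0.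
  move: (v ^+ D) => w hw; move: cD; nra.
rewrite mulrDr; apply: le_trans (lerD part1 part2).
by apply: le_trans (ler_normD _ _); rewrite addrA subrK.
Qed.

(** The limit of Ghat m N p as N grows with N p = v. *)
Definition Gfun m v : R :=
  1 + cal R m * catom 2^-1 0 v + cbe R m * catom 1 0 v + cc R m * catom (2 ^+ m) 0 v
  + cal1 R m * catom 2^-1 1 v + cbe1 R m * catom 1 1 v + cbe2 R m * catom 1 2 v
  + cga R m * catom 1 3 v.

Lemma coef_le10 m : [/\ `|cal R m| <= 10, `|cbe R m| <= 10, `|cc R m| <= 10,
  `|cal1 R m| <= 10 & [/\ `|cbe1 R m| <= 10, `|cbe2 R m| <= 10 & `|cga R m| <= 10]].
Proof.
have [h1 h2 h3] : [/\ 0 <= cal R m <= 4, -5 <= cbe R m <= 0 & -2 <= cal1 R m <= 0].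
  rewrite /cal /cal1 /cbe; case: m => [|m].
    rewrite expr0 (_ : 1 / (1 - 2^-1) ^+ 2 = 4); last by field.
    by rewrite (_ : 1 / (1 - 2^-1) = 2); [split; lra | field].
  have := @exp2_gt1 R m; move: (2 ^+ m.+1) => y y2; split.
  - by apply/andP; split; [rewrite divr_ge0 ?sqr_ge0 //; lra|
      rewrite ler_pdivrMr ?exprn_gt0; nra].
  - have y1 : 0 < y - 1 by lra.
    apply/andP; split.
      have : y / (y - 1) <= 2 by rewrite ler_pdivrMr; lra.
      have : 0 <= y / (2 * (y - 1) ^+ 3) by rewrite divr_ge0 ?mulr_ge0 ?exprn_ge0; lra.
      lra.
    rewrite subr_le0 ler_pdivrMr ?mulr_gt0 ?exprn_gt0 // -mulrA ler_peMr //; first lra.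
    rewrite mulrC -ler_pdivrMr ?invr_gt0 // invrK mul1r.
    have : 1 <= y - 1 by lra.
    by move: (y - 1) => z z1; rewrite !exprS expr0; nra.
  - have y1 : 0 < y - 2^-1 by lra.
    have : y / (y - 2^-1) <= 2 by rewrite ler_pdivrMr; lra.
    have : 0 <= y / (y - 2^-1) by rewrite divr_ge0; lra.
    lra.
have h4 : `|cc R m| <= 10 by rewrite ler_norml /cc; lra.
split=> //; try by rewrite ler_norml; lra.
rewrite /cbe1 /cbe2 /cga; case: m {h1 h2 h3 h4} => [|m].
  by split; rewrite ler_norml; lra.
have := @exp2_gt1 R m; move: (2 ^+ m.+1) => y y2.
have y1 : 0 < y - 1 by lra.
split; last by rewrite normr0.
- rewrite normrN ger0_norm ?divr_ge0 ?mulr_ge0 ?sqr_ge0 //; [|lra..].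
  by rewrite ler_pdivrMr ?mulr_gt0 ?exprn_gt0 //; nra.
- rewrite ger0_norm ?divr_ge0 ?mulr_ge0 //; [|lra..].
  by rewrite ler_pdivrMr ?mulr_gt0 //; nra.
Qed.

End Bounds.

(** * Limits of the coefficients and uniform error bounds *)

Section QBounds.
Variable R : realType.
Implicit Types (k m n N K : nat).

Lemma exp2VS n : 2 ^- n.+1 = 2 ^- n / 2 :> R.
Proof. by rewrite exprSr invfM. Qed.

Lemma exp2V_gt0 n : 0 < 2 ^- n :> R.
Proof. by rewrite invr_gt0 exp2_gt0. Qed.

Lemma exp2V_le1 n : 2 ^- n <= 1 :> R.
Proof. by rewrite invf_le1 ?exp2_gt0 ?exp2_ge1. Qed.

Lemma Qfin_le1 n : Qfin R n <= 1.
Proof.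
elim: n => [|n IH]; first by rewrite Qfin0.
rewrite QfinS mulr_ile1 // ?(ltW (Qfin_gt0 _ _)) //.
  by have := exp2V_lt1 R n; lra.
Qed.

Lemma Qfin_geS n : 4^-1 + 2 ^- n.+2 <= Qfin R n.+1.
Proof.
elim: n => [|n IH]; first by rewrite QfinS Qfin0 !exprS expr0; lra.
rewrite (QfinS _ n.+1) !exp2VS in IH *; have := exp2V_gt0 n.+1.
have := exp2V_lt1 R n; rewrite !exp2VS; move: (2 ^- n) IH => x IH x2 x0.
nra.
Qed.

Lemma Qfin_ge4 n : 4^-1 <= Qfin R n.
Proof.
case: n => [|n]; first by rewrite Qfin0; lra.
by have := Qfin_geS n; have := exp2V_gt0 n.+2; lra.
Qed.

Lemma Qfin_nonincreasing : nonincreasing_seq (Qfin R).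
Proof.
apply/nonincreasing_seqP => n; rewrite QfinS ler_piMr ?(ltW (Qfin_gt0 _ _)) //.
Qed.

Lemma is_cvg_Qfin : cvgn (Qfin R).
Proof.
apply: nonincreasing_is_cvgn Qfin_nonincreasing _.
by exists 4^-1 => _ [n _ <-]; exact: Qfin_ge4.
Qed.

Lemma Qinf_ge4 : 4^-1 <= Qinf R.
Proof. by apply: limr_ge is_cvg_Qfin _; apply: nearW => n; exact: Qfin_ge4. Qed.

Lemma Qinf_gt0 : 0 < Qinf R. Proof. by have := Qinf_ge4; lra. Qed.

Lemma Qinf_neq0 : Qinf R != 0. Proof. exact/lt0r_neq0/Qinf_gt0. Qed.

Lemma Qinf_le n : Qinf R <= Qfin R n.
Proof. exact: nonincreasing_cvgn_ge Qfin_nonincreasing is_cvg_Qfin n. Qed.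

Lemma Qinf_ge n : Qfin R n - 2 ^- n <= Qinf R.
Proof.
apply: limr_ge is_cvg_Qfin _; near=> j.
have nj : (n <= j)%N by near: j; exact: nbhs_infty_ge.
suff : Qfin R n - 2 ^- n <= Qfin R j - 2 ^- j by have := exp2V_gt0 j; lra.
have : nondecreasing_seq (fun i => Qfin R i - 2 ^- i).
  apply/nondecreasing_seqP => i; rewrite QfinS exp2VS.
  have := Qfin_le1 i; have := exp2V_gt0 i; nra.
exact.
Unshelve. all: by end_near. Qed.

Lemma invQ_diff i : `|(Qfin R i)^-1 - (Qinf R)^-1| <= 16 * 2 ^- i.
Proof.
have q4 := Qfin_ge4 i; have q4' := Qinf_ge4.
have h1 := Qinf_le i; have h2 := Qinf_ge i.
have -> : (Qfin R i)^-1 - (Qinf R)^-1 = - ((Qfin R i - Qinf R) / (Qfin R i * Qinf R)).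
  by field; rewrite Qinf_neq0 Qfin_neq0.
rewrite normrN ger0_norm ?divr_ge0 ?mulr_ge0 //; [|lra..].
rewrite ler_pdivrMr ?mulr_gt0 //; [|lra..].
have : 16^-1 <= Qfin R i * Qinf R by nra.
have := exp2V_gt0 i; move: (Qfin R i * _) => z; nra.
Qed.

Lemma invQ_le n : 0 <= (Qfin R n)^-1 <= 4.
Proof.
rewrite invr_ge0 (ltW (Qfin_gt0 _ _)) /= -[leRHS]invrK lef_pV2 ?Qfin_ge4 //.
  by rewrite posrE Qfin_gt0.
by rewrite posrE; lra.
Qed.

Lemma invQinf_le : 0 <= (Qinf R)^-1 <= 4.
Proof.
rewrite invr_ge0 (ltW Qinf_gt0) /= -[leRHS]invrK lef_pV2 ?Qinf_ge4 //.
  by rewrite posrE Qinf_gt0.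
by rewrite posrE; lra.
Qed.

(** 2 ^ 12 = 4 * 2 ^ 10, where 4 bounds 1 / Q_m and 10 is the maximum of
    5 m - m (m + 1) / 2. *)
Definition Ca : R := 2 ^+ 12.

Lemma Ca_ge0 : 0 <= Ca. Proof. exact: exprn_ge0. Qed.

Lemma coefa_le m : `|coefa R m| <= Ca * 32 ^- m.
Proof.
rewrite /coefa !normrM normrX normrN1 expr1n mul1r.
have /andP[q0 q1] := invQ_le m.
rewrite (ger0_norm q0) ger0_norm ?invr_ge0 ?exprn_ge0 //.
have h : (5 * m <= 'C(m.+1, 2) + 10)%N.
  move: m {q0 q1}; do 5 case=> [//|]; elim=> [//|m IH].
  by rewrite binS bin1; lia.
have e : 2 ^- 'C(m.+1, 2) <= 2 ^+ 10 * 32 ^- m :> R.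
  rewrite -ler_pdivrMl ?exp2_gt0 // mulrC.
  have -> : 32 = 2 ^+ 5 :> R by rewrite !exprS expr0; lra.
  rewrite -invfM -exprD -exprM lef_pV2 ?posrE ?exp2_gt0 //.
  by rewrite ler_weXn2l ?ler1n.
have -> : Ca * 32 ^- m = (2 ^+ 10 * 32 ^- m) * 4 :> R by rewrite /Ca !exprS expr0; ring.
by apply: ler_pM => //; rewrite invr_ge0 exprn_ge0.
Qed.

Lemma sum_geom_le (r : R) K : 0 <= r -> r <= 2^-1 -> \sum_(m < K) r ^+ m <= 2.
Proof.
move=> r0 r2; suff : (1 - r) * \sum_(m < K) r ^+ m <= 1.
  have : 0 <= \sum_(m < K) r ^+ m by apply: sumr_ge0 => m _; rewrite exprn_ge0.
  move: (\sum_(m < K) _) => s; nra.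
have -> : (1 - r) * \sum_(m < K) r ^+ m = 1 - r ^+ K.
  elim: K => [|K IH]; first by rewrite big_ord0 expr0; lra.
  by rewrite big_ord_recr mulrDr IH exprS /=; ring.
by have := exprn_ge0 K r0; lra.
Qed.

Lemma sum_coefa8 K : \sum_(m < K) `|coefa R m| * 8 ^+ m <= (2 * Ca).
Proof.
apply: (@le_trans _ _ (\sum_(m < K) Ca * (4^-1) ^+ m)).
  apply: ler_sum => m _.
  have -> : Ca * 4^-1 ^+ m = (Ca * 32 ^- m) * 8 ^+ m :> R.
    by rewrite -mulrA -[32 ^- m]exprVn -exprMn; congr (_ * _ ^+ _); lra.
  by rewrite ler_wpM2r ?exprn_ge0 // coefa_le.
have : \sum_(m < K) (4^-1 : R) ^+ m <= 2 by apply: sum_geom_le; lra.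
by rewrite -mulr_sumr => h; rewrite [leRHS]mulrC ler_wpM2l // Ca_ge0.
Qed.

Definition Ainf m : R := coefa R m / Qinf R.

Lemma coefA_le k m : `|coefA R k m| <= 4 * `|coefa R m|.
Proof.
rewrite /coefA; case: ifP => _; last by rewrite normr0 mulr_ge0.
by have /andP[q0 q1] := invQ_le (k - m); rewrite normrM (ger0_norm q0) mulrC ler_wpM2r.
Qed.

Lemma Ainf_le m : `|Ainf m| <= 4 * `|coefa R m|.
Proof.
by have /andP[q0 q1] := invQinf_le; rewrite normrM (ger0_norm q0) mulrC ler_wpM2r.
Qed.

Lemma coefA_Ainf k m :
  `|coefA R k m - Ainf m| <= 16 * 2 ^+ m * 2 ^- k * `|coefa R m|.
Proof.
rewrite /coefA; case: leqP => mk.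
  rewrite -mulrBr normrM mulrC ler_wpM2r //; apply: le_trans (invQ_diff _) _.
  rewrite -mulrA ler_wpM2l // -{2}(subnK mk) exprD invfM mulrCA divff ?mulr1 //.
rewrite sub0r normrN; apply: le_trans (Ainf_le m) _; rewrite ler_wpM2r //.
have : 1 <= 2 ^+ m / 2 ^+ k :> R.
  by rewrite ler_pdivlMr ?exp2_gt0 // mul1r ler_weXn2l ?ler1n // ltnW.
rewrite -mulrA; lra.
Qed.

Lemma sum_coefa_tail K n :
  \sum_(K <= m < n) `|coefa R m| <= (2 * Ca) * 8 ^- K.
Proof.
have [nK|/ltnW Kn] := leqP n K.
  rewrite big_geq //; apply: mulr_ge0; last by rewrite invr_ge0 exprn_ge0.
  by rewrite mulr_ge0 // Ca_ge0.
rewrite ler_pdivlMr ?exprn_gt0 // mulr_suml.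
apply: le_trans (sum_coefa8 n).
rewrite -(big_mkord predT (fun m => `|coefa R m| * 8 ^+ m)) /=.
rewrite (big_cat_nat (leq0n K) Kn) /=.
rewrite -[leLHS]add0r lerD //; first by apply: sumr_ge0 => m _; rewrite mulr_ge0 // exprn_ge0.
rewrite big_nat [leRHS]big_nat; apply: ler_sum => m /andP[Km _].
by rewrite ler_wpM2l // ler_weXn2l ?ler1n.
Qed.

Lemma exp2D3 K : 2 ^- (3 * K) = 8 ^- K :> R.
Proof. by rewrite exprM; congr (_ ^+ _)^-1; rewrite !exprS expr0; lra. Qed.

(** The limit of sum_coefA: the weights Ainf m add up to 1. *)
Lemma sum_Ainf K : `|1 - \sum_(m < K) Ainf m| <= (40 * Ca) * 8 ^- K.
Proof.
(* With this k, the rate 2 ^ - k of coefA_Ainf is 8 ^ - K. *)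
pose k := (3 * K)%N; have Kk : (K <= k.+1)%N by rewrite /k; lia.
rewrite -[X in `|X - _|](sum_coefA R k) -(big_mkord predT (coefA R k)) -(big_mkord predT Ainf) /=.
rewrite (big_cat_nat (leq0n K) Kk) /= addrAC -sumrB.
apply: le_trans (ler_normD _ _) _.
have h1 : `|\sum_(0 <= m < K) (coefA R k m - Ainf m)| <= 16 * (2 * Ca) * 8 ^- K.
  apply: le_trans (ler_norm_sum _ _ _) _.
  apply: (@le_trans _ _ (\sum_(0 <= m < K) (16 * 8 ^- K) * (`|coefa R m| * 8 ^+ m))).
    apply: ler_sum => m _; apply: le_trans (coefA_Ainf k m) _; rewrite exp2D3.
    have : 2 ^+ m <= 8 ^+ m :> R by rewrite lerXn2r ?nnegrE //; lra.
    have a0 : 0 <= 16 * 8 ^- K * `|coefa R m| :> R.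
      by rewrite !mulr_ge0 // invr_ge0 exprn_ge0.
    move=> /(ler_wpM2l a0); lra.
  rewrite -mulr_sumr big_mkord [leRHS]mulrAC ler_wpM2l ?sum_coefa8 //.
have h2 : `|\sum_(K <= m < k.+1) coefA R k m| <= 4 * ((2 * Ca) * 8 ^- K).
  apply: le_trans (ler_norm_sum _ _ _) _.
  apply: (@le_trans _ _ (\sum_(K <= m < k.+1) 4 * `|coefa R m|)).
    by apply: ler_sum => m _; exact: coefA_le.
  by rewrite -mulr_sumr ler_wpM2l // sum_coefa_tail.
have : 0 <= Ca * 8 ^- K by rewrite mulr_ge0 ?Ca_ge0 // invr_ge0 exprn_ge0.
move: h1 h2; lra.
Qed.

End QBounds.

Section MainBound.
Variable R : realType.
Implicit Types (a v : R) (k m n N K : nat).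

Lemma atom_mu d : exists2 C : R, 0 <= C & forall a k N, 2^-1 <= a <= 1 -> (0 < N)%N ->
  `|atom a d N (2 ^- k) - catom a d (N%:R * 2 ^- k)| <=
    C * (2 ^- k * mu (N%:R * 2 ^- k)).
Proof.
have p0 k := @exp2V_gt0 R k; have p1 k := @exp2V_le1 R k.
have v0 k N : (0 < N)%N -> 0 < N%:R * 2 ^- k :> R.
  by move=> N0; rewrite mulr_gt0 // ltr0n.
case: d => [|d].
  exists (cmu R 0) => [|a k N /andP[a2 a1] N0]; first exact: cmu_ge0.
  apply: le_trans (atom_catom0 _ _ _ _) _; [lra | exact: ltW| |].
    by rewrite mulr_ile1 // ltW //; lra.
  have := catom_mu 0 a2 (v0 k N N0); have := catom_ge0 a 1 (ltW (v0 k N N0)).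
  move: (catom _ _ _) (mu _) => c u c0 cu.
  have a21 : a ^+ 2 <= 1 by rewrite exprn_ile1 //; lra.
  rewrite -mulrA mulrCA [leRHS]mulrCA ler_wpM2l ?(ltW (p0 k)) //.
  by apply: le_trans cu; rewrite ler_piMl.
exists (expR d.+1%:R * (cmu R d.+1 + d.+1%:R * cmu R d) + (d.+1 * d)%:R * cmu R d.-1).
  apply: addr_ge0; last by rewrite mulr_ge0 ?cmu_ge0.
  rewrite mulr_ge0 ?expR_ge0 //; apply: addr_ge0; first exact: cmu_ge0.
  by rewrite mulr_ge0 ?cmu_ge0.
move=> a k N /andP[a2 a1] N0.
apply: le_trans (atom_catomS _ _ _ _ _ _) _; [lra| exact: a1| exact: ltW|exact: p1|].
rewrite [leRHS]mulrCA ler_wpM2l ?(ltW (p0 k)) // mulrDl lerD //.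
  rewrite -mulrA ler_wpM2l ?expR_ge0 // mulrDl lerD ?catom_mu ?v0 //.
  by rewrite -mulrA ler_wpM2l // catom_mu ?v0.
case: d => [|d]; first by rewrite muln0 !mul0r.
by rewrite -mulrA ler_wpM2l // catom_mu ?v0.
Qed.

Lemma mul_bound (c x b : R) : `|c| <= 10 -> `|x| <= b -> - (10 * b) <= c * x <= 10 * b.
Proof.
by move=> c10 xb; rewrite -ler_norml normrM ler_pM.
Qed.

Lemma half_in : (2^-1 : R) <= (2^-1 : R) <= 1. Proof. by apply/andP; split; lra. Qed.
Lemma one_in : (2^-1 : R) <= (1 : R) <= 1. Proof. by apply/andP; split; lra. Qed.

Lemma pow2_le4 m : 2 ^+ m <= 4 ^+ m :> R.
Proof. by rewrite lerXn2r ?nnegrE //; lra. Qed.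

Lemma pow4_ge1 m : 1 <= 4 ^+ m :> R.
Proof. by rewrite exprn_ege1 // ler1n. Qed.

(** The factor 4 ^ m comes from the atom of rate 2 ^ m. *)
Lemma Ghat_Gfun : exists2 C : R, 0 <= C & forall m k N, (m <= k)%N -> (0 < N)%N ->
  `|Ghat m N (2 ^- k) - Gfun m (N%:R * 2 ^- k)| <=
    C * 4 ^+ m * (2 ^- k * mu (N%:R * 2 ^- k)).
Proof.
have [C0 C00 h0] := atom_mu 0; have [C1 C10 h1] := atom_mu 1.
have [C2 C20 h2] := atom_mu 2; have [C3 C30 h3] := atom_mu 3.
exists (10 * (2 * C0 + cmu R 0 + 2 * C1 + C2 + C3)).
  by rewrite mulr_ge0 // !addr_ge0 // ?mulr_ge0 // cmu_ge0.
move=> m k N mk N0; have [b1 b2 b3 b4 [b5 b6 b7]] := coef_le10 R m.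
have p0 := @exp2V_gt0 R k.
have v0 : 0 < N%:R * 2 ^- k :> R by rewrite mulr_gt0 // ltr0n.
have cm : `|atom (2 ^+ m) 0 N (2 ^- k) - catom (2 ^+ m) 0 (N%:R * 2 ^- k)| <=
   cmu R 0 * 4 ^+ m * (2 ^- k * mu (N%:R * 2 ^- k)).
  apply: le_trans (atom_catom0 _ _ _ _) _; [exact: exprn_ge0|exact: ltW| |].
    by rewrite ler_pdivrMr ?exp2_gt0 // mul1r ler_weXn2l ?ler1n.
  have := @catom_mu R (2 ^+ m) 0 _ _ v0.
  have e2 : 2^-1 <= 2 ^+ m :> R by have := exp2_ge1 R m; lra.
  move=> /(_ e2); rewrite -exprM mulnC exprM (_ : 2 ^+ 2 = 4 :> R); last by rewrite expr2; lra.
  move: (catom _ _ _) (mu _) => c u cu.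
  have : 4 ^+ m * 2 ^- k * c <= 4 ^+ m * 2 ^- k * (cmu R 0 * u).
    by rewrite ler_wpM2l // mulr_ge0 ?exprn_ge0 // ltW.
  lra.
have {}h0 a := h0 a k N; have {}h1 a := h1 a k N.
have {}h2 a := h2 a k N; have {}h3 a := h3 a k N.
have := mul_bound b1 (h0 _ half_in N0); have := mul_bound b2 (h0 _ one_in N0).
have := mul_bound b3 cm; have := mul_bound b4 (h1 _ half_in N0).
have := mul_bound b5 (h1 _ one_in N0); have := mul_bound b6 (h2 _ one_in N0).
have := mul_bound b7 (h3 _ one_in N0); rewrite /Ghat /Gfun.
have pu0 : 0 <= (2 ^- k : R) * mu (N%:R * 2 ^- k).
  by rewrite mulr_ge0 ?mu_ge0 // ltW.
have m4 := pow4_ge1 m.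
have up (C : R) : 0 <= C -> C * (2 ^- k * mu (N%:R * 2 ^- k)) <=
    C * (4 ^+ m * (2 ^- k * mu (N%:R * 2 ^- k))).
  by move=> c0; rewrite ler_wpM2l // ler_peMl.
move=> {h0 h1 h2 h3 cm b1 b2 b3 b4 b5 b6 b7 p0}.
have := up _ C00; have := up _ C10; have := up _ C20; have := up _ C30.
rewrite -!(mulrA _ (4 ^+ m)) => {up m4 pu0}.
move: (mu _) => u.
move: (cal R m) (cbe R m) (cc R m) (cal1 R m) (cbe1 R m) (cbe2 R m) (cga R m).
move: (atom _ 0 _ _) (atom _ 0 _ _) (atom _ 0 _ _) (atom _ 1 _ _) (atom _ 1 _ _)
  (atom _ 2 _ _) (atom _ 3 _ _).
move: (catom _ 0 _) (catom _ 0 _) (catom _ 0 _) (catom _ 1 _) (catom _ 1 _)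
  (catom _ 2 _) (catom _ 3 _).
move=> x1 x2 x3 x4 x5 x6 x7 y1 y2 y3 y4 y5 y6 y7 c1 c2 c3 c4 c5 c6 c7.
move: (cmu R 0) => c k3 k2 k1 k0 /andP[? ?] /andP[? ?] /andP[? ?] /andP[? ?]
  /andP[? ?] /andP[? ?] /andP[? ?].
by rewrite ler_norml; apply/andP; split; lra.
Qed.

(** Gfun m goes from 0 at v = 0 to 1 at infinity: compared with a step it is
    summable over the levels in both directions. *)
Lemma Gfun_chi : exists2 C : R, 0 <= C & forall m v, 0 < v ->
  `|Gfun m v - (1 <= v)%R%:R| <= C * 4 ^+ m * mu v.
Proof.
exists (10 * (18 + 5 * cmu R 0 + cmu R 1 + cmu R 2)).
  by rewrite mulr_ge0 // !addr_ge0 ?mulr_ge0 // cmu_ge0.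
move=> m v v0; have [b1 b2 b3 b4 [b5 b6 b7]] := coef_le10 R m.
have h2 : 2^-1 <= 2^-1 :> R by []. have h1 : 2^-1 <= 1 :> R by lra.
have u0 := mu_ge0 (ltW v0); have m4 := pow4_ge1 m; have m2 := pow2_le4 m.
have c0 := cmu_ge0 R 0; have c1 := cmu_ge0 R 1; have c2 := cmu_ge0 R 2.
have uU : mu v <= 4 ^+ m * mu v by rewrite ler_peMl.
have nc a d : 2^-1 <= a -> `|catom a d.+1 v| <= cmu R d * mu v.
  by move=> a2; rewrite ger0_norm ?catom_ge0 ?(ltW v0) // catom_mu.
have up (C : R) : 0 <= C -> C * mu v <= C * (4 ^+ m * mu v) by move=> ?; rewrite ler_wpM2l.
have := mul_bound b4 (nc _ 0%N h2); have := mul_bound b5 (nc _ 0%N h1).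
have := mul_bound b6 (nc _ 1%N h1); have := mul_bound b7 (nc _ 2%N h1).
have e2 : 2^-1 <= 2 ^+ m :> R by have := exp2_ge1 R m; lra.
have [v1|v1] := leP 1 v.
  have ec a : 2^-1 <= a -> `|catom a 0 v| <= cmu R 0 * mu v.
    by move=> a2; rewrite ger0_norm ?catom_ge0 ?(ltW v0) // expRN_mu.
  have := mul_bound b1 (ec _ h2); have := mul_bound b2 (ec _ h1).
  have := mul_bound b3 (ec _ e2).
  move=> /andP[? ?] /andP[? ?] /andP[? ?] /andP[? ?] /andP[? ?] /andP[? ?] /andP[? ?].
  have := up _ c0; have := up _ c1; have := up _ c2.
  rewrite -(mulrA _ (4 ^+ m)) /Gfun /= mulr1n ler_norml => ? ? ?; apply/andP; split; lra.
have v6 : v <= 6 * mu v.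
  by have := @le_mu R 1 v v v0 ler01; rewrite mul1r mulr1; apply=> //; nra.
have ec a : 0 <= a -> `|catom a 0 v - 1| <= a * v.
  move=> a0; rewrite /catom expr0 mul1r distrC.
  have /andP[e1 e3] := expRN_sub1 (mulr_ge0 a0 (ltW v0)).
  by rewrite ger0_norm.
have h0 : 0 <= 2^-1 :> R by lra.
have p0 : 0 <= 2 ^+ m :> R by rewrite exprn_ge0.
have := mul_bound b1 (ec _ h0); have := mul_bound b2 (ec 1 ler01).
have := mul_bound b3 (ec _ p0) => /andP[? ?] /andP[? ?] /andP[? ?].
move=> /andP[? ?] /andP[? ?] /andP[? ?] /andP[? ?].
have V1 : 2 ^+ m * v <= 6 * (4 ^+ m * mu v).
  rewrite mulrCA; apply: le_trans (_ : 4 ^+ m * v <= _); first by rewrite ler_wpM2r // ltW.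
  by rewrite ler_wpM2l // exprn_ge0.
have := up _ c0; have := up _ c1; have := up _ c2; rewrite /= mulr0n subr0 -(mulrA _ (4 ^+ m)) => ? ? ?.
have -> : Gfun m v = cal R m * (catom 2^-1 0 v - 1) + cbe R m * (catom 1 0 v - 1)
  + cc R m * (catom (2 ^+ m) 0 v - 1) + cal1 R m * catom 2^-1 1 v
  + cbe1 R m * catom 1 1 v + cbe2 R m * catom 1 2 v + cga R m * catom 1 3 v.
  by rewrite /Gfun /cc; ring.
by rewrite ler_norml; apply/andP; split; lra.
Qed.

End MainBound.

(** * From the levels of the tree to a two-sided sum *)

Section LseqPhi.
Variable R : realType.
Implicit Types (k m n N K : nat).

(** The limit form of lseqE, completed by levels of negative index so that the sum
    over the levels becomes two-sided. *)
Definition Phi K N : R := \sum_(m < K) Ainf R m *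
  (\sum_(k < K) 2 ^+ k * Gfun m (N%:R * 2 ^- k) +
   \sum_(j < K) 2 ^- j.+1 * Gfun m (N%:R * 2 ^+ j.+1)).

Lemma pow2_pow4 m : 2 ^+ m * 4 ^+ m = 8 ^+ m :> R.
Proof. by rewrite -exprMn; congr (_ ^+ _); lra. Qed.

Lemma widen_coefA k K (F : nat -> R) : (k < K)%N ->
  \sum_(m < k.+1) coefA R k m * F m = \sum_(m < K) coefA R k m * F m.
Proof.
move=> kK; rewrite (big_ord_widen K (fun m => coefA R k m * F m)) // big_mkcond /=.
by apply: eq_bigr => m _; rewrite /coefA ltnS; case: (m <= k)%N; rewrite ?mul0r.
Qed.

(** As both families of coefficients add up to 1, they may be exchanged after the
    step function chi, which is the same for all m, has been subtracted from Gfun m;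
    the difference is small far from level log2 N. *)
Lemma level_bound : exists2 C : R, 0 <= C & forall k K N, (k < K)%N -> (0 < N)%N ->
  `|\sum_(m < k.+1) coefA R k m * Ghat m N (2 ^- k)
    - \sum_(m < K) Ainf R m * Gfun m (N%:R * 2 ^- k)| <=
  C * (2 ^- k * mu (N%:R * 2 ^- k)) + 40 * Ca R * 8 ^- K.
Proof.
have [C1 C10 h1] := Ghat_Gfun R; have [C2 C20 h2] := Gfun_chi R.
exists ((4 * C1 + 16 * C2) * (2 * Ca R)).
  by rewrite mulr_ge0 ?addr_ge0 ?mulr_ge0 ?Ca_ge0.
move=> k K N kK N0; set v := N%:R * 2 ^- k; set u := 2 ^- k * mu v.
have p0 := @exp2V_gt0 R k.
have v0 : 0 < v by rewrite mulr_gt0 // ltr0n.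
have u0 : 0 <= u by rewrite mulr_ge0 ?mu_ge0 // ltW.
pose chi : R := (1 <= v)%R%:R.
have chi1 : `|chi| <= 1 by rewrite /chi; case: (1 <= v); rewrite ?normr1 ?normr0.
rewrite (widen_coefA (fun m => Ghat m N (2 ^- k)) kK).
have -> : \sum_(m < K) coefA R k m * Ghat m N (2 ^- k) - \sum_(m < K) Ainf R m * Gfun m v =
  \sum_(m < K) (coefA R k m * (Ghat m N (2 ^- k) - Gfun m v) +
    (coefA R k m - Ainf R m) * (Gfun m v - chi)) + chi * (1 - \sum_(m < K) Ainf R m).
  rewrite -[X in chi * (X - _)](sum_coefA R k).
  under [X in chi * (X - _)]eq_bigr do rewrite -[coefA _ _ _]mulr1.
  rewrite (widen_coefA (fun=> 1) kK) -!sumrB mulr_sumr -big_split /=.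
  by apply: eq_bigr => m _; ring.
apply: le_trans (ler_normD _ _) _; apply: lerD; last first.
  rewrite normrM -[leRHS]mul1r; apply: ler_pM => //; exact: sum_Ainf.
apply: le_trans (ler_norm_sum _ _ _) _.
have -> : (4 * C1 + 16 * C2) * (2 * Ca R) * u = (4 * C1 + 16 * C2) * u * (2 * Ca R).
  by ring.
apply: (@le_trans _ _ (\sum_(m < K) (4 * C1 + 16 * C2) * u * (`|coefa R m| * 8 ^+ m)));
  last first.
  rewrite -mulr_sumr ler_wpM2l ?sum_coefa8 //.
  by rewrite mulr_ge0 // addr_ge0 // mulr_ge0.
apply: ler_sum => m _.
have a0 : 0 <= `|coefa R m| by [].
have m2 : 1 <= 2 ^+ m :> R by exact: exp2_ge1.
have q0 : 0 < 4 ^+ m :> R by rewrite exprn_gt0.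
rewrite -pow2_pow4.
apply: le_trans (ler_normD _ _) _; set B := `|coefa R m| * _.
have -> : (4 * C1 + 16 * C2) * u * B = 4 * C1 * u * B + 16 * C2 * u * B by ring.
apply: lerD; rewrite /B {B}.
  rewrite normrM.
  have [mk|mk] := leqP m k; last first.
    rewrite /coefA leqNgt mk /= normr0 mul0r; apply: mulr_ge0.
      by apply: mulr_ge0 => //; apply: mulr_ge0.
    by apply: mulr_ge0 => //; apply: mulr_ge0; lra.
  apply: le_trans (ler_pM _ _ (coefA_le R k m) (h1 m k N mk N0)) _ => //.
  rewrite -/v -/u.
  have h : 4 * C1 * u * (`|coefa R m| * 4 ^+ m) <= 4 * C1 * u * (`|coefa R m| * (2 ^+ m * 4 ^+ m)).
    have h0 : 0 <= 4 * C1 * u by apply: mulr_ge0 => //; apply: mulr_ge0.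
    by rewrite (ler_wpM2l h0) // (ler_wpM2l a0) // ler_peMl // ltW.
  apply: le_trans h; rewrite le_eqVlt; apply/orP; left; apply/eqP; ring.
rewrite normrM.
apply: le_trans (ler_pM _ _ (coefA_Ainf R k m) (h2 m v v0)) _ => //.
by rewrite /u le_eqVlt; apply/orP; left; apply/eqP; ring.
Qed.

(** The errors of level_bound, times 2 ^ k, are mu (N / 2 ^ k) up to a constant, and
    these add up to O(1); the levels of negative index in Phi weigh 2 ^ - j. *)
Lemma lseq_Phi : exists C : R, forall K N, (0 < N)%N ->
  `|lseq R K N - Phi K N| <= C.
Proof.
have [C C0 hC] := level_bound; have [C2 C20 h2] := Gfun_chi R.
exists (C + 40 * Ca R + 8 * (1 + C2) * (2 * Ca R)) => K N N0.
have N1 : 0 < N%:R :> R by rewrite ltr0n.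
have -> : Phi K N = \sum_(k < K) 2 ^+ k * (\sum_(m < K) Ainf R m * Gfun m (N%:R * 2 ^- k))
  + \sum_(j < K) 2 ^- j.+1 * (\sum_(m < K) Ainf R m * Gfun m (N%:R * 2 ^+ j.+1)).
  rewrite /Phi; under eq_bigr do rewrite mulrDr.
  rewrite big_split /=; congr (_ + _).
    under eq_bigr do rewrite mulr_sumr.
    rewrite exchange_big /=; apply: eq_bigr => k _; rewrite mulr_sumr.
    by apply: eq_bigr => m _; rewrite mulrCA.
  under eq_bigr do rewrite mulr_sumr.
  rewrite exchange_big /=; apply: eq_bigr => k _; rewrite mulr_sumr.
  by apply: eq_bigr => m _; rewrite mulrCA.
rewrite opprD addrA; apply: le_trans (ler_normB _ _) _; apply: lerD.
  rewrite lseqE -sumrB; apply: le_trans (ler_norm_sum _ _ _) _.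
  apply: (@le_trans _ _ (\sum_(k < K) (C * mu (N%:R / 2 ^+ k) + 40 * Ca R * 8 ^- K * 2 ^+ k))).
    apply: ler_sum => k _; rewrite -mulrBr normrM ger0_norm ?exprn_ge0 //.
    apply: le_trans (ler_wpM2l _ (hC k K N (ltn_ord k) N0)) _; first exact: exprn_ge0.
    rewrite mulrDr mulrCA [2 ^+ k * (2 ^- k * _)]mulrA divff ?mul1r ?expf_neq0 //.
    by rewrite [2 ^+ k * _]mulrC.
  rewrite big_split /= -!mulr_sumr; apply: lerD.
    by rewrite -[leRHS]mulr1 ler_wpM2l // sum_mu.
  rewrite -mulrA -[leRHS]mulr1 ler_wpM2l ?mulr_ge0 ?Ca_ge0 //.
  have : \sum_(k < K) 2 ^+ k <= 2 ^+ K :> R.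
    elim: (K) => [|n IH]; first by rewrite big_ord0 expr0.
    by rewrite big_ord_recr exprS /=; lra.
  have : 2 ^+ K <= 8 ^+ K :> R by rewrite lerXn2r ?nnegrE //; lra.
  by rewrite mulrC ler_pdivrMr ?exprn_gt0 // mul1r => ? /le_trans; apply.
have Gle m v : 0 < v -> `|Gfun m v| <= (1 + C2) * 8 ^+ m :> R.
  move=> v0; have := h2 m v v0; have := mu_le1 (ltW v0); have := mu_ge0 (ltW v0).
  have -> : Gfun m v = (Gfun m v - (1 <= v)%R%:R) + (1 <= v)%R%:R by rewrite subrK.
  rewrite addrK => u0 u1 h; apply: le_trans (ler_normD _ _) _.
  rewrite addrC mulrDl mul1r; apply: lerD.
    apply: (@le_trans _ _ 1); last by rewrite exprn_ege1 // ler1n.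
    by case: (1 <= v)%R; rewrite ?normr1 ?normr0.
  apply: le_trans h _; rewrite -mulrA ler_wpM2l // -pow2_pow4 mulrC.
  by rewrite ler_wpM2r ?exprn_ge0 //; apply: le_trans u1 _; exact: exp2_ge1.
apply: le_trans (ler_norm_sum _ _ _) _.
apply: (@le_trans _ _ (\sum_(j < K) (4 * (1 + C2) * (2 * Ca R)) * 2^-1 ^+ j)).
  apply: ler_sum => j _; rewrite normrM mulrC; apply: ler_pM => //; last first.
    rewrite ger0_norm ?invr_ge0 ?exprn_ge0 // -exprVn exprS.
    by have := @exp2V_gt0 R j; rewrite -exprVn; lra.
  apply: le_trans (ler_norm_sum _ _ _) _.
  apply: le_trans (ler_wpM2l _ (sum_coefa8 R K)); last by rewrite mulr_ge0 // addr_ge0.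
  rewrite mulr_sumr; apply: ler_sum => m _; rewrite normrM.
  rewrite mulrACA; apply: ler_pM => //; first exact: Ainf_le.
  by apply: Gle; rewrite mulr_gt0 // exp2_gt0.
have : \sum_(j < K) (2^-1 : R) ^+ j <= 2 by apply: sum_geom_le; lra.
rewrite -mulr_sumr => s2; apply: le_trans (ler_wpM2l _ s2) _.
  by rewrite mulr_ge0 ?mulr_ge0 ?Ca_ge0 ?addr_ge0.
by rewrite le_eqVlt; apply/orP; left; apply/eqP; ring.
Qed.

End LseqPhi.

(** * Integrals over a period *)

Section MeanOverPeriod.
Variable R : realType.
Implicit Types (f g F : R -> R) (x s c : R).

Definition mean01 f : R := (\int[lebesgue_measure]_(x in `[0, 1]) f x)%R.

Lemma integrable_segment f (a b : R) : continuous f ->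
  lebesgue_measure.-integrable `[a, b] (EFin \o f).
Proof.
move=> cf; apply: continuous_compact_integrable; first exact: segment_compact.
exact: continuous_subspaceT.
Qed.

Lemma is_derive_continuous F x (d : R) : is_derive x 1 F d -> {for x, continuous F}.
Proof. by move=> [dF _]; apply/differentiable_continuous/derivable1_diffP. Qed.

Lemma mean01D f g : continuous f -> continuous g ->
  mean01 (fun x => f x + g x) = mean01 f + mean01 g.
Proof. by move=> cf cg; rewrite /mean01 RintegralD //; exact: integrable_segment. Qed.

Lemma mean01Z c f : continuous f -> mean01 (fun x => c * f x) = c * mean01 f.
Proof. by move=> cf; rewrite /mean01 RintegralZl //; exact: integrable_segment. Qed.

Lemma eq_mean01 f g : f =1 g -> mean01 f = mean01 g.
Proof. by move=> fg; congr mean01; apply/funext. Qed.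

Lemma mean01_le f g : continuous f -> continuous g ->
  (forall x, 0 <= x -> x <= 1 -> f x <= g x) -> mean01 f <= mean01 g.
Proof.
move=> cf cg fg; apply: le_Rintegral => //; try exact: integrable_segment.
by move=> x /=; rewrite in_itv /= => /andP[x0 x1]; exact: fg.
Qed.

Lemma mean01_FTC f F : continuous f ->
  (forall x, 0 <= x -> x <= 1 -> is_derive x 1 F (f x)) -> mean01 f = F 1 - F 0.
Proof.
move=> cf dF; rewrite /mean01 /Rintegral (@continuous_FTC2 _ f F) //.
- exact: continuous_subspaceT.
- split.
  + move=> x; rewrite in_itv /= => /andP[x0 x1].
    by have [] := dF x (ltW x0) (ltW x1).
  + by apply/cvg_at_right_filter/is_derive_continuous/dF.
  + by apply/cvg_at_left_filter/is_derive_continuous/dF.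
- move=> x; rewrite in_itv /= => /andP[x0 x1].
  by rewrite derive1E; have [_] := dF x (ltW x0) (ltW x1).
Qed.

Lemma continuous_cst c : continuous (fun _ : R => c).
Proof. by move=> x; apply: cvg_cst. Qed.

Lemma mean01_cst c : mean01 (fun=> c) = c.
Proof.
have dc x : 0 <= x -> x <= 1 -> is_derive x 1 (fun x => c * x) c.
  by move=> _ _; apply: is_derive_eq; rewrite /GRing.scale /= mulr1.
by rewrite (mean01_FTC (@continuous_cst c) dc) mulr1 mulr0 subr0.
Qed.

Lemma mean01_norm f c : continuous f -> (forall x, 0 <= x -> x <= 1 -> `|f x| <= c) ->
  `|mean01 f| <= c.
Proof.
move=> cf fc; have h x : 0 <= x -> x <= 1 -> - c <= f x <= c.
  by move=> x0 x1; have := fc x x0 x1; rewrite ler_norml.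
rewrite ler_norml -[X in X <= _](mean01_cst (- c)) -[X in _ && (_ <= X)](mean01_cst c).
by apply/andP; split; apply: mean01_le => //; try exact: continuous_cst;
  move=> x x0 x1; have /andP[] := h x x0 x1.
Qed.

Lemma antiderivative f (a : R) : continuous f ->
  exists F : R -> R, forall x, a < x -> is_derive x 1 F (f x).
Proof.
move=> cf; exists (fun y => (\int[lebesgue_measure]_(t in `[a, y]) f t)%R) => x ax.
have xu : x < x + 1 by lra.
have [d1 d2] := continuous_FTC1_closed xu (integrable_segment a (x + 1) cf) ax (cf x).
by split; [exact: d1|rewrite -derive1E d2].
Qed.

(** If F is an antiderivative of the periodic f then F (y + 1) - F y is constant. *)
Lemma mean01_shift f s : continuous f -> (forall x, f (x + 1) = f x) ->
  mean01 (fun x => f (x + s)) = mean01 f.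
Proof.
(* A base point to the left of all the points at which F is used. *)
move=> cf pf; pose a := Num.min 0 s - 1.
have a0 : a < 0 by rewrite /a ltrBlDr add0r gt_min ltr01.
have as' : a < s by rewrite /a ltrBlDr gt_min orbC ltrDl ltr01.
have [F dF] := antiderivative a cf.
have cfs : continuous (fun x => f (x + s)).
  by move=> x; apply: continuous_comp; [apply: cvgD; [exact: cvg_id|exact: cvg_cst]|exact: cf].
have dshift s' x : a < x + s' -> is_derive x 1 (fun y => F (y + s')) (f (x + s')).
  move=> h; have d1 := dF _ h.
  have d2 : is_derive x (1 : R) (fun y => y + s') 1.
    by apply: is_derive_eq; rewrite addr0.
  have := @is_derive1_comp _ F (fun y => y + s') x _ _ d1 d2.
  by rewrite mulr1.
have d1 x : 0 <= x -> x <= 1 -> is_derive x 1 (fun y => F (y + s)) (f (x + s)).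
  by move=> x0 _; apply: dshift; lra.
have d2 x : 0 <= x -> x <= 1 -> is_derive x 1 F (f x) by move=> x0 _; apply: dF; lra.
rewrite (mean01_FTC cfs d1) (mean01_FTC cf d2).
rewrite add0r; pose g y := F (y + 1) - F y.
have dg x : a < x -> is_derive x 1 g 0.
  move=> ax; rewrite (_ : 0 = f (x + 1) - f x); last by rewrite pf subrr.
  by apply: is_deriveB; [apply: dshift; lra | exact: dF].
suff : g s = g 0 by rewrite /g add0r [s + 1]addrC.
have key (u v : R) : a < u -> u < v -> g u = g v.
  move=> au uv; have [||c _] := @MVT _ g (fun=> 0) u v uv.
  - by move=> x; rewrite in_itv /= => /andP[ux xv]; apply: dg; lra.
  - apply: continuous_in_subspaceT => x; rewrite inE /= in_itv /= => /andP[ux xv].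
    by apply: is_derive_continuous (dg x _); lra.
  - by rewrite mul0r => /eqP; rewrite subr_eq0 => /eqP.
by case: (ltgtP s 0) => [h|h|->] //; [apply: key|apply/esym/key].
Qed.

Lemma mean01_sum (I : Type) (r : seq I) (f : I -> R -> R) :
  (forall i, continuous (f i)) ->
  continuous (fun x => \sum_(i <- r) f i x) /\
  mean01 (fun x => \sum_(i <- r) f i x) = \sum_(i <- r) mean01 (f i).
Proof.
move=> cf; elim: r => [|i r [IH1 IH2]].
  have -> : (fun x => \sum_(i <- [::]) f i x) = fun=> 0.
    by apply/funext => x; rewrite big_nil.
  by rewrite big_nil mean01_cst; split => // x; exact: cst_continuous.
have -> : (fun x => \sum_(i <- i :: r) f i x) = (fun x => f i x + \sum_(i <- r) f i x).
  by apply/funext => x; rewrite big_cons.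
rewrite big_cons mean01D // IH2; split => // x.
by apply: cvgD; [exact: cf|exact: IH1].
Qed.

End MeanOverPeriod.

(** * Trigonometric functions and the Fejer kernel *)

Section Trig.
Variable R : realType.
Implicit Types (x y t : R) (j k m n : nat).

(** The grouping of the factors is that of expi2pi (j t). *)
Definition ct (j : int) t : R := cos (2 * pi * (j%:~R * t)).
Definition st (j : int) t : R := sin (2 * pi * (j%:~R * t)).

Lemma continuous_linear_fun (a : R) : continuous (fun t : R => a * t).
Proof. by move=> x; apply: cvgM; [exact: cvg_cst|exact: cvg_id]. Qed.

Lemma continuous_ct (j : int) : continuous (ct j).
Proof.
have -> : ct j = cos \o (fun t => (2 * pi * j%:~R) * t).
  by apply/funext => t; rewrite /ct /= mulrA.
by move=> x; apply: continuous_comp; [exact: continuous_linear_fun|exact: continuous_cos].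
Qed.

Lemma continuous_st (j : int) : continuous (st j).
Proof.
have -> : st j = sin \o (fun t => (2 * pi * j%:~R) * t).
  by apply/funext => t; rewrite /st /= mulrA.
by move=> x; apply: continuous_comp; [exact: continuous_linear_fun|exact: continuous_sin].
Qed.

Lemma cos_int2pi (j : int) (x : R) : cos (x + 2 * pi * j%:~R) = cos x /\
  sin (x + 2 * pi * j%:~R) = sin x.
Proof.
have p (n : nat) y : cos (y + 2 * pi * n%:R) = cos y /\ sin (y + 2 * pi * n%:R) = sin y.
  elim: n => [|n [IH1 IH2]]; first by rewrite mulr0 addr0.
  have -> : y + 2 * pi * n.+1%:R = (y + 2 * pi * n%:R) + pi *+ 2.
    by rewrite -natr1 -mulr_natl; ring.
  by split; [rewrite cosD | rewrite sinD];
    rewrite cos2pi sin2pi mulr0 mulr1 ?subr0 ?addr0.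
case: j => n; first exact: p.
rewrite NegzE mulrNz; have [h1 h2] := p n.+1 (x - 2 * pi * n.+1%:R).
by rewrite !subrK in h1 h2; rewrite mulrN -pmulrn -h1 -h2.
Qed.

Lemma ct_periodic (j : int) t : ct j (t + 1) = ct j t.
Proof.
rewrite /ct -(proj1 (cos_int2pi j (2 * pi * (j%:~R * t)))); congr cos; ring.
Qed.

Lemma st_periodic (j : int) t : st j (t + 1) = st j t.
Proof.
rewrite /st -(proj2 (cos_int2pi j (2 * pi * (j%:~R * t)))); congr sin; ring.
Qed.

Lemma mean01_ct j : (0 < j)%N -> mean01 (ct j%:Z) = 0.
Proof.
move=> j0; have jn : 2 * pi * j%:R != 0 :> R.
  by rewrite !mulf_neq0 ?pnatr_eq0 -?lt0n // lt0r_neq0 // pi_gt0.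
have dF x : 0 <= x -> x <= 1 ->
    is_derive x 1 (fun x => (2 * pi * j%:R)^-1 * sin ((2 * pi * j%:R) * x)) (ct j%:Z x).
  move=> _ _; have d1 : is_derive x (1 : R) (fun x => (2 * pi * j%:R) * x) (2 * pi * j%:R).
    by apply: is_derive_eq; rewrite /GRing.scale /= mulr1.
  have d2 := @is_derive1_comp _ sin _ x _ _ (is_derive_sin _) d1.
  apply: is_derive_eq; rewrite /GRing.scale /= mulrCA mulVf // mulr1 /ct.
  by congr cos; rewrite mulrA.
rewrite (mean01_FTC (@continuous_ct j%:Z) dF) mulr1 mulr0 sin0 mulr0 subr0.
have [_] := cos_int2pi j%:Z 0; rewrite add0r sin0 => ->; exact: mulr0.
Qed.

(** Jordan's inequality, up to the constant. *)
Lemma sin_pi_ge t : 0 <= t -> t <= 2^-1 -> t <= sin (pi * t).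
Proof.
(* At half the angle the cosine is bounded below. *)
move=> t0 t1; have p0 := pi_gt0 R; pose z : R := pi * t / 2.
have z0 : 0 <= z by rewrite /z divr_ge0 // mulr_ge0 // ltW.
have z1 : z <= pi / 4 by rewrite /z; nra.
have cz : 2^-1 <= cos z ^+ 2.
  have : 0 <= cos (z *+ 2).
    apply: cos_ge0_pihalf; rewrite (mulr2n z).
    by apply/andP; split; lra.
  by rewrite cos_mulr2n -mulr_natl; lra.
have c0 : 0 <= cos z by apply: cos_ge0_pihalf; apply/andP; split; lra.
have sz : z * cos z <= sin z.
  have [zz|zz] := eqVneq z 0; first by rewrite zz mul0r sin0.
  have zp : 0 < z by rewrite lt_neqAle eq_sym zz.
  have [|c] := @MVT _ sin cos 0 z zp.
    by apply: continuous_subspaceT; exact: continuous_sin.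
  rewrite in_itv /= sin0 !subr0 => /andP[c0' cz'] ->.
  rewrite mulrC ler_wpM2r //; apply: ltW; rewrite ltr_cos // in_itv /=;
    apply/andP; split; lra.
have -> : pi * t = z *+ 2 by rewrite /z -mulr_natl; field.
rewrite sin_mulr2n -mulr_natl.
have : z * cos z * cos z <= sin z * cos z by rewrite ler_wpM2r.
have : t <= z by rewrite /z; have := pi_ge2 R; nra.
nra.
Qed.

(** The Fejer kernel, times n. *)
Definition fejer n t : R := \sum_(m < n) (1 + 2 * \sum_(1 <= j < m.+1) ct j%:Z t).

(** The squared modulus of a geometric sum; positivity and fejer_sin2 both come from
    this form. *)
Lemma fejerE n t : fejer n t =
  (\sum_(j < n) ct j%:Z t) ^+ 2 + (\sum_(j < n) st j%:Z t) ^+ 2.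
Proof.
elim: n => [|n IH]; first by rewrite /fejer !big_ord0 expr0n /= addr0.
rewrite /fejer big_ord_recr /= -/(fejer n t) IH !big_ord_recr /= !sqrrD.
set A := \sum_(i < n) _; set B := \sum_(i < n) _.
have e1 : ct n%:Z t ^+ 2 + st n%:Z t ^+ 2 = 1 by rewrite /ct /st cos2Dsin2.
have -> : \sum_(1 <= j < n.+1) ct j%:Z t = A * ct n%:Z t + B * st n%:Z t.
  rewrite /A /B !mulr_suml -big_split /= (reindex_inj rev_ord_inj) /=.
  rewrite big_add1 big_mkord /=; apply: eq_bigr => i _.
  rewrite /ct /st -cosB -[RHS]cosN; congr cos.
  by rewrite -!pmulrn natrB ?(ltn_ord i) //; ring.
transitivity (A ^+ 2 + B ^+ 2 + (ct n%:Z t ^+ 2 + st n%:Z t ^+ 2) +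
  2 * (A * ct n%:Z t + B * st n%:Z t)); last by ring.
by rewrite e1; ring.
Qed.

Lemma fejer_ge0 n t : 0 <= fejer n t.
Proof. by rewrite fejerE addr_ge0 // sqr_ge0. Qed.

(** The factor 2 sin (pi t) telescopes both trigonometric sums. *)
Lemma fejer_sin2 n t : sin (pi * t) ^+ 2 * fejer n t <= 1.
Proof.
set s := sin (pi * t); set a : R := (2 * n%:R - 1) * (pi * t).
have hA : 2 * s * (\sum_(j < n) ct j%:Z t) = sin a + s.
  rewrite /a; elim: n {a} => [|n IH].
    by rewrite big_ord0 mulr0 mulr0 sub0r mulN1r sinN addNr.
  rewrite big_ord_recr /= mulrDr IH /ct /s -(@natr1 R n).
  have -> : (2 * (n%:R + 1) - 1) * (pi * t) = 2 * pi * (n%:~R * t) + pi * t by ring.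
  have -> : (2 * n%:R - 1) * (pi * t) = 2 * pi * (n%:~R * t) - pi * t by ring.
  by rewrite sinB sinD; ring.
have hB : 2 * s * (\sum_(j < n) st j%:Z t) = cos (pi * t) - cos a.
  rewrite /a; elim: n {a hA} => [|n IH].
    by rewrite big_ord0 mulr0 mulr0 sub0r mulN1r cosN subrr.
  rewrite big_ord_recr /= mulrDr IH /st /s -(@natr1 R n).
  have -> : (2 * (n%:R + 1) - 1) * (pi * t) = 2 * pi * (n%:~R * t) + pi * t by ring.
  have -> : (2 * n%:R - 1) * (pi * t) = 2 * pi * (n%:~R * t) - pi * t by ring.
  by rewrite cosB cosD; ring.
have h4 : 4 * (s ^+ 2 * fejer n t) = (sin a + s) ^+ 2 + (cos (pi * t) - cos a) ^+ 2.
  by rewrite -hA -hB fejerE; ring.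
have e1 := cos2Dsin2 a; have e2 := cos2Dsin2 (pi * t); rewrite -/s in e2.
have h5 : - 1 <= cos (a + pi * t) by apply: cos_geN1.
rewrite cosD -/s in h5; nra.
Qed.

Lemma continuous_sum_ct (r : seq nat) : continuous (fun t => \sum_(j <- r) ct j%:Z t).
Proof.
have [h _] := mean01_sum r (fun j => @continuous_ct j%:Z); exact: h.
Qed.

Lemma continuous_dirichlet m : continuous (fun t => 1 + 2 * \sum_(1 <= j < m.+1) ct j%:Z t).
Proof.
move=> x; apply: cvgD; first exact: cvg_cst.
apply: cvgM; [exact: cvg_cst | exact: continuous_sum_ct].
Qed.

Lemma continuous_fejer n : continuous (fejer n).
Proof.
have [h _] := mean01_sum (index_enum 'I_n) (fun m : 'I_n => @continuous_dirichlet m).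
exact: h.
Qed.

Lemma mean01_fejer n : mean01 (fejer n) = n%:R.
Proof.
rewrite (proj2 (mean01_sum (index_enum 'I_n) (fun m : 'I_n => @continuous_dirichlet m))).
rewrite (eq_bigr (fun=> 1)) ?sumr_const ?card_ord // => m _.
rewrite mean01D; [|exact: continuous_cst|]; last first.
  by move=> x; apply: cvgM; [exact: cvg_cst | exact: continuous_sum_ct].
rewrite mean01_cst mean01Z; last exact: continuous_sum_ct.
rewrite (proj2 (mean01_sum _ (fun j : nat => @continuous_ct j%:Z))).
rewrite big_nat big1 ?mulr0 ?addr0 // => j /andP[j1 _].
exact: mean01_ct.
Qed.

End Trig.

(** * Fourier series of functions with bounded second differences *)

Section FourierReal.
Variables (R : realType) (F : R -> R) (C : R).
Hypothesis perF : forall x, F (x + 1) = F x.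
Hypothesis lipF : forall x h, `|h| <= 2^-1 -> `|F (x + h) - F x| <= C * `|h|.
Hypothesis sdF : forall x h, `|h| <= 2^-1 ->
  `|F (x + h) - 2 * F x + F (x - h)| <= C * h ^+ 2.
Hypothesis mean0 : mean01 F = 0.
Implicit Types (x t : R) (m n N : nat) (j : int).

Let C0 : 0 <= C.
Proof.
have h : `|2^-1 : R| <= 2^-1 by rewrite ger0_norm //; lra.
have := le_trans (normr_ge0 _) (lipF 0 h); rewrite ger0_norm; last lra.
by rewrite pmulr_lge0 //; lra.
Qed.

Lemma continuous_lip : continuous F.
Proof.
move=> x; apply/cvgrPdist_le => e e0; near=> t.
have -> : F x - F t = - (F (x + (t - x)) - F x) by rewrite [x + _]addrC subrK opprB.
rewrite normrN; apply: le_trans (lipF _ _) _.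
  by near: t; apply: cvgr_distC_le => //; lra.
apply: (@le_trans _ _ ((C + 1) * `|t - x|)); first by rewrite ler_wpM2r //; lra.
rewrite mulrC -ler_pdivlMr; last by have := C0; lra.
by near: t; apply: cvgr_distC_le => //; rewrite divr_gt0 //; have := C0; lra.
Unshelve. all: by end_near. Qed.

Lemma continuous_shift (f : R -> R) s : continuous f -> continuous (fun t => f (t + s)).
Proof.
move=> cf x; apply: continuous_comp; last exact: cf.
by apply: cvgD; [exact: cvg_id|exact: cvg_cst].
Qed.

Lemma continuous_mul (f g : R -> R) : continuous f -> continuous g ->
  continuous (fun t => f t * g t).
Proof. by move=> cf cg x; apply: cvgM; [exact: cf|exact: cg]. Qed.

(** Shifting by half a wave length changes the sign of the wave e, so a Fourier
    coefficient is a mean of second differences. *)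
Lemma decay_wave (e : R -> R) j : j != 0 -> continuous e ->
  (forall t, e (t + 1) = e t) -> (forall t, `|e t| <= 1) ->
  (forall t, e (t + (2 * j%:~R)^-1) = - e t) ->
  `|mean01 (fun t => F t * e t)| <= C / (16 * j%:~R ^+ 2).
Proof.
move=> j0 ce pe e1 he; have cF := continuous_lip.
have jR : (j%:~R : R) != 0 by rewrite intr_eq0.
set h := (2 * j%:~R)^-1 in he.
have he' t : e (t - h) = - e t by rewrite -[in RHS](subrK h t) he opprK.
have sh s : (forall t, e (t - s) = - e t) ->
    mean01 (fun t => F (t + s) * e t) = - mean01 (fun t => F t * e t).
  move=> hs; rewrite -(@mean01_shift _ (fun t => F t * e t) s); last 2 first.
  - exact: continuous_mul.
  - by move=> t; rewrite perF pe.
  rewrite -[RHS]mulN1r -mean01Z; last first.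
    by apply: (@continuous_shift (fun t => F t * e t)); exact: continuous_mul.
  apply: eq_mean01 => t.
  have -> : e t = - e (t + s) by rewrite -(hs (t + s)) addrK.
  by ring.
have cs s : continuous (fun t => F (t + s) * e t).
  by apply: continuous_mul => //; exact: continuous_shift.
have : mean01 (fun t => (F (t + h) - 2 * F t + F (t - h)) * e t) =
    - 4 * mean01 (fun t => F t * e t).
  transitivity (mean01 (fun t => F (t + h) * e t + (-2 * (F t * e t) + F (t + - h) * e t))).
    by apply: eq_mean01 => t; ring.
  have c2 : continuous (fun t => -2 * (F t * e t)).
    by apply: continuous_mul; [exact: continuous_cst|exact: continuous_mul].
  rewrite mean01D //; last by move=> t; apply: cvgD; [exact: c2 | exact: cs].
  rewrite mean01D // mean01Z; last exact: continuous_mul.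
  rewrite sh // sh; first by ring.
  by move=> t; rewrite opprK he.
have jj : 1 <= `|j%:~R : R|.
  by rewrite -intr_norm -[leLHS]/(1%:~R) ler_int -gtz0_ge1 normr_gt0.
have h2 : `|h| <= 2^-1.
  rewrite /h normfV normrM (ger0_norm (_ : 0 <= 2 :> R)) //.
  by rewrite lef_pV2 ?posrE //; lra.
have cd : continuous (fun t => (F (t + h) - 2 * F t + F (t - h)) * e t).
  apply: continuous_mul => // t; apply: cvgD; last exact: (@continuous_shift F (- h)).
  apply: cvgB; first exact: continuous_shift.
  by apply: cvgM; [exact: cvg_cst|exact: cF].
have := @mean01_norm _ _ (C * h ^+ 2) cd; move=> bnd eq4.
have {bnd} : `|mean01 (fun t => (F (t + h) - 2 * F t + F (t - h)) * e t)| <= C * h ^+ 2.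
  apply: bnd => t _ _; rewrite normrM -[leRHS]mulr1.
  by apply: ler_pM => //; exact: sdF.
rewrite eq4 normrM normrN (ger0_norm (_ : 0 <= 4 :> R)) // mulrC -ler_pdivlMr //.
move=> /le_trans; apply; rewrite le_eqVlt; apply/orP; left; apply/eqP.
by rewrite /h; field.
Qed.

Lemma half_wave j (t : R) : j != 0 ->
  2 * pi * (j%:~R * (t + (2 * j%:~R)^-1)) = 2 * pi * (j%:~R * t) + pi :> R.
Proof. by move=> j0; field; rewrite intr_eq0. Qed.

Definition alpha j : R := mean01 (fun t => F t * ct j t).
Definition beta j : R := mean01 (fun t => F t * st j t).

Lemma alpha_le j : j != 0 -> `|alpha j| <= C / (16 * j%:~R ^+ 2).
Proof.
move=> j0; apply: decay_wave => //; [exact: continuous_ct|exact: ct_periodic| |].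
  by move=> t; rewrite ler_norml /ct cos_geN1 cos_le1.
by move=> t; rewrite /ct half_wave // cosDpi.
Qed.

Lemma beta_le j : j != 0 -> `|beta j| <= C / (16 * j%:~R ^+ 2).
Proof.
move=> j0; apply: decay_wave => //; [exact: continuous_st|exact: st_periodic| |].
  by move=> t; rewrite ler_norml /st sin_geN1 sin_le1.
by move=> t; rewrite /st half_wave // sinDpi.
Qed.

Definition gamma x j : R := alpha j * ct j x + beta j * st j x.

Lemma gamma_le x j : j != 0 -> `|gamma x j| <= C / (8 * j%:~R ^+ 2).
Proof.
move=> j0; have jR : 0 < (j%:~R : R) ^+ 2 by rewrite exprn_even_gt0 //= intr_eq0.
have c1 : `|ct j x| <= 1 by rewrite ler_norml /ct cos_geN1 cos_le1.
have s1 : `|st j x| <= 1 by rewrite ler_norml /st sin_geN1 sin_le1.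
apply: le_trans (ler_normD _ _) _; rewrite !normrM.
have h1 := ler_pM (normr_ge0 _) (normr_ge0 _) (alpha_le j0) c1.
have h2 := ler_pM (normr_ge0 _) (normr_ge0 _) (beta_le j0) s1.
have e : C / (8 * j%:~R ^+ 2) = C / (16 * j%:~R ^+ 2) * 1 + C / (16 * j%:~R ^+ 2) * 1.
  by field; rewrite intr_eq0.
by rewrite e; apply: lerD.
Qed.

Lemma gammaE x j : mean01 (fun t => F (x + t) * ct j t) = gamma x j.
Proof.
have cF := continuous_lip.
have cts : continuous (fun u => ct j (u - x)).
  by apply: continuous_shift; exact: continuous_ct.
transitivity (mean01 (fun u => F u * ct j (u - x))).
  rewrite -(@mean01_shift _ (fun u => F u * ct j (u - x)) x); last 2 first.
  - exact: continuous_mul.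
  - by move=> t; rewrite perF addrAC ct_periodic.
  by apply: eq_mean01 => t; rewrite addrK [x + t]addrC.
have c1 : continuous (fun u => F u * ct j u) by apply: continuous_mul => //; exact: continuous_ct.
have c2 : continuous (fun u => F u * st j u) by apply: continuous_mul => //; exact: continuous_st.
transitivity (mean01 (fun u => ct j x * (F u * ct j u) + st j x * (F u * st j u))).
  apply: eq_mean01 => u; have -> : ct j (u - x) = ct j u * ct j x + st j u * st j x.
    by rewrite /ct /st -cosB; congr cos; ring.
  by ring.
rewrite mean01D; [|by apply: continuous_mul => //; exact: continuous_cst..].
by rewrite !mean01Z // /gamma mulrC [st j x * _]mulrC.
Qed.

(** A symmetric partial sum of the Fourier series: the terms of index i and - i
    have the same real part. *)
Definition fsum x m : R := 2 * \sum_(1 <= i < m.+1) gamma x i%:Z.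

Lemma mean01_fejer_F x n : mean01 (fun t => F (x + t) * fejer n t) = \sum_(m < n) fsum x m.
Proof.
have cF : continuous (fun t => F (x + t)).
  have -> : (fun t => F (x + t)) = (fun t => F (t + x)) by apply/funext => t; rewrite addrC.
  by apply: continuous_shift; exact: continuous_lip.
have cfc j : continuous (fun t => F (x + t) * ct j t).
  by apply: continuous_mul => //; exact: continuous_ct.
have cs m : continuous (fun t => \sum_(1 <= i < m.+1) F (x + t) * ct i%:Z t).
  by have [h _] := mean01_sum (index_iota 1 m.+1) (fun i : nat => cfc i%:Z); exact: h.
have c2s m : continuous (fun t => 2 * \sum_(1 <= i < m.+1) F (x + t) * ct i%:Z t).
  by apply: continuous_mul; [exact: continuous_cst|exact: cs].
transitivity (mean01 (fun t => \sum_(m < n)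
    (F (x + t) + 2 * \sum_(1 <= i < m.+1) F (x + t) * ct i%:Z t))).
  apply: eq_mean01 => t; rewrite /fejer mulr_sumr; apply: eq_bigr => m _.
  by rewrite mulrDr mulr1 mulrCA; congr (_ + _ * _); exact: mulr_sumr.
have cT m : continuous (fun t => F (x + t) + 2 * \sum_(1 <= i < m.+1) F (x + t) * ct i%:Z t).
  by move=> t; apply: cvgD; [exact: cF|exact: c2s].
rewrite (proj2 (mean01_sum (index_enum 'I_n) (fun m : 'I_n => @cT m))).
apply: eq_bigr => m _; rewrite mean01D //.
rewrite mean01Z //; rewrite (_ : mean01 (fun t => F (x + t)) = 0); last first.
  rewrite -mean0 -(@mean01_shift _ F x continuous_lip perF).
  by apply: eq_mean01 => t; rewrite addrC.
rewrite add0r /fsum; congr (_ * _).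
rewrite (proj2 (mean01_sum (index_iota 1 m.+1) (fun i : nat => @cfc i%:Z))).
by apply: eq_bigr => i _; rewrite gammaE.
Qed.

(** Near the other end of the period, F is compared with F (x + 1). *)
Lemma lip_sin x t : 0 <= t -> t <= 1 -> `|F (x + t) - F x| <= C * `|sin (pi * t)|.
Proof.
move=> t0 t1; have [th|th] := leP t 2^-1.
  have s := sin_pi_ge t0 th.
  apply: le_trans (lipF _ _) _; first by rewrite ger0_norm.
  by rewrite ler_wpM2l ?C0 // !ger0_norm //; lra.
have u0 : 0 <= 1 - t by lra.
have u1 : 1 - t <= 2^-1 by lra.
have s := sin_pi_ge u0 u1.
have -> : F (x + t) - F x = F ((x + 1) + - (1 - t)) - F (x + 1).
  by rewrite perF; congr (F _ - _); ring.
apply: le_trans (lipF _ _) _; first by rewrite normrN ger0_norm.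
rewrite normrN ler_wpM2l ?C0 //.
have -> : sin (pi * t) = sin (pi * (1 - t)).
  have -> : pi * t = - (pi * (1 - t)) + pi by ring.
  by rewrite sinDpi sinN opprK.
by rewrite !ger0_norm //; lra.
Qed.

(** With s = |sin (pi t)| and the kernel K, lip_sin bounds the integrand by
    C s K <= C (eta K + s ^ 2 K / eta), where s ^ 2 K <= 1 and K has mean n. *)
Lemma fejer_error x n (eta : R) : 0 < eta ->
  `|\sum_(m < n) fsum x m - n%:R * F x| <= C * (eta * n%:R + eta^-1).
Proof.
move=> e0; have cF : continuous (fun t => F (x + t)).
  have -> : (fun t => F (x + t)) = (fun t => F (t + x)) by apply/funext => t; rewrite addrC.
  by apply: continuous_shift; exact: continuous_lip.
have cK := @continuous_fejer R n.
have cFK : continuous (fun t => F (x + t) * fejer n t) by exact: continuous_mul.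
have cc : continuous (fun t => - F x * fejer n t).
  by apply: continuous_mul => //; exact: continuous_cst.
have -> : \sum_(m < n) fsum x m - n%:R * F x =
    mean01 (fun t => F (x + t) * fejer n t + - F x * fejer n t).
  by rewrite mean01D // mean01Z // mean01_fejer mean01_fejer_F; ring.
have cB : continuous (fun t => C * (eta * fejer n t) + C * eta^-1).
  move=> t; apply: cvgD; last exact: cvg_cst.
  by apply: cvgM; [exact: cvg_cst|apply: cvgM; [exact: cvg_cst|exact: cK]].
have -> : C * (eta * n%:R + eta^-1) = mean01 (fun t => C * (eta * fejer n t) + C * eta^-1).
  have c1 : continuous (fun t => eta * fejer n t).
    by apply: continuous_mul => //; exact: continuous_cst.
  rewrite mean01D; [|by apply: continuous_mul => //; exact: continuous_cst|exact: continuous_cst].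
  by rewrite mean01Z // mean01Z // mean01_fejer mean01_cst mulrDr.
have key t : 0 <= t -> t <= 1 -> `|F (x + t) * fejer n t + - F x * fejer n t| <=
    C * (eta * fejer n t) + C * eta^-1.
  move=> t0 t1; rewrite -mulrDl normrM (ger0_norm (fejer_ge0 n t)) -mulrDr.
  have := ler_wpM2r (fejer_ge0 n t) (lip_sin x t0 t1) => /le_trans; apply.
  rewrite -mulrA ler_wpM2l ?C0 //.
  have f0 := fejer_ge0 n t; have f1 := fejer_sin2 n t.
  rewrite -[sin _ ^+ 2]real_normK ?num_real // in f1.
  move: (fejer n t) `|sin _| (normr_ge0 (sin (pi * t))) f0 f1 => K s s0 K0 sK.
  have h : eta * s <= eta ^+ 2 + s ^+ 2.
    by have := sqr_ge0 (eta - s); have := sqr_ge0 (eta + s); nra.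
  rewrite -(ler_pM2l e0) mulrDr divff ?lt0r_neq0 //.
  have : eta * s * K <= (eta ^+ 2 + s ^+ 2) * K by rewrite ler_wpM2r.
  nra.
have cD : continuous (fun t => F (x + t) * fejer n t + - F x * fejer n t).
  by move=> t; apply: cvgD; [exact: cFK|exact: cc].
have cN : continuous (fun t => - 1 * (C * (eta * fejer n t) + C * eta^-1)).
  by apply: continuous_mul => //; exact: continuous_cst.
rewrite ler_norml -mulN1r -mean01Z //; apply/andP; split; apply: mean01_le => // t t0 t1.
  by rewrite mulN1r; have := key t t0 t1; rewrite ler_norml => /andP[].
by have := key t t0 t1; rewrite ler_norml => /andP[].
Qed.

(** 1 / i ^ 2 <= 1 / (i - 1) - 1 / i. *)
Lemma sum_invsq n m : (0 < n)%N -> \sum_(n.+1 <= i < m) (i%:R ^+ 2)^-1 <= n%:R^-1 :> R.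
Proof.
move=> n0; have [mn|nm] := ltnP m n.+1.
  by rewrite big_geq ?invr_ge0 // ltnW.
suff : \sum_(n.+1 <= i < m) (i%:R ^+ 2)^-1 <= n%:R^-1 - m.-1%:R^-1 :> R.
  by have : 0 <= m.-1%:R^-1 :> R by []; lra.
elim: m nm => // m IH; rewrite ltnS leq_eqVlt => /predU1P[<-|nm].
  by rewrite big_geq // subrr.
rewrite big_nat_recr //=; have {IH}h := IH nm.
apply: (@le_trans _ _ (n%:R^-1 - m.-1%:R^-1 + (m%:R ^+ 2)^-1)); first by rewrite lerD2r.
case: m nm {h} => [//|[|m]] nm; first by move: nm; rewrite ltnS; case: n n0.
rewrite -addrA lerD2l /= -(@natr1 R m.+1).
have m0 : 0 < m.+1%:R :> R by rewrite ltr0n.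
move: (m.+1%:R) m0 => y y0; have y1 : 0 < y + 1 by lra.
suff : ((y + 1) ^+ 2)^-1 <= y^-1 - (y + 1)^-1 by lra.
have -> : y^-1 - (y + 1)^-1 = (y * (y + 1))^-1 by field; rewrite !lt0r_neq0.
by rewrite lef_pV2 ?posrE ?mulr_gt0 ?exprn_gt0 //; nra.
Qed.

(** The decay of the coefficients makes the partial sums a Cauchy sequence, and by
    fejer_error their averages tend to F x. *)
Lemma fsum_error x n : (0 < n)%N -> `|F x - fsum x n| <= C / (4 * n%:R).
Proof.
move=> n0; have nR : 0 < n%:R :> R by rewrite ltr0n.
have dif m : (n <= m)%N -> `|fsum x m - fsum x n| <= C / (4 * n%:R).
  move=> nm; have -> : fsum x m - fsum x n = 2 * \sum_(n.+1 <= i < m.+1) gamma x i%:Z.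
    by rewrite /fsum (big_cat_nat (_ : 1 <= n.+1)%N (_ : n.+1 <= m.+1)%N) //=; ring.
  rewrite normrM (ger0_norm (_ : 0 <= 2 :> R)) //.
  have : `|\sum_(n.+1 <= i < m.+1) gamma x i%:Z| <=
      \sum_(n.+1 <= i < m.+1) C / 8 * (i%:R ^+ 2)^-1.
    apply: le_trans (ler_norm_sum _ _ _) _; rewrite big_nat [leRHS]big_nat.
    apply: ler_sum => i /andP[ni _]; have i0 : i%:Z != 0 by case: i ni.
    by have := gamma_le x i0; rewrite -pmulrn invfM mulrA.
  rewrite -mulr_sumr => /le_trans h.
  have {h} := h _ (ler_wpM2l _ (sum_invsq m.+1 n0)); rewrite divr_ge0 ?C0 // => /(_ isT).
  have -> : C / (4 * n%:R) = 2 * (C / 8 / n%:R) by field; rewrite lt0r_neq0.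
  by move=> ?; rewrite ler_wpM2l.
apply/ler_addgt0Pr => e e0.
(* eta keeps the term linear in N below N e / 2, and N absorbs the others. *)
pose eta := e / (2 * (C + 1)); have c1 : 0 < C + 1 by have := C0; lra.
have eta0 : 0 < eta by rewrite divr_gt0 // mulr_gt0.
pose B := C / eta + \sum_(m < n) `|fsum x m - fsum x n|.
have B0 : 0 <= B by rewrite addr_ge0 ?sumr_ge0 // divr_ge0 ?C0 // ltW.
pose N := (n + (Num.truncn (2 * B / e)).+1)%N.
have NB : 2 * B / e < N%:R.
  apply: lt_le_trans (truncnS_gt _) _; by rewrite ler_nat leq_addl.
have N0 : 0 < N%:R :> R by rewrite ltr0n /N addnS.
have h1 := fejer_error x N eta0.
have h2 : `|\sum_(m < N) fsum x m - N%:R * fsum x n| <=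
    \sum_(m < n) `|fsum x m - fsum x n| + N%:R * (C / (4 * n%:R)).
  have -> : \sum_(m < N) fsum x m - N%:R * fsum x n = \sum_(m < N) (fsum x m - fsum x n).
    by rewrite sumrB sumr_const card_ord mulr_natl.
  apply: le_trans (ler_norm_sum _ _ _) _; rewrite {1 2}/N big_split_ord /= lerD //.
  apply: (@le_trans _ _ (\sum_(i < (Num.truncn (2 * B / e)).+1) C / (4 * n%:R))).
    by apply: ler_sum => i _; apply: dif; rewrite leq_addr.
  have c0 : 0 <= C / (4 * n%:R) by rewrite divr_ge0 ?C0 // mulr_ge0.
  by rewrite sumr_const card_ord -[leLHS]mulr_natl (ler_wpM2r c0) // ler_nat leq_addl.
have h3 : N%:R * `|F x - fsum x n| <= C * (eta * N%:R + eta^-1) +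
    (\sum_(m < n) `|fsum x m - fsum x n| + N%:R * (C / (4 * n%:R))).
  rewrite -[X in X * _]ger0_norm ?(ltW N0) // -normrM.
  have -> : N%:R * (F x - fsum x n) = - (\sum_(m < N) fsum x m - N%:R * F x) +
     (\sum_(m < N) fsum x m - N%:R * fsum x n) by ring.
  by apply: le_trans (ler_normD _ _) _; rewrite normrN lerD.
have h4 : C * (eta * N%:R + eta^-1) + (\sum_(m < n) `|fsum x m - fsum x n| +
    N%:R * (C / (4 * n%:R))) = N%:R * (C / (4 * n%:R) + C * eta) + B.
  by rewrite /B; ring.
have h5 : C * eta <= e / 2.
  have -> : e / 2 = (C + 1) * eta by rewrite /eta; field; rewrite lt0r_neq0.
  by rewrite ler_wpM2r ?(ltW eta0) //; lra.
have h6 : B <= N%:R * (e / 2).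
  by move: NB; rewrite ltr_pdivrMr //; lra.
rewrite -(ler_pM2l N0); apply: le_trans h3 _; rewrite h4.
have : N%:R * (C * eta) <= N%:R * (e / 2) by rewrite ler_wpM2l // ltW.
lra.
Qed.

End FourierReal.

(** * Unconditional convergence of Fourier series *)

Section FourierComplex.
Variables (R : realType) (F : R -> R) (C : R).
Hypothesis perF : forall x, F (x + 1) = F x.
Hypothesis lipF : forall x h, `|h| <= 2^-1 -> `|F (x + h) - F x| <= C * `|h|.
Hypothesis sdF : forall x h, `|h| <= 2^-1 ->
  `|F (x + h) - 2 * F x + F (x - h)| <= C * h ^+ 2.
Hypothesis mean0 : mean01 F = 0.
Implicit Types (x t : R) (m n N : nat) (j : int).

Definition fourier_coef j : R[i] := Complex (alpha F j) (- beta F j).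

Definition gamma_im x j : R := alpha F j * st j x - beta F j * ct j x.

Lemma fourier_termE x j :
  fourier_coef j * expi2pi (j%:~R * x) = Complex (gamma F x j) (gamma_im x j).
Proof.
rewrite /fourier_coef /expi2pi /gamma /gamma_im /ct /st; apply/eqP.
by rewrite eq_complex /=; apply/andP; split; apply/eqP; ring.
Qed.

Lemma ctN j t : ct (- j) t = ct j t :> R.
Proof. by rewrite /ct mulrNz mulNr mulrN cosN. Qed.

Lemma stN j t : st (- j) t = - st j t :> R.
Proof. by rewrite /st mulrNz mulNr mulrN sinN. Qed.

Lemma alphaN j : alpha F (- j) = alpha F j.
Proof. by apply: eq_mean01 => t; rewrite ctN. Qed.

Lemma betaN j : beta F (- j) = - beta F j.
Proof.
rewrite /beta -[RHS]mulN1r -mean01Z; last first.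
  by apply: continuous_mul; [exact: continuous_lip lipF|exact: continuous_st].
by apply: eq_mean01 => t; rewrite stN; ring.
Qed.

Lemma gammaN x j : gamma F x (- j) = gamma F x j.
Proof. by rewrite /gamma alphaN betaN ctN stN; ring. Qed.

Lemma gamma_imN x j : gamma_im x (- j) = - gamma_im x j.
Proof. by rewrite /gamma_im alphaN betaN ctN stN; ring. Qed.

Lemma gamma_im_le x j : j != 0 -> `|gamma_im x j| <= C / (8 * j%:~R ^+ 2).
Proof.
move=> j0.
have c1 : `|ct j x| <= 1 by rewrite ler_norml /ct cos_geN1 cos_le1.
have s1 : `|st j x| <= 1 by rewrite ler_norml /st sin_geN1 sin_le1.
apply: le_trans (ler_normB _ _) _; rewrite !normrM.
have h1 := ler_pM (normr_ge0 _) (normr_ge0 _) (alpha_le perF lipF sdF j0) s1.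
have h2 := ler_pM (normr_ge0 _) (normr_ge0 _) (beta_le perF lipF sdF j0) c1.
have -> : C / (8 * j%:~R ^+ 2) = C / (16 * j%:~R ^+ 2) * 1 + C / (16 * j%:~R ^+ 2) * 1.
  by field; rewrite intr_eq0.
exact: lerD.
Qed.

Definition annulus n m : seq int :=
  map Posz (index_iota n.+1 m.+1) ++ map (fun i : nat => - Posz i) (index_iota n.+1 m.+1).

Lemma mem_annulus n m j : (j \in annulus n m) = (n < `|j|%N <= m)%N.
Proof.
rewrite mem_cat; apply/orP/idP => [[h|h]|].
- have [i hi ->] : exists2 i, i \in index_iota n.+1 m.+1 & j = i%:Z by apply/mapP.
  by rewrite mem_index_iota ltnS in hi; rewrite absz_nat.
- have [i hi ->] : exists2 i, i \in index_iota n.+1 m.+1 & j = - i%:Z by apply/mapP.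
  by rewrite mem_index_iota ltnS in hi; rewrite abszN absz_nat.
case: j => i h; [left|right].
  by apply/mapP; exists i; rewrite // mem_index_iota ltnS.
by apply/mapP; exists i.+1; rewrite ?NegzE // mem_index_iota ltnS.
Qed.

Lemma uniq_annulus n m : uniq (annulus n m).
Proof.
rewrite cat_uniq !map_inj_uniq ?iota_uniq /=; last 2 first.
- by move=> i k /oppr_inj [].
- by move=> i k [].
rewrite andbT; apply/hasPn => _ /mapP[i hi ->]; apply/negP => /mapP[k hk].
move: hi hk; rewrite !mem_index_iota; by case: i.
Qed.

Lemma sum_annulus n m (f : int -> R) : \sum_(j <- annulus n m) f j =
  \sum_(n.+1 <= i < m.+1) (f i%:Z + f (- i%:Z)).
Proof. by rewrite big_cat !big_map /= big_split. Qed.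

(** A finite set of frequencies that contains those with 1 <= |j| <= n differs from
    them by a part of the tail, whatever its shape: hence unconditional convergence. *)
Lemma finite_sum_error (s : seq int) n (f : int -> R) : (0 < n)%N ->
  uniq s -> {subset annulus 0 n <= s} -> (forall j, j \in s -> j != 0) ->
  (forall j, j != 0 -> `|f j| <= C / (8 * j%:~R ^+ 2)) ->
  `|\sum_(j <- s) f j - \sum_(j <- annulus 0 n) f j| <= C / (4 * n%:R).
Proof.
move=> n0 us sub nz fle; rewrite (bigID (mem (annulus 0 n))) /=.
have -> : \sum_(j <- s | j \in annulus 0 n) f j = \sum_(j <- annulus 0 n) f j.
  rewrite -big_filter; apply: perm_big; apply: uniq_perm.
  - exact: filter_uniq.
  - exact: uniq_annulus.
  - by move=> j; rewrite mem_filter andb_idr // => /sub.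
rewrite addrAC subrr add0r; apply: le_trans (ler_norm_sum _ _ _) _.
pose M := \max_(j <- s) `|j|%N.
have CC : 0 <= C.
  have h : (1 : int) != 0 by [].
  have := le_trans (normr_ge0 _) (gamma_im_le 0 h).
  by rewrite expr1n mulr1 pmulr_lge0.
pose g (j : int) : R := C / 8 * (j%:~R ^+ 2)^-1.
apply: (@le_trans _ _ (\sum_(j <- annulus n M) g j)).
  apply: (@le_trans _ _ (\sum_(j <- s | j \notin annulus 0 n) g j)).
    rewrite big_seq_cond [leRHS]big_seq_cond; apply: ler_sum => j /andP[js _].
    by have := fle j (nz j js); rewrite /g invfM mulrA.
  rewrite [leRHS](bigID (fun j => (j \in s) && (j \notin annulus 0 n))) /=.
  rewrite -[leLHS]addr0 lerD //; last first.
    by apply: sumr_ge0 => j _; rewrite mulr_ge0 ?divr_ge0 // invr_ge0 sqr_ge0.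
  rewrite -big_filter -[leRHS]big_filter le_eqVlt; apply/orP; left; apply/eqP.
  apply/perm_big/uniq_perm; rewrite ?filter_uniq ?uniq_annulus // => j.
  rewrite !mem_filter -andbA andbCA; apply: andb_id2l => h.
  apply/esym/andb_idr => js; rewrite mem_annulus ltnNge leq_bigmax_seq // andbT.
  by apply: contra h => h; rewrite mem_annulus h absz_gt0 nz.
rewrite sum_annulus; apply: (@le_trans _ _ (\sum_(n.+1 <= i < M.+1) C / 4 * (i%:R ^+ 2)^-1)).
  apply: ler_sum => i _; rewrite /g mulrNz sqrrN -!pmulrn; lra.
rewrite -mulr_sumr invfM mulrA ler_wpM2l ?divr_ge0 //; exact: sum_invsq.
Qed.

Lemma Complex_sum (I : Type) (s : seq I) (f g : I -> R) :
  \sum_(j <- s) (Complex (f j) (g j) : R[i]) =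
  Complex (\sum_(j <- s) f j) (\sum_(j <- s) g j).
Proof. by elim: s => [|j s IH]; rewrite ?big_nil // !big_cons IH. Qed.

Lemma normc_le (a b : R) : `|Complex a b : R[i]| <= (`|a| + `|b|)%:C%C.
Proof.
rewrite normc_def lecR /= -[leRHS]ger0_norm ?addr_ge0 // -sqrtr_sqr ler_wsqrtr //.
rewrite sqrrD !real_normK ?num_real //.
by have : 0 <= `|a| * `|b| by []; rewrite -mulr_natl; lra.
Qed.

(** The real part is fsum_error together with finite_sum_error; in the imaginary part
    the terms of index j and - j cancel, up to the same tail. *)
Lemma fourier_expansionP : fourier_expansion0 F fourier_coef.
Proof.
move=> x; apply/cvgrPdist_le => e e0.
have [er er0 eE] : exists2 er : R, 0 < er & e = er%:C%C.
  move: e0; case: e => a b; rewrite ltcE /= => /andP[/eqP -> a0]; by exists a.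
have CC : 0 <= C.
  have h : (1 : int) != 0 by [].
  have := le_trans (normr_ge0 _) (gamma_im_le 0 h).
  by rewrite expr1n mulr1 pmulr_lge0.
pose n := (Num.truncn (C / er)).+1.
have nR : 0 < n%:R :> R by rewrite ltr0n.
have nC : C / n%:R <= er.
  by rewrite ler_pdivrMr // -ler_pdivrMl // mulrC ltW // truncnS_gt.
pose A0 : {fset {j : int | j != 0}} := [fset k in pmap insub (annulus 0 n)]%fset.
exists A0 => // A /= A0A.
pose s := map val (enum_fset A).
have us : uniq s by rewrite map_inj_uniq ?fset_uniq //; exact: val_inj.
have nz j : j \in s -> j != 0 by move=> /mapP[k _ ->]; exact: (valP k).
have sub : {subset annulus 0 n <= s}.
  move=> j ja; have j0 : j != 0 by move: ja; rewrite mem_annulus absz_gt0 => /andP[].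
  apply/mapP; exists (Sub j j0) => //=; apply: (fsubsetP A0A).
  by rewrite in_fset mem_pmap; apply/mapP; exists j => //; rewrite insubT.
have -> : summability.partial_sum (fun j : {j : int | j != 0} =>
     fourier_coef (val j) * expi2pi ((val j)%:~R * x) : R[i]^o) A =
   Complex (\sum_(j <- s) gamma F x j) (\sum_(j <- s) gamma_im x j).
  rewrite /summability.partial_sum -Complex_sum /s big_map.
  rewrite (big_seq_fsetE _ A predT (fun j : {j : int | j != 0} => Complex (gamma F x (val j)) (gamma_im x (val j)) : R[i]^o)) /=.
  by apply: eq_bigr => j _; exact: fourier_termE.
have n0 : (0 < n)%N by [].
have h1 := finite_sum_error n0 us sub nz (gamma_le perF lipF sdF x).
have h2 := finite_sum_error n0 us sub nz (gamma_im_le x).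
have h3 := fsum_error perF lipF sdF mean0 x n0.
have e1 : \sum_(j <- annulus 0 n) gamma F x j = fsum F x n.
  rewrite sum_annulus /fsum mulr_sumr; apply: eq_bigr => i _.
  by rewrite gammaN; ring.
have e2 : \sum_(j <- annulus 0 n) gamma_im x j = 0.
  by rewrite sum_annulus big1 // => i _; rewrite gamma_imN subrr.
rewrite e1 in h1; rewrite e2 subr0 in h2.
set u := \sum_(j <- s) gamma F x j in h1 *; set v := \sum_(j <- s) _ in h2 *.
have -> : real_complex R (F x) - Complex u v = Complex (F x - u) (- v) :> R[i].
  by apply/eqP; rewrite eq_complex /= add0r !eqxx.
apply: le_trans (normc_le _ _) _; rewrite eE lecR normrN.
have h4 : `|F x - u| <= C / (4 * n%:R) + C / (4 * n%:R).
  have -> : F x - u = (F x - fsum F x n) - (u - fsum F x n) by ring.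
  by apply: le_trans (ler_normB _ _) _; exact: lerD.
have e5 : C / (4 * n%:R) = C / n%:R / 4 by field; rewrite lt0r_neq0.
have h5 : 0 <= C / n%:R by rewrite divr_ge0 // ltW.
rewrite e5 in h2 h4.
by move: h2 h4 nC h5; move: (C / n%:R) => z; lra.
Qed.

End FourierComplex.

(** * Periodization on a logarithmic scale *)

Section LimitTools.
Variable R : realType.
Implicit Types (u : R^nat) (l c B : R).

Lemma lim_dist_le u l c B (n0 : nat) : u @ \oo --> l ->
  (forall n, (n0 <= n)%N -> `|u n - c| <= B) -> `|l - c| <= B.
Proof.
move=> ul h; apply/ler_addgt0Pr => e e0.
have /cvgrPdist_le/(_ e e0) [n _ hn] := ul.
pose m := maxn n n0.
have -> : l - c = (l - u m) + (u m - c) by rewrite addrA subrK.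
apply: le_trans (ler_normD _ _) _; rewrite addrC lerD //.
  by apply: h; rewrite leq_maxr.
by apply: hn; rewrite /= leq_maxl.
Qed.

Lemma cvg_exp2V B : (fun n : nat => B * 2 ^- n) @ \oo --> (0 : R).
Proof.
rewrite -[X in _ --> X](mulr0 B); apply: cvgM; first exact: cvg_cst.
have : (fun n : nat => (2^-1 : R) ^+ n) @ \oo --> (0 : R).
  by apply: cvg_expr; rewrite ger0_norm; lra.
by apply: cvg_trans; apply: near_eq_cvg; near=> n; rewrite exprVn.
Unshelve. all: by end_near. Qed.

Lemma cvg_of_rate u l B : (forall n, `|u n - l| <= B * 2 ^- n) -> u @ \oo --> l.
Proof.
move=> h; apply/cvgrPdist_le => e e0.
have /cvgrPdist_le/(_ e e0) := cvg_exp2V B; apply: filterS => n.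
rewrite sub0r normrN distrC => hn; apply: le_trans (h n) _.
by apply: le_trans hn; exact: ler_norm.
Qed.

Lemma lim_norm_le u l B : u @ \oo --> l -> (forall n, `|u n| <= B) -> `|l| <= B.
Proof.
move=> ul h; rewrite -[l]subr0; apply: (@lim_dist_le u l 0 B 0 ul) => n _.
by rewrite subr0.
Qed.

Lemma eq_of_rate (a b B : R) : (forall n, `|a - b| <= B * 2 ^- n) -> a = b.
Proof.
move=> h; have hb := @cvg_of_rate (fun=> a) b B h.
have ha : (fun=> a) @ \oo --> a by exact: cvg_cst.
exact: (cvg_unique _ ha hb).
Qed.

End LimitTools.

Section PowersOfTwo.
Variable R : realType.
Implicit Types (x y h : R) (k : nat).

Definition two x : R := expR (ln 2 * x).

Lemma ln2_gt0 : 0 < ln 2 :> R.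
Proof. by rewrite ln_gt0 // ltr1n. Qed.

Lemma ln2_neq0 : ln 2 != 0 :> R.
Proof. exact/lt0r_neq0/ln2_gt0. Qed.

Lemma ln2_le1 : ln 2 <= 1 :> R.
Proof.
have := @le_ln1Dx R 1; rewrite (_ : 1 + 1 = 2); last lra.
by apply; lra.
Qed.

Lemma two_gt0 x : 0 < two x. Proof. exact: expR_gt0. Qed.

Lemma two0 : two 0 = 1. Proof. by rewrite /two mulr0 expR0. Qed.

Lemma twoD x y : two (x + y) = two x * two y.
Proof. by rewrite /two mulrDr expRD. Qed.

Lemma two_nat k : two k%:R = 2 ^+ k.
Proof. by rewrite /two mulrC expRM_natl lnK // posrE. Qed.

Lemma twoN x : two (- x) = (two x)^-1.
Proof. by rewrite /two mulrN expRN. Qed.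

Lemma two_log2 (n : nat) : (0 < n)%N -> two (log2 n%:R) = n%:R.
Proof. by move=> n0; rewrite /two /log2 mulrC divfK ?ln2_neq0 // lnK // posrE ltr0n. Qed.

Lemma le_two x y : x <= y -> two x <= two y.
Proof. by move=> xy; rewrite ler_expR ler_wpM2l // ltW // ln2_gt0. Qed.

Lemma is_derive_two y : is_derive y 1 two (ln 2 * two y).
Proof.
have d1 : is_derive y (1 : R) (fun y => ln 2 * y) (ln 2).
  by apply: is_derive_eq; rewrite /GRing.scale /= mulr1.
have := @is_derive1_comp _ expR (fun y => ln 2 * y) y _ _ (is_derive_expR _) d1.
by move=> h; apply: is_derive_eq; rewrite mulrC.
Qed.

Lemma mu_two y h : `|h| <= 1 -> mu (two (y + h)) <= 8 * mu (two y).
Proof.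
rewrite ler_norml => /andP[h1 h2]; rewrite twoD.
have c1 : 2^-1 <= two h by rewrite -[leLHS](_ : two (-1) = _) ?le_two // twoN (two_nat 1).
have c2 : two h <= 2 by rewrite -[leRHS](two_nat 1) le_two.
move: (two y) (two h) (two_gt0 y) c1 c2 => v c v0 c1 c2; rewrite /mu.
have e : 8 * (v / ((1 + v) * (2 + v))) = (8 * v) / ((1 + v) * (2 + v)) by ring.
rewrite e ler_pdivrMr; last by rewrite mulr_gt0 //; nra.
rewrite mulrAC ler_pdivlMr; last by rewrite mulr_gt0 //; lra.
have vc0 : 0 < v * c by rewrite mulr_gt0 //; lra.
suff : c * ((1 + v) * (2 + v)) <= 8 * ((1 + v * c) * (2 + v * c)) by nra.
have : v / 2 <= v * c by rewrite ler_wpM2l // ltW.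
move: (v * c) vc0 => w w0 vw; nra.
Qed.

Lemma mvt_bound (f df : R -> R) (y h B : R) :
  (forall z : R, `|z - y| <= `|h| -> is_derive z 1 f (df z)) ->
  (forall z, `|z - y| <= `|h| -> `|df z| <= B) -> `|f (y + h) - f y| <= B * `|h|.
Proof.
move=> dfE dfB.
have [h0|h0|->] := ltgtP h 0; last by rewrite addr0 subrr !normr0 mulr0.
- have yh : y + h < y by lra.
  have near z : y + h <= z -> z <= y -> `|z - y| <= `|h|.
    by move=> z1 z2; rewrite (ler0_norm (_ : h <= 0)) ?ler0_norm; lra.
  have [z||c] := @MVT _ f df _ _ yh.
  + by rewrite in_itv /= => /andP[z1 z2]; apply/dfE/near; exact: ltW.
  + apply: continuous_in_subspaceT => z; rewrite inE /= in_itv /= => /andP[z1 z2].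
    by apply: is_derive_continuous (dfE z _); exact: near.
  rewrite in_itv /= => /andP[c1 c2] e.
  rewrite distrC e normrM (_ : y - (y + h) = - h); last by ring.
  by rewrite normrN ler_wpM2r //; apply/dfB/near; exact: ltW.
- have yh : y < y + h by lra.
  have near z : y <= z -> z <= y + h -> `|z - y| <= `|h|.
    by move=> z1 z2; rewrite (ger0_norm (_ : 0 <= h)) ?ger0_norm; lra.
  have [z||c] := @MVT _ f df _ _ yh.
  + by rewrite in_itv /= => /andP[z1 z2]; apply/dfE/near; exact: ltW.
  + apply: continuous_in_subspaceT => z; rewrite inE /= in_itv /= => /andP[z1 z2].
    by apply: is_derive_continuous (dfE z _); exact: near.
  rewrite in_itv /= => /andP[c1 c2] e.
  rewrite e normrM (_ : y + h - y = h); last by ring.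
  by rewrite ler_wpM2r //; apply/dfB/near; exact: ltW.
Qed.

Lemma mu_two_ge0 y : 0 <= mu (two y).
Proof. by rewrite mu_ge0 // ltW // two_gt0. Qed.

Lemma diff1_mu (f df : R -> R) (C y h : R) : 0 <= C -> (forall z : R, is_derive z 1 f (df z)) ->
  (forall z, `|df z| <= C * mu (two z)) -> `|h| <= 1 ->
  `|f (y + h) - f y| <= 8 * C * mu (two y) * `|h|.
Proof.
move=> C0 dfE dfB h1; apply: (mvt_bound (fun z _ => dfE z)) => z zy.
apply: le_trans (dfB z) _.
have -> : 8 * C * mu (two y) = C * (8 * mu (two y)) by ring.
rewrite ler_wpM2l //.
have := @mu_two y (z - y); rewrite [y + _]addrC subrK; apply; exact: le_trans zy h1.
Qed.

(** The mean value theorem for s |-> f (y + s) + f (y - s), whose derivative is a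
    first difference of f1. *)
Lemma diff2_mu (f f1 f2 : R -> R) (C y h : R) : 0 <= C ->
  (forall z : R, is_derive z 1 f (f1 z)) -> (forall z : R, is_derive z 1 f1 (f2 z)) ->
  (forall z, `|f2 z| <= C * mu (two z)) -> `|h| <= 2^-1 ->
  `|f (y + h) - 2 * f y + f (y - h)| <= 128 * C * mu (two y) * h ^+ 2.
Proof.
move=> C0 d1 d2 b2 h2; pose phi s := f (s + y) + f (- s + y).
have dphi (s : R) : is_derive s 1 phi (f1 (s + y) - f1 (- s + y)).
  have e1 : is_derive s (1 : R) (fun s => s + y) 1.
    by apply: is_derive_eq; rewrite addr0.
  have e2 : is_derive s (1 : R) (fun s => - s + y) (- 1).
    by apply: is_derive_eq; rewrite addr0.
  have D1 := @is_derive1_comp _ f (fun s => s + y) s _ _ (d1 _) e1.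
  have D2 := @is_derive1_comp _ f (fun s => - s + y) s _ _ (d1 _) e2.
  have := is_deriveD D1 D2; rewrite mulr1 mulrN1.
  exact.
have := @mvt_bound phi _ 0 h (128 * C * mu (two y) * `|h|) (fun s _ => dphi s).
rewrite add0r /phi add0r oppr0 add0r [h + y]addrC [- h + y]addrC -[h ^+ 2]real_normK ?num_real //.
have -> : f (y + h) + f (y - h) - (f y + f y) = f (y + h) - 2 * f y + f (y - h) by ring.
move=> key; rewrite expr2 mulrA; apply: key => s; rewrite addr0 => sh.
have s1 : `|2 * s| <= 1.
  by rewrite normrM ger0_norm //; move: sh h2; lra.
have s2 : `|- s| <= 1 by rewrite normrN; move: sh h2; lra.
rewrite [- s + y]addrC; have := diff1_mu (y - s) C0 d2 b2 s1; rewrite (_ : y - s + 2 * s = s + y); last by ring.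
move=> /le_trans; apply; rewrite normrM (ger0_norm (_ : 0 <= 2 :> R)) //.
have := mu_two y s2; have m0 := mu_two_ge0 (y - s); have m1 := mu_two_ge0 y.
have s0 : 0 <= `|s| by []; move: (mu (two (y - s))) (mu (two y)) m0 m1 => a b a0 b0 ab.
have h3 : C * a * `|s| <= C * (8 * b) * `|h|.
  by apply: ler_pM => //; [rewrite mulr_ge0 | rewrite ler_wpM2l].
lra.
Qed.

End PowersOfTwo.

Section Window.
Variables (R : realType) (psi f f1 f2 : R -> R) (C lp lm : R).
Hypothesis C0 : 0 <= C.
Hypothesis dpsi : forall y : R, is_derive y 1 psi (f y).
Hypothesis df : forall y : R, is_derive y 1 f (f1 y).
Hypothesis df1 : forall y : R, is_derive y 1 f1 (f2 y).
Hypothesis bf : forall y, `|f y| <= C * mu (two y).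
Hypothesis bf1 : forall y, `|f1 y| <= C * mu (two y).
Hypothesis bf2 : forall y, `|f2 y| <= C * mu (two y).
Hypothesis cvg_lp : (fun n : nat => psi n.+1%:R) @ \oo --> lp.
Hypothesis cvg_lm : (fun n : nat => psi (1 - n%:R)) @ \oo --> lm.
Implicit Types (x y h : R) (k n K : nat).

(** The asymmetric range is that of Phi: the K levels of index k >= 0 and the K
    levels of negative index. *)
Definition window (f : R -> R) K x : R :=
  \sum_(k < K) (f (x - k%:R) + f (x + k.+1%:R)).

Lemma two_sub x k : two (x - k%:R) = two x / 2 ^+ k.
Proof. by rewrite twoD twoN two_nat. Qed.

Lemma two_add x k : two (x + k%:R) = two x * 2 ^+ k.
Proof. by rewrite twoD two_nat. Qed.

Lemma window_mu x K : window (fun y => mu (two y)) K x <= 2.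
Proof.
rewrite /window big_split /=.
have h1 : \sum_(k < K) mu (two (x - k%:R)) <= 1.
  under eq_bigr do rewrite two_sub.
  exact: sum_mu (two_gt0 x).
have h2 : \sum_(k < K) mu (two (x + k.+1%:R)) <= 1.
  rewrite (reindex_inj rev_ord_inj) /=.
  rewrite (eq_bigr (fun k : 'I_K => mu (two (x + K%:R) / 2 ^+ k))).
    exact: sum_mu (two_gt0 _).
  move=> k _; rewrite -two_sub; congr (mu (two _)).
  by rewrite subnSK // natrB 1?ltnW //; ring.
lra.
Qed.

Lemma window_tail x K n : `|window f (K + n) x - window f K x| <=
  2 * C * (two x + (two x)^-1) * 2 ^- K.
Proof.
have v0 := two_gt0 x; have vV0 : 0 < (two x)^-1 by rewrite invr_gt0.
rewrite /window big_split_ord /= addrC addrK.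
apply: le_trans (ler_norm_sum _ _ _) _.
apply: (@le_trans _ _ (\sum_(k < n) (C * (two x + (two x)^-1) * 2 ^- K) * 2^-1 ^+ k)).
  apply: ler_sum => k _; apply: le_trans (ler_normD _ _) _.
  have -> : C * (two x + (two x)^-1) * 2 ^- K * 2^-1 ^+ k =
      C * (two x / 2 ^+ (K + k)) + C * ((two x)^-1 / 2 ^+ (K + k)).
    by rewrite exprD invfM exprVn; ring.
  apply: lerD.
    apply: le_trans (bf _) _; rewrite ler_wpM2l // -two_sub.
    by apply: mu_le; rewrite ltW // two_gt0.
  apply: le_trans (bf _) _; rewrite ler_wpM2l // two_add.
  apply: le_trans (mu_leV _) _; first by rewrite mulr_gt0 // exp2_gt0.
  rewrite invfM ler_wpM2l ?(ltW vV0) // lef_pV2 ?posrE ?exp2_gt0 //.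
  by rewrite ler_weXn2l // ler1n.
rewrite -mulr_sumr mulrC; have := @sum_geom_le R 2^-1 n.
move=> /(_ _ _)/le_trans; have hh : 0 <= C * (two x + (two x)^-1) * 2 ^- K.
  by rewrite !mulr_ge0 // ?addr_ge0 ?ltW // exp2V_gt0.
have s2 : \sum_(k < n) (2^-1 : R) ^+ k <= 2 by apply: sum_geom_le; lra.
by move=> _; apply: le_trans (ler_wpM2r hh s2) _; rewrite le_eqVlt; apply/orP; left;
  apply/eqP; ring.
Qed.

Lemma window_cvg x : cvgn (fun K => window f K x).
Proof.
set B := 2 * C * (two x + (two x)^-1).
have -> : (fun K => window f K x) = series (fun k => f (x - k%:R) + f (x + k.+1%:R)).
  by apply/funext => K; rewrite /window /series /= big_mkord.
apply: normed_cvg.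
apply: (@series_le_cvg _ _ (fun k => B * 2^-1 ^+ k)) => [k|k|k|] /=.
- by [].
- rewrite mulr_ge0 ?exprn_ge0 // mulr_ge0 ?mulr_ge0 // addr_ge0 ?invr_ge0 ?ltW ?two_gt0 //.
- have := window_tail x k 1; rewrite /window addn1 big_ord_recr /= addrC addrK exprVn.
  exact.
- have := @is_cvg_geometric_series R B 2^-1; apply.
  by rewrite ger0_norm; lra.
Qed.

(** The periodization of f. *)
Definition bisum (f : R -> R) x : R := limn (fun K => window f K x).

Lemma cvg_window x : window f ^~ x @ \oo --> bisum f x.
Proof. exact: window_cvg. Qed.

Lemma bisum_rate x K : `|bisum f x - window f K x| <=
  2 * C * (two x + (two x)^-1) * 2 ^- K.
Proof.
have := @lim_dist_le _ _ _ (window f K x) (2 * C * (two x + (two x)^-1) * 2 ^- K) K (@cvg_window x).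
apply=> n Kn.
by rewrite -(subnKC Kn); exact: window_tail.
Qed.

Lemma window_shift x K : window f K (x + 1) - window f K x =
  f (x + 1 + K%:R) - f (x + 1 - K%:R).
Proof.
elim: K => [|K IH]; first by rewrite /window !big_ord0 mulr0n addr0 !subr0 subrr.
rewrite /window !big_ord_recr /= -!/(window _ _ _) opprD addrACA IH.
have -> : x + 1 + K.+1%:R = x + 1 + K%:R + 1 by rewrite -natr1; ring.
have -> : x + K.+1%:R = x + 1 + K%:R by rewrite -natr1; ring.
have -> : x + 1 - K.+1%:R = x - K%:R by rewrite -natr1; ring.
ring.
Qed.

Lemma bisum_periodic x : bisum f (x + 1) = bisum f x.
Proof.
have v0 := two_gt0 x.
apply: (@eq_of_rate _ _ _ (2 * C * (two (x + 1) + (two (x + 1))^-1) +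
  2 * C * (two x + (two x)^-1) + (C * (two (x + 1))^-1 + C * two (x + 1)))) => K.
have -> : bisum f (x + 1) - bisum f x = (bisum f (x + 1) - window f K (x + 1)) -
  (bisum f x - window f K x) + (window f K (x + 1) - window f K x) by ring.
rewrite !mulrDl window_shift; apply: le_trans (ler_normD _ _) _; apply: lerD.
  rewrite -!mulrDl; apply: le_trans (ler_normB _ _) _.
  rewrite mulrDl; apply: lerD; exact: bisum_rate.
rewrite -mulrDl; apply: le_trans (ler_normB _ _) _; rewrite mulrDl; apply: lerD.
  apply: le_trans (bf _) _; rewrite -mulrA ler_wpM2l // two_add.
  apply: le_trans (mu_leV _) _; last by rewrite invfM.
  by rewrite mulr_gt0 ?two_gt0 ?exp2_gt0.
apply: le_trans (bf _) _; rewrite -mulrA ler_wpM2l // two_sub mu_le //.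
by rewrite mulr_ge0 ?invr_ge0 ?ltW ?two_gt0 ?exp2_gt0.
Qed.

Lemma bisum_lip x h : `|h| <= 2^-1 -> `|bisum f (x + h) - bisum f x| <= 256 * C * `|h|.
Proof.
move=> h2; have h1 : `|h| <= 1 by move: h2; lra.
apply: (@lim_norm_le _ (fun K => window f K (x + h) - window f K x)).
  by apply: cvgB; exact: cvg_window.
move=> K; rewrite /window -sumrB.
apply: (@le_trans _ _ (8 * C * `|h| * window (fun y => mu (two y)) K x)).
  rewrite /window mulr_sumr; apply: le_trans (ler_norm_sum _ _ _) _; apply: ler_sum => k _.
  have g1 := diff1_mu (x - k%:R) C0 df bf1 h1.
  have g2 := diff1_mu (x + k.+1%:R) C0 df bf1 h1.
  have -> : f (x + h - k%:R) + f (x + h + k.+1%:R) - (f (x - k%:R) + f (x + k.+1%:R)) =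
     (f (x - k%:R + h) - f (x - k%:R)) + (f (x + k.+1%:R + h) - f (x + k.+1%:R)).
    by rewrite (addrAC x h) (addrAC x h k.+1%:R); ring.
  apply: le_trans (ler_normD _ _) _; rewrite mulrDr.
  by apply: lerD; rewrite mulrAC.
have c0 : 0 <= 8 * C * `|h| by rewrite !mulr_ge0.
by have := ler_wpM2l c0 (window_mu x K); lra.
Qed.

Lemma bisum_diff2 x h : `|h| <= 2^-1 ->
  `|bisum f (x + h) - 2 * bisum f x + bisum f (x - h)| <= 256 * C * h ^+ 2.
Proof.
move=> h2.
apply: (@lim_norm_le _ (fun K => window f K (x + h) - 2 * window f K x + window f K (x - h))).
  apply: cvgD; last exact: cvg_window.
  by apply: cvgB; [exact: cvg_window|apply: cvgM; [exact: cvg_cst|exact: cvg_window]].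
move=> K; rewrite /window mulr_sumr -sumrB -big_split /=.
apply: (@le_trans _ _ (128 * C * h ^+ 2 * window (fun y => mu (two y)) K x)).
  rewrite /window mulr_sumr; apply: le_trans (ler_norm_sum _ _ _) _; apply: ler_sum => k _.
  have g1 := diff2_mu (x - k%:R) C0 df df1 bf2 h2.
  have g2 := diff2_mu (x + k.+1%:R) C0 df df1 bf2 h2.
  have -> : f (x + h - k%:R) + f (x + h + k.+1%:R) - 2 * (f (x - k%:R) + f (x + k.+1%:R))
      + (f (x - h - k%:R) + f (x - h + k.+1%:R)) =
     (f (x - k%:R + h) - 2 * f (x - k%:R) + f (x - k%:R - h)) +
     (f (x + k.+1%:R + h) - 2 * f (x + k.+1%:R) + f (x + k.+1%:R - h)).
    by rewrite !(addrAC x h) !(addrAC x (- h)); ring.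
  apply: le_trans (ler_normD _ _) _; rewrite mulrDr.
  by apply: lerD; rewrite mulrAC.
have c0 : 0 <= 128 * C * h ^+ 2.
  by apply: mulr_ge0; [exact: mulr_ge0 | exact: sqr_ge0].
by have := ler_wpM2l c0 (window_mu x K); lra.
Qed.

(** Over one period, the windows of f integrate to increments of psi over longer and
    longer intervals. *)
Lemma mean01_bisum : mean01 (bisum f) = lp - lm.
Proof.
have cF : continuous (bisum f) := continuous_lip bisum_lip.
have cf : continuous f by move=> z; exact: is_derive_continuous (df z).
have cW K : continuous (window f K).
  have [h _] := mean01_sum (index_enum 'I_K) (fun k : 'I_K =>
    (fun x => cvgD (@continuous_shift _ f (- k%:R) cf x) (@continuous_shift _ f k.+1%:R cf x))
    : continuous (fun x => f (x - k%:R) + f (x + k.+1%:R))).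
  exact: h.
have mW K : mean01 (window f K) = psi K.+1%:R - psi (1 - K%:R).
  have dsh (s x : R) : is_derive x 1 (fun x => psi (x + s)) (f (x + s)).
    have e1 : is_derive x (1 : R) (fun x => x + s) 1.
      by apply: is_derive_eq; rewrite addr0.
    have := @is_derive1_comp _ psi (fun x => x + s) x _ _ (dpsi _) e1.
    by rewrite mulr1.
  have dW x : 0 <= x -> x <= 1 -> is_derive x 1 (window psi K) (window f K x).
    move=> _ _; rewrite /window; elim: (K) => [|n IH].
      have -> : (fun x => \sum_(k < 0) (psi (x - k%:R) + psi (x + k.+1%:R))) = cst 0.
        by apply/funext => z; rewrite big_ord0.
      by rewrite big_ord0; exact: is_derive_cst.
    have -> : (fun x => \sum_(k < n.+1) (psi (x - k%:R) + psi (x + k.+1%:R))) =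
      (fun x => \sum_(k < n) (psi (x - k%:R) + psi (x + k.+1%:R))) \+
      ((fun x => psi (x - n%:R)) \+ (fun x => psi (x + n.+1%:R))).
      by apply/funext => z; rewrite big_ord_recr.
    by rewrite big_ord_recr; apply: is_deriveD; apply: is_deriveD; exact: dsh.
  rewrite (mean01_FTC (cW K) dW).
  elim: (K) => [|n IH]; first by rewrite /window !big_ord0 mulr0n mulr1n !subr0 subrr.
  rewrite /window !big_ord_recr /= -!/(window _ _ _) opprD addrACA IH !add0r.
  have -> : 1 + n.+1%:R = n.+2%:R :> R by rewrite -[RHS]natr1 addrC.
  have -> : 1 - n.+1%:R = - n%:R :> R by rewrite -natr1; ring.
  ring.
have rate K : `|mean01 (bisum f) - mean01 (window f K)| <= 6 * C * 2 ^- K.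
  have -> : mean01 (bisum f) - mean01 (window f K) =
      mean01 (fun x => bisum f x + -1 * window f K x).
    rewrite mean01D //; last by apply: continuous_mul => //; exact: continuous_cst.
    by rewrite mean01Z // mulN1r.
  apply: mean01_norm => [x|x x0 x1].
    by apply: cvgD; [exact: cF|apply: cvgM; [exact: cvg_cst|exact: cW]].
  rewrite mulN1r; apply: le_trans (bisum_rate x K) _.
  rewrite ler_wpM2r ?(ltW (exp2V_gt0 _ _)) //.
  have t1 : 1 <= two x by rewrite -[leLHS](two0 R) le_two.
  have t2 : two x <= 2 by rewrite -[leRHS](two_nat _ 1) le_two.
  have t3 : (two x)^-1 <= 1 by rewrite invf_le1 // two_gt0.
  have : C * (two x + (two x)^-1) <= C * 3 by rewrite ler_wpM2l //; lra.
  lra.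
have h1 : (fun K => mean01 (window f K)) @ \oo --> mean01 (bisum f).
  by apply: (@cvg_of_rate _ _ _ (6 * C)) => K; rewrite distrC; exact: rate.
have h2 : (fun K => mean01 (window f K)) @ \oo --> lp - lm.
  have -> : (fun K => mean01 (window f K)) = (fun K => psi K.+1%:R - psi (1 - K%:R)).
    by apply/funext => K; rewrite mW.
  exact: cvgB.
exact: (cvg_unique _ h1 h2).
Qed.

End Window.

(** * Oscillating profiles *)

Section Profile.
Variable R : realType.
Implicit Types (x y v : R) (i k m n K N : nat).

Local Notation L := (ln 2 : R).

(** The building blocks of Gfun in the variable y = log2 v, in which halving v is a
    translation. *)
Definition gam i y : R := catom 1 i (two y).
Definition pf v : R := (1 - expR (- v)) / v.
Definition Pf y : R := pf (two y).
(** Pf tends to 1 at - oo, so its translates are not summable; gam 0 has the same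
    limit and corrects this. *)
Definition pe y : R := Pf y - gam 0 y.

Lemma gamE i y : gam i y = expR (i%:R * (L * y) - two y).
Proof.
by rewrite expRD expRM_natl /gam /catom mul1r.
Qed.

Lemma is_derive_gam i y : is_derive y 1 (gam i) (L * (i%:R * gam i y - gam i.+1 y)).
Proof.
have d1 : is_derive y (1 : R) (fun y => i%:R * (L * y) - two y) (i%:R * L - L * two y).
  have d2 : is_derive y (1 : R) (fun y => i%:R * (L * y)) (i%:R * L).
    by apply: is_derive_eq; rewrite /GRing.scale /= !mulr1.
  exact: (is_deriveB d2 (is_derive_two y)).
have := @is_derive1_comp _ expR _ y _ _ (is_derive_expR _) d1.
have -> : expR \o (fun y => i%:R * (L * y) - two y) = gam i.
  by apply/funext => z; rewrite gamE.
rewrite /= -gamE (_ : _ * _ = L * (i%:R * gam i y - gam i.+1 y)) //.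
by rewrite /gam /catom exprS; ring.
Qed.

Lemma is_derive_Pf y : is_derive y 1 Pf (L * (gam 0 y - Pf y)).
Proof.
have d1 := is_derive_gam 0 y.
have d2 : is_derive y (1 : R) (fun y => two (- y)) (- (L * two (- y))).
  have d3 : is_derive y (1 : R) (fun y => - y) (-1) by apply: is_derive_eq.
  have := @is_derive1_comp _ (@two R) _ y _ _ (is_derive_two _) d3.
  by rewrite mulrN1.
have d4 : is_derive y (1 : R) (fun y => 1 - gam 0 y) (- (L * (0%:R * gam 0 y - gam 1 y))).
  have := is_deriveB (is_derive_cst (1 : R) y 1) d1; by rewrite sub0r.
have := is_deriveM d4 d2.
have -> : (fun y => 1 - gam 0 y) * (fun y => two (- y)) = Pf.
  by apply/funext => z; rewrite /Pf /pf /gam /catom fctE expr0 !mul1r /= twoN.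
rewrite (_ : _ *: _ + _ = L * (gam 0 y - Pf y)) //.
rewrite /GRing.scale /= /Pf /pf /gam /catom twoN expr1 !expr0 !mul1r; field.
by rewrite lt0r_neq0 ?two_gt0.
Qed.

Lemma gam_mu i y : 0 <= gam i.+1 y <= cmu R i * mu (two y).
Proof.
rewrite catom_ge0 ?(ltW (two_gt0 _)) //= catom_mu ?two_gt0 //; lra.
Qed.

Lemma pf_bounds v : 0 < v -> [/\ 0 <= pf v, pf v <= 1, 1 - pf v <= v & pf v <= v^-1].
Proof.
move=> v0; have /andP[h1 h2] := expRN_sub1 (ltW v0).
have h3 := expR_gt0 (- v).
split.
- by rewrite divr_ge0 // ltW.
- by rewrite ler_pdivrMr // mul1r.
- rewrite lerBlDr -lerBlDl ler_pdivlMr //.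
  have := expR_ge1Dx v; rewrite -[v in expR v]opprK (expRN (- v)) => h4.
  have h5 : (1 + v) * expR (- v) <= 1 by rewrite -ler_pdivlMr // mul1r.
  have := expRN_sub1 (ltW v0); nra.
- by rewrite ler_pdivrMr // mulVf ?lt0r_neq0 //; lra.
Qed.

Lemma gam0_bounds y : [/\ 0 <= gam 0 y, 1 - gam 0 y <= two y & gam 0 y <= (two y)^-1].
Proof.
have v0 := two_gt0 y; rewrite /gam /catom expr0 !mul1r.
split; first exact: expR_ge0.
  by have /andP[] := expRN_sub1 (ltW v0).
rewrite -[leRHS]mul1r ler_pdivlMr // mulrC.
have := exprn_expRN 1 (ltW v0); rewrite !expr1; lra.
Qed.

Lemma pe_mu y : 0 <= pe y <= 6 * mu (two y).
Proof.
have v0 := two_gt0 y; have [h1 h2 h3 h4] := pf_bounds v0.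
have [g0 g1 g2] := gam0_bounds y; rewrite /pe /Pf.
have e : gam 0 y <= pf (two y).
  rewrite ler_pdivlMr // /gam /catom expr0 !mul1r.
  have := expR_ge1Dx (two y); have e0 := expR_gt0 (- two y).
  have := expRxMexpNx_1 (two y); nra.
apply/andP; split; first by rewrite subr_ge0.
have := @le_mu R 1 (pf (two y) - gam 0 y) _ v0 ler01; rewrite mulr1 mul1r; apply.
  lra.
have : pf (two y) * two y <= 1.
  by rewrite -ler_pdivlMr // mul1r.
have : 0 <= gam 0 y * two y by rewrite mulr_ge0 // ltW.
rewrite mulrBl; lra.
Qed.

Section Combination.
Variables a b c : R.

Definition prof y : R := a * pe y + b * gam 1 y + c * gam 2 y.
Definition prof1 y : R :=
  L * (- a * pe y + (a + b) * gam 1 y + (2 * c - b) * gam 2 y - c * gam 3 y).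
Definition prof2 y : R := L ^+ 2 * (a * pe y + b * gam 1 y
  + (4 * c - 3 * b - a) * gam 2 y + (b - 5 * c) * gam 3 y + c * gam 4 y).
Definition psi y : R := - (L^-1 * (a * Pf y + b * gam 0 y + c * (gam 1 y + gam 0 y))).

Definition prof_cst : R :=
  20 * (`|a| + `|b| + `|c|) * (6 + cmu R 0 + cmu R 1 + cmu R 2 + cmu R 3).

Lemma prof_cst_ge0 : 0 <= prof_cst.
Proof.
have := cmu_ge0 R 0; have := cmu_ge0 R 1; have := cmu_ge0 R 2; have := cmu_ge0 R 3.
move=> *; apply: mulr_ge0; last by lra.
by rewrite mulr_ge0 // !addr_ge0.
Qed.

Lemma is_derive_psi y : is_derive y 1 psi (prof y).
Proof.
have dP := is_derive_Pf y; have d0 := is_derive_gam 0 y; have d1 := is_derive_gam 1 y.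
rewrite /psi; apply: is_derive_eq; rewrite /GRing.scale /= /prof /pe.
by field; rewrite ln2_neq0.
Qed.

Lemma is_derive_prof y : is_derive y 1 prof (prof1 y).
Proof.
have dP := is_derive_Pf y; have d0 := is_derive_gam 0 y; have d1 := is_derive_gam 1 y.
have d2 := is_derive_gam 2 y.
rewrite /prof /pe; apply: is_derive_eq; rewrite /GRing.scale /= /prof1 /pe; ring.
Qed.

Lemma is_derive_prof1 y : is_derive y 1 prof1 (prof2 y).
Proof.
have dP := is_derive_Pf y; have d0 := is_derive_gam 0 y; have d1 := is_derive_gam 1 y.
have d2 := is_derive_gam 2 y; have d3 := is_derive_gam 3 y.
rewrite /prof1 /pe; apply: is_derive_eq; rewrite /GRing.scale /= /prof2 /pe; ring.
Qed.

Lemma comb_le (u v w : R) : -4 <= u <= 4 -> -4 <= v <= 4 -> -5 <= w <= 5 ->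
  `|u * a + v * b + w * c| <= 5 * (`|a| + `|b| + `|c|).
Proof.
move=> hu hv hw.
have hu5 : `|u| <= 5 by rewrite ler_norml; lra.
have hv5 : `|v| <= 5 by rewrite ler_norml; lra.
have hw5 : `|w| <= 5 by rewrite ler_norml.
rewrite !mulrDr; apply: le_trans (ler_normD _ _) _; apply: lerD.
  by apply: le_trans (ler_normD _ _) _; apply: lerD; rewrite normrM ler_wpM2r.
by rewrite normrM ler_wpM2r.
Qed.

Lemma prof_bounds y : [/\ `|prof y| <= prof_cst * mu (two y),
  `|prof1 y| <= prof_cst * mu (two y) & `|prof2 y| <= prof_cst * mu (two y)].
Proof.
have A0 : 0 <= `|a| by []. have B0 : 0 <= `|b| by []. have D0 : 0 <= `|c| by [].
have na : `|a| <= 5 * (`|a| + `|b| + `|c|) by lra.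
have nNa : `|- a| <= 5 * (`|a| + `|b| + `|c|) by rewrite normrN; lra.
have nb : `|b| <= 5 * (`|a| + `|b| + `|c|) by lra.
have nc : `|c| <= 5 * (`|a| + `|b| + `|c|) by lra.
have nNc : `|- c| <= 5 * (`|a| + `|b| + `|c|) by rewrite normrN; lra.
have [[e1 e2] [e3 e4]] :
    (`|a + b| <= 5 * (`|a| + `|b| + `|c|) /\ `|2 * c - b| <= 5 * (`|a| + `|b| + `|c|)) /\
    (`|4 * c - 3 * b - a| <= 5 * (`|a| + `|b| + `|c|) /\ `|b - 5 * c| <= 5 * (`|a| + `|b| + `|c|)).
  have := comb_le (u := 1) (v := 1) (w := 0); have := comb_le (u := 0) (v := -1) (w := 2).
  have := comb_le (u := -1) (v := -3) (w := 4); have := comb_le (u := 0) (v := 1) (w := -5).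
  move=> h4 h3 h2 h1; split; split.
  - by rewrite (_ : _ + _ = 1 * a + 1 * b + 0 * c); [apply: h1; clear -a b c; lra|ring].
  - by rewrite (_ : _ - _ = 0 * a + -1 * b + 2 * c); [apply: h2; clear -a b c; lra|ring].
  - by rewrite (_ : _ - _ = -1 * a + -3 * b + 4 * c); [apply: h3; clear -a b c; lra|ring].
  - by rewrite (_ : _ - _ = 0 * a + 1 * b + -5 * c); [apply: h4; clear -a b c; lra|ring].
have u0 := mu_two_ge0 y.
have /andP[p0 p1] := pe_mu y; have /andP[a1 b1] := gam_mu 0 y.
have /andP[a2 b2] := gam_mu 1 y; have /andP[a3 b3] := gam_mu 2 y.
have /andP[a4 b4] := gam_mu 3 y.
have k0 := cmu_ge0 R 0; have k1 := cmu_ge0 R 1; have k2 := cmu_ge0 R 2.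
have k3 := cmu_ge0 R 3.
set M := (6 + cmu R 0 + cmu R 1 + cmu R 2 + cmu R 3) * mu (two y).
have uc (d : R) : 0 <= d -> 0 <= d * mu (two y) by move=> ?; rewrite mulr_ge0.
have := uc _ k0; have := uc _ k1; have := uc _ k2; have := uc _ k3 => w3 w2 w1 w0.
have [m1 m2 m3 [m4 m5]] : [/\ pe y <= M, gam 1 y <= M, gam 2 y <= M
    & gam 3 y <= M /\ gam 4 y <= M].
  rewrite /M; clear -a b c p1 b1 b2 b3 b4 w0 w1 w2 w3 u0.
  by split; [lra..|split; lra].
have M0 : 0 <= M by apply: le_trans m1.
have bnd (d e q B : R) : `|d| <= e -> 0 <= q <= B -> `|d * q| <= e * B.
  by move=> de /andP[q0 qB]; rewrite normrM (ger0_norm q0); apply: ler_pM.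
have S0 : 0 <= `|a| + `|b| + `|c| by rewrite !addr_ge0.
have big (d q : R) : `|d| <= 5 * (`|a| + `|b| + `|c|) -> 0 <= q <= M ->
    `|d * q| <= 5 * (`|a| + `|b| + `|c|) * M by exact: bnd.
have q1 : 0 <= gam 1 y <= M by rewrite a1.
have q2 : 0 <= gam 2 y <= M by rewrite a2.
have q3 : 0 <= gam 3 y <= M by rewrite a3.
have q4 : 0 <= gam 4 y <= M by rewrite a4.
have qp : 0 <= pe y <= M by rewrite p0.
have L0 := ln2_gt0 R; have L1 := ln2_le1 R.
rewrite /prof_cst -(mulrA _ _ (mu (two y))) -/M.
set S := `|a| + `|b| + `|c| in S0 big na nNa nb nc nNc e1 e2 e3 e4 *.
have SM : 0 <= S * M by rewrite mulr_ge0.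
split.
- apply: le_trans (ler_normD _ _) _.
  have := ler_normD (a * pe y) (b * gam 1 y).
  have := big _ _ na qp; have := big _ _ nb q1; have := big _ _ nc q2.
  clear -a b c SM; lra.
- rewrite /prof1 normrM (gtr0_norm L0).
  have h : `|- a * pe y + (a + b) * gam 1 y + (2 * c - b) * gam 2 y - c * gam 3 y| <= 20 * S * M.
    apply: le_trans (ler_normB _ _) _.
    have := ler_normD (- a * pe y + (a + b) * gam 1 y) ((2 * c - b) * gam 2 y).
    have := ler_normD (- a * pe y) ((a + b) * gam 1 y).
    have := big _ _ nNa qp; have := big _ _ e1 q1; have := big _ _ e2 q2.
    have := big _ _ nc q3; clear -a b c; lra.
  by apply: le_trans h; rewrite ler_piMl.
- rewrite /prof2 normrM (ger0_norm (sqr_ge0 _)).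
  have L2 : L ^+ 2 <= 1 by rewrite exprn_ile1 // ltW.
  have h : `|a * pe y + b * gam 1 y + (4 * c - 3 * b - a) * gam 2 y + (b - 5 * c) * gam 3 y
     + c * gam 4 y| <= 20 * S * M.
    have A1 := bnd _ _ _ _ (lexx `|a|) qp.
    have A2 := bnd _ _ _ _ (lexx `|b|) q1.
    have A5 := bnd _ _ _ _ (lexx `|c|) q4.
    apply: le_trans (ler_normD _ _) _.
    have := ler_normD (a * pe y + b * gam 1 y + (4 * c - 3 * b - a) * gam 2 y)
      ((b - 5 * c) * gam 3 y).
    have := ler_normD (a * pe y + b * gam 1 y) ((4 * c - 3 * b - a) * gam 2 y).
    have := ler_normD (a * pe y) (b * gam 1 y).
    have := big _ _ e3 q2; have := big _ _ e4 q3.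
    have : S * M = `|a| * M + `|b| * M + `|c| * M by rewrite /S; ring.
    clear -a b c A1 A2 A5 SM; lra.
  by apply: le_trans h; rewrite ler_piMl.
Qed.

Lemma psi_lp : (fun n : nat => psi n.+1%:R) @ \oo --> (0 : R).
Proof.
apply: (@cvg_of_rate _ _ _ (L^-1 * (`|a| + `|b| + `|c| * (1 + cmu R 0)))) => n.
have v0 := two_gt0 (n.+1%:R : R).
have vn : (two (n.+1%:R : R))^-1 <= 2 ^- n.
  rewrite two_nat lef_pV2 ?posrE ?exp2_gt0 // ler_weXn2l ?ler1n //.
have [h1 _ _ h4] := pf_bounds v0; have [g0 _ g2] := gam0_bounds (n.+1%:R : R).
have /andP[i0 i1] := gam_mu 0 (n.+1%:R : R).
have i2 : gam 1 (n.+1%:R : R) <= cmu R 0 * 2 ^- n.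
  apply: le_trans i1 _; rewrite ler_wpM2l ?cmu_ge0 //.
  exact: le_trans (mu_leV v0) vn.
have L0 := ln2_gt0 R.
rewrite subr0 /psi normrN normrM (ger0_norm (_ : 0 <= L^-1)) ?invr_ge0 ?(ltW L0) //.
rewrite -mulrA ler_wpM2l ?invr_ge0 ?(ltW L0) //.
have t1 : `|a * Pf n.+1%:R| <= `|a| * 2 ^- n.
  by rewrite normrM ler_wpM2l // ger0_norm //; exact: le_trans h4 vn.
have t2 : `|b * gam 0 n.+1%:R| <= `|b| * 2 ^- n.
  by rewrite normrM ler_wpM2l // ger0_norm //; exact: le_trans g2 vn.
have t3 : `|c * (gam 1 n.+1%:R + gam 0 n.+1%:R)| <= `|c| * ((1 + cmu R 0) * 2 ^- n).
  rewrite normrM ler_wpM2l // ger0_norm ?addr_ge0 // mulrDl mul1r addrC lerD //.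
  exact: le_trans g2 vn.
apply: le_trans (ler_normD _ _) _; have := ler_normD (a * Pf n.+1%:R) (b * gam 0 n.+1%:R).
lra.
Qed.

Lemma psi_lm : (fun n : nat => psi (1 - n%:R)) @ \oo --> - (L^-1 * (a + b + c)).
Proof.
apply: (@cvg_of_rate _ _ _ (L^-1 * (4 * (`|a| + `|b| + 2 * `|c|)))) => n.
set y : R := 1 - n%:R; have v0 := two_gt0 y.
have vn : two y = 2 * 2 ^- n by rewrite two_sub (two_nat _ 1).
have [_ h2 h3 _] := pf_bounds v0; have [g0 g1 _] := gam0_bounds y.
have g3 : gam 0 y <= 1.
  by rewrite /gam /catom expr0 !mul1r -[leRHS]expR0 ler_expR oppr_le0 ltW.
have [i0 i1] : 0 <= gam 1 y /\ gam 1 y <= two y.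
  rewrite /gam /catom expr1 mul1r; split; first by rewrite mulr_ge0 ?expR_ge0 // ltW.
  by rewrite ler_piMr ?(ltW v0) // -[leRHS]expR0 ler_expR oppr_le0 ltW.
have L0 := ln2_gt0 R.
have -> : psi y - - (L^-1 * (a + b + c)) =
   L^-1 * (a * (1 - Pf y) + b * (1 - gam 0 y) + c * ((1 - gam 0 y) - gam 1 y)).
  by rewrite /psi; ring.
rewrite normrM (ger0_norm (_ : 0 <= L^-1)) ?invr_ge0 ?(ltW L0) //.
rewrite -mulrA ler_wpM2l ?invr_ge0 ?(ltW L0) //.
have t1 : `|a * (1 - Pf y)| <= `|a| * two y.
  by rewrite normrM ler_wpM2l // ger0_norm // /Pf; lra.
have t2 : `|b * (1 - gam 0 y)| <= `|b| * two y.
  by rewrite normrM ler_wpM2l // ger0_norm //; lra.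
have t3 : `|c * ((1 - gam 0 y) - gam 1 y)| <= `|c| * (2 * two y).
  by rewrite normrM ler_wpM2l // ler_norml; apply/andP; split; lra.
rewrite vn in t1 t2 t3.
have z0 : 0 <= `|a| * 2 ^- n by rewrite mulr_ge0 // ltW // exp2V_gt0.
have z1 : 0 <= `|b| * 2 ^- n by rewrite mulr_ge0 // ltW // exp2V_gt0.
have z2 : 0 <= `|c| * 2 ^- n by rewrite mulr_ge0 // ltW // exp2V_gt0.
apply: le_trans (ler_normD _ _) _.
have := ler_normD (a * (1 - Pf y)) (b * (1 - gam 0 y)); lra.
Qed.

(** By mean01_bisum the constant is the mean of the periodization, as psi tends to 0
    at + oo and to - (a + b + c) / ln 2 at - oo. *)
Definition osc x : R := bisum prof x - L^-1 * (a + b + c).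

Lemma osc_periodic x : osc (x + 1) = osc x.
Proof.
rewrite /osc (bisum_periodic prof_cst_ge0) // => y.
by have [] := prof_bounds y.
Qed.

(** The periodization inherits from prof the bounds on first and second
    differences. *)
Lemma osc_fourier : fourier_expansion0 osc (fourier_coef osc).
Proof.
have b0 y : `|prof y| <= prof_cst * mu (two y) by have [] := prof_bounds y.
have b1 y : `|prof1 y| <= prof_cst * mu (two y) by have [] := prof_bounds y.
have b2 y : `|prof2 y| <= prof_cst * mu (two y) by have [] := prof_bounds y.
have C0 := prof_cst_ge0.
have lipB x h : `|h| <= 2^-1 -> `|bisum prof (x + h) - bisum prof x| <= 256 * prof_cst * `|h|.
  exact: (bisum_lip C0 is_derive_prof b0 b1).
have cB : continuous (bisum prof) := continuous_lip lipB.
apply: (@fourier_expansionP _ _ (256 * prof_cst)).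
- exact: osc_periodic.
- move=> x h h2; rewrite /osc (_ : _ - _ - _ = bisum prof (x + h) - bisum prof x).
    exact: lipB.
  move: (bisum _ _) (bisum _ _) (L^-1 * _) => u v z; ring.
- move=> x h h2; rewrite /osc.
  rewrite (_ : _ + _ = bisum prof (x + h) - 2 * bisum prof x + bisum prof (x - h)).
    exact: (bisum_diff2 C0 is_derive_prof is_derive_prof1 b0 b2).
  move: (bisum _ _) (bisum _ _) (bisum _ _) (L^-1 * _) => u v w z; ring.
- rewrite /osc; rewrite (@mean01D _ (bisum prof) (fun=> - (L^-1 * (a + b + c)))) //;
    last exact: continuous_cst.
  rewrite mean01_cst.
  rewrite (mean01_bisum C0 is_derive_psi is_derive_prof b0 b1 psi_lp psi_lm).
  move: (L^-1 * _) => z; ring.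
Qed.

End Combination.
End Profile.

(** * Oscillating and telescoping parts *)

Section Mellin.
Variable R : realType.
Implicit Types (x y v t : R) (i k m n K N : nat) (g h : nat -> R).

Local Notation L := (ln 2 : R).

Lemma windowS (f : R -> R) K x :
  window f K.+1 x = window f K x + (f (x - K%:R) + f (x + K.+1%:R)).
Proof. by rewrite /window big_ord_recr. Qed.

Lemma windowD (f h : R -> R) K x :
  window (fun y => f y + h y) K x = window f K x + window h K x.
Proof. by rewrite /window -big_split; apply: eq_bigr => k _ /=; ring. Qed.

Lemma windowZ c (f : R -> R) K x : window (fun y => c * f y) K x = c * window f K x.
Proof. by rewrite /window mulr_sumr; apply: eq_bigr => k _; ring. Qed.

Lemma window_tele (h : R -> R) K x :
  window (fun y => h y - h (y - 1)) K x = h (x + K%:R) - h (x - K%:R).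
Proof.
elim: K => [|K IH]; first by rewrite /window big_ord0 mulr0n addr0 subr0 subrr.
rewrite windowS IH.
have -> : x + K.+1%:R - 1 = x + K%:R by rewrite -natr1; ring.
have -> : x - K.+1%:R = x - K%:R - 1 by rewrite -natr1; ring.
ring.
Qed.

(** The coefficient of pe that remains once the differences in slack are removed. *)
Definition Pc m : R := - (cal1 R m + cbe1 R m).

Lemma ccE m : cc R m * 2 ^+ m = cal1 R m - 2^-1 * cal R m + cbe1 R m - cbe R m.
Proof.
have [e1 _ e3 _ _] := coef_eqs R m; rewrite e1 -addrA e3 /cc; ring.
Qed.

(** The part of Gfun m (2 ^ y) / 2 ^ y that telescopes over integer translates. *)
Definition slack m y : R :=
  cal R m / 2 * (Pf y - Pf (y - 1)) + cc R m * 2 ^+ m * (Pf y - Pf (y + m%:R))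
  - cal1 R m * (gam 0 y - gam 0 (y - 1)).

(** The constants 1, cal, cbe and cc cancel, so the exponentials occur only through
    (1 - exp (- a v)) / v, and for a = 1 / 2 and a = 2 ^ m these are translates of Pf up
    to a factor. *)
Lemma Gfun_two m y : Gfun m (two y) =
  two y * (prof (Pc m) (cbe2 R m) (cga R m) y + slack m y).
Proof.
have v0 := two_gt0 y; have p0 := @exp2_gt0 R m.
rewrite /slack ccE /Pc /prof /pe /Pf /pf /gam two_add (two_sub _ 1) expr1 /Gfun /catom.
rewrite !expr0 !expr1 !mul1r.
have cE := ccE m; move: (2 ^+ m) p0 cE => q p0 cE.
rewrite (mulrC (two y) q) (mulrC (two y) 2^-1); move: (two y) v0 => v v0.
have c4E : cbe1 R m = cc R m * q - cal1 R m + 2^-1 * cal R m + cbe R m by rewrite cE; ring.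
rewrite -cE c4E /cc; move: (cal R m) (cbe R m) (cal1 R m) (cbe2 R m) (cga R m) => c1 c2 c3 c5 c6.
rewrite !(mulrC _^-1 v); move: (expR _) (expR _) (expR _) => E1 E2 E3.
by field; rewrite !lt0r_neq0.
Qed.

Lemma Pf_near x K j : [/\ 0 <= Pf (x + j%:R + K%:R) <= (two x)^-1 * 2 ^- K,
  0 <= 1 - Pf (x + j%:R - K%:R) <= 2 ^+ j * two x * 2 ^- K,
  0 <= gam 0 (x + j%:R + K%:R) <= (two x)^-1 * 2 ^- K
  & 0 <= 1 - gam 0 (x + j%:R - K%:R) <= 2 ^+ j * two x * 2 ^- K].
Proof.
have v0 := two_gt0 x; have j1 := @exp2_ge1 R j; have k0 := @exp2_gt0 R K.
have [a1 a2 a3 a4] := pf_bounds (two_gt0 (x + j%:R + K%:R)).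
have [b1 b2 b3 b4] := pf_bounds (two_gt0 (x + j%:R - K%:R)).
have [c1 c2 c3] := gam0_bounds (x + j%:R + K%:R).
have [d1 d2 d3] := gam0_bounds (x + j%:R - K%:R).
have d4 : gam 0 (x + j%:R - K%:R) <= 1.
  by rewrite gamE mul0r sub0r -[leRHS]expR0 ler_expR oppr_le0 ltW // two_gt0.
have e1 : (two (x + j%:R + K%:R))^-1 <= (two x)^-1 * 2 ^- K.
  rewrite !two_add -invfM lef_pV2 ?posrE ?mulr_gt0 ?exp2_gt0 //.
  by rewrite ler_wpM2r ?(ltW k0) // ler_peMr // ltW.
have e2 : two (x + j%:R - K%:R) = 2 ^+ j * two x * 2 ^- K.
  by rewrite two_sub two_add [two x * _]mulrC.
rewrite /Pf -e2; split; apply/andP; split => //; try exact: le_trans e1; lra.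
Qed.

(** Pf and gam 0 fall from 1 to 0, so a telescoping sum over a translation by i
    units tends to i. *)
Definition drift m : R := - (cal R m / 2) + m%:R * (cc R m * 2 ^+ m) + cal1 R m.

Lemma window_slack m x K : `|window (slack m) K x - drift m| <=
  25 * 8 ^+ m * ((two x + (two x)^-1) * 2 ^- K).
Proof.
have tel j : window (fun y => Pf y - Pf (y + j%:R)) K x =
    \sum_(i < j) (Pf (x + i.+1%:R - K%:R) - Pf (x + i.+1%:R + K%:R)).
  elim: j => [|j IH].
    by rewrite big_ord0 /window big1 // => k _; rewrite !addr0 !subrr addr0.
  rewrite big_ord_recr -IH /=.
  have := window_tele (fun y => Pf (y + j.+1%:R)) K x.
  have -> : (fun y => Pf y - Pf (y + j.+1%:R)) = fun y => (Pf y - Pf (y + j%:R)) +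
      -1 * (Pf (y + j.+1%:R) - Pf (y - 1 + j.+1%:R)).
    apply/funext => y; have -> : y - 1 + j.+1%:R = y + j%:R by rewrite -natr1; ring.
    ring.
  move=> w; rewrite windowD windowZ w (addrAC x K%:R) (addrAC x (- K%:R)); ring.
set E := (two x + (two x)^-1) * 2 ^- K.
have v0 := two_gt0 x; have vV : 0 < (two x)^-1 by rewrite invr_gt0.
have E0 : 0 <= E by rewrite mulr_ge0 // ?addr_ge0 // ltW // exp2V_gt0.
have [m1 m2] : 1 <= 2 ^+ m :> R /\ m%:R <= 2 ^+ m :> R.
  by rewrite exp2_ge1 -natrX ler_nat ltnW // ltn_expl.
have bP j : (j <= m)%N -> `|Pf (x + j%:R - K%:R) - Pf (x + j%:R + K%:R) - 1| <= 2 ^+ m * E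
   /\ `|gam 0 (x + j%:R - K%:R) - gam 0 (x + j%:R + K%:R) - 1| <= 2 ^+ m * E.
  move=> jm; have [/andP[a1 a2] /andP[b1 b2] /andP[c1 c2] /andP[d1 d2]] := Pf_near x K j.
  have k0 := ltW (exp2V_gt0 R K).
  have h1 : 2 ^+ j * two x * 2 ^- K <= 2 ^+ m * (two x * 2 ^- K).
    by rewrite -mulrA ler_wpM2r ?mulr_ge0 // ?(ltW v0) // ler_weXn2l // ler1n.
  have h2 : (two x)^-1 * 2 ^- K <= 2 ^+ m * ((two x)^-1 * 2 ^- K).
    by rewrite ler_peMl // mulr_ge0 // ltW.
  have e : 2 ^+ m * E = 2 ^+ m * (two x * 2 ^- K) + 2 ^+ m * ((two x)^-1 * 2 ^- K).
    by rewrite /E; ring.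
  rewrite e !ler_norml; split; lra.
have sE : \sum_(i < m) (Pf (x + i.+1%:R - K%:R) - Pf (x + i.+1%:R + K%:R) - 1) =
    \sum_(i < m) (Pf (x + i.+1%:R - K%:R) - Pf (x + i.+1%:R + K%:R)) - m%:R.
  by rewrite sumrB; congr (_ - _); rewrite sumr_const card_ord.
have -> : window (slack m) K x - drift m =
   - (cal R m / 2) * (Pf (x + 0%:R - K%:R) - Pf (x + 0%:R + K%:R) - 1)
   + cc R m * 2 ^+ m * (\sum_(i < m) (Pf (x + i.+1%:R - K%:R) - Pf (x + i.+1%:R + K%:R) - 1))
   + cal1 R m * (gam 0 (x + 0%:R - K%:R) - gam 0 (x + 0%:R + K%:R) - 1).
  have -> : slack m = fun y => cal R m / 2 * (Pf y - Pf (y - 1))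
     + (cc R m * 2 ^+ m * (Pf y - Pf (y + m%:R)) + - cal1 R m * (gam 0 y - gam 0 (y - 1))).
    by apply/funext => y; rewrite /slack; ring.
  rewrite !windowD !windowZ !window_tele tel sE /drift !addr0; ring.
have [c1 _ c2 c3 _] := coef_le10 R m.
have [p1 p2] := bP 0%N (leq0n m).
have bs : `|\sum_(i < m) (Pf (x + i.+1%:R - K%:R) - Pf (x + i.+1%:R + K%:R) - 1)|
    <= 2 ^+ m * (2 ^+ m * E).
  apply: le_trans (ler_norm_sum _ _ _) _.
  apply: (@le_trans _ _ (\sum_(i < m) (2 ^+ m * E))).
    by apply: ler_sum => i _; have [] := bP i.+1 (ltn_ord i).
  by rewrite sumr_const card_ord -[leLHS]mulr_natl ler_wpM2r // mulr_ge0 // ltW // exp2_gt0.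
have e8 : 8 ^+ m = 2 ^+ m * (2 ^+ m * 2 ^+ m) :> R by rewrite -!exprMn; congr (_ ^+ _); lra.
rewrite e8.
have t1 := ler_pM (normr_ge0 _) (normr_ge0 _) c1 p1.
have t3 := ler_pM (normr_ge0 _) (normr_ge0 _) c3 p2.
have t2 := ler_pM (normr_ge0 _) (normr_ge0 _) c2 bs.
rewrite -!normrM in t1 t2 t3.
have z1 : 2 ^+ m * E <= 2 ^+ m * (2 ^+ m * 2 ^+ m) * E.
  rewrite ler_wpM2r // ler_peMr; [by []|lra|nra].
have z2 : 2 ^+ m * (10 * (2 ^+ m * (2 ^+ m * E))) = 10 * (2 ^+ m * (2 ^+ m * 2 ^+ m) * E) by ring.
apply: le_trans (ler_normD _ _) _.
have := ler_normD (- (cal R m / 2) * (Pf (x + 0%:R - K%:R) - Pf (x + 0%:R + K%:R) - 1))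
  (cc R m * 2 ^+ m * (\sum_(i < m) (Pf (x + i.+1%:R - K%:R) - Pf (x + i.+1%:R + K%:R) - 1))).
have -> : `|- (cal R m / 2) * (Pf (x + 0%:R - K%:R) - Pf (x + 0%:R + K%:R) - 1)| =
   2^-1 * `|cal R m * (Pf (x + 0%:R - K%:R) - Pf (x + 0%:R + K%:R) - 1)|.
  by rewrite mulNr normrN mulrAC normrM mulrC (ger0_norm (_ : 0 <= 2^-1 :> R)).
have -> : `|cc R m * 2 ^+ m * (\sum_(i < m) (Pf (x + i.+1%:R - K%:R) - Pf (x + i.+1%:R + K%:R) - 1))| = 2 ^+ m * `|cc R m * (\sum_(i < m) (Pf (x + i.+1%:R - K%:R) - Pf (x + i.+1%:R + K%:R) - 1))|.
  by rewrite mulrAC normrM mulrC (ger0_norm (_ : 0 <= 2 ^+ m :> R)) //; lra.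
have p0 : 0 <= 2 ^+ m :> R by lra.
have t4 := ler_wpM2l p0 t2; rewrite z2 in t4.
move: t1 t3 t4 z1; clear -R; lra.
Qed.
End Mellin.

(** * Summation over m *)

Section Limits.
Variable R : realType.
Implicit Types (x y v t B : R) (i k m n K N : nat) (g h : nat -> R).

Local Notation L := (ln 2 : R).

(** With the b_m for g this is the constant of the theorem. *)
Definition wsum g : R := (Qinf R)^-1 * limn (series (fun m => coefa R m * g m)).

Lemma is_cvg_coefa g B : 0 <= B -> (forall m, `|g m| <= B * 8 ^+ m) ->
  cvgn (series (fun m => coefa R m * g m)).
Proof.
move=> B0 gB; apply: normed_cvg.
apply: (@series_le_cvg _ _ (fun m => Ca R * B * 4^-1 ^+ m)) => [m|m|m|] /=.
- by [].
- by rewrite !mulr_ge0 ?exprn_ge0 ?Ca_ge0.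
- rewrite normrM; apply: le_trans (ler_pM _ _ (coefa_le R m) (gB m)) _ => //.
  have -> : Ca R * B * 4^-1 ^+ m = Ca R * 32 ^- m * (B * 8 ^+ m).
    have -> : 32 ^+ m = 4 ^+ m * 8 ^+ m :> R by rewrite -exprMn; congr (_ ^+ _); lra.
    by rewrite exprVn; field; rewrite !expf_neq0.
  by [].
- have := @is_cvg_geometric_series R (Ca R * B) 4^-1; apply.
  by rewrite ger0_norm; lra.
Qed.

Lemma cvg_wsum g B : 0 <= B -> (forall m, `|g m| <= B * 8 ^+ m) ->
  (fun K => \sum_(m < K) Ainf R m * g m) @ \oo --> wsum g.
Proof.
move=> B0 gB.
have -> : (fun K => \sum_(m < K) Ainf R m * g m) =
    (fun K => (Qinf R)^-1 * series (fun m => coefa R m * g m) K).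
  apply/funext => K; rewrite /series /= big_mkord mulr_sumr; apply: eq_bigr => m _.
  by rewrite /Ainf; ring.
apply: cvgM; first exact: cvg_cst.
exact: is_cvg_coefa B0 gB.
Qed.

Lemma Pc_le m : `|Pc R m| <= 20 * 8 ^+ m.
Proof.
have [_ _ _ h1 [h2 _ _]] := coef_le10 R m.
have : 1 <= 8 ^+ m :> R by rewrite exprn_ege1 // ler1n.
rewrite /Pc normrN; have := ler_normD (cal1 R m) (cbe1 R m); lra.
Qed.

Lemma cbe2_le m : `|cbe2 R m| <= 10 * 8 ^+ m.
Proof.
have [_ _ _ _ [_ h _]] := coef_le10 R m.
by apply: le_trans h _; rewrite ler_peMr // exprn_ege1 // ler1n.
Qed.

Lemma cga_le m : `|cga R m| <= 10 * 8 ^+ m.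
Proof.
have [_ _ _ _ [_ _ h]] := coef_le10 R m.
by apply: le_trans h _; rewrite ler_peMr // exprn_ege1 // ler1n.
Qed.

Lemma drift_le m : `|drift R m| <= 25 * 8 ^+ m.
Proof.
have [h1 _ h2 h3 _] := coef_le10 R m.
have e8 : 8 ^+ m = 2 ^+ m * (2 ^+ m * 2 ^+ m) :> R by rewrite -!exprMn; congr (_ ^+ _); lra.
have [m1 m2] : 1 <= 2 ^+ m :> R /\ m%:R <= 2 ^+ m :> R.
  by rewrite exp2_ge1 -natrX ler_nat ltnW // ltn_expl.
have h4 : `|m%:R * (cc R m * 2 ^+ m)| <= 2 ^+ m * (10 * 2 ^+ m).
  rewrite normrM ger0_norm //; apply: ler_pM => //.
  by rewrite normrM (ger0_norm (exprn_ge0 _ _)) // ler_wpM2r // exprn_ge0.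
have h5 : `|- (cal R m / 2)| <= 5.
  by rewrite normrN normrM (ger0_norm (_ : 0 <= 2^-1 :> R)) //; lra.
have h6 : 2 ^+ m * 2 ^+ m <= 8 ^+ m :> R.
  by rewrite e8 ler_peMl // mulr_ge0 // exprn_ge0.
have h7 : 1 <= 8 ^+ m :> R by rewrite exprn_ege1 // ler1n.
rewrite /drift; apply: le_trans (ler_normD _ _) _.
have := ler_normD (- (cal R m / 2)) (m%:R * (cc R m * 2 ^+ m)).
have -> : 25 * 8 ^+ m = 5 * 8 ^+ m + 10 * 8 ^+ m + 10 * 8 ^+ m :> R by ring.
have : 2 ^+ m * (10 * 2 ^+ m) = 10 * (2 ^+ m * 2 ^+ m) :> R by ring.
lra.
Qed.

Lemma cvg_window_prof (a b c : R) x :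
  (fun K => window (prof a b c) K x) @ \oo --> bisum (prof a b c) x.
Proof.
apply: (@cvg_window _ (prof a b c) (prof_cst a b c)); first exact: prof_cst_ge0.
by move=> y; have [] := prof_bounds a b c y.
Qed.

(** Linearity in the coefficients lets the sum over m be taken first, so that the
    limits in m and in the levels are independent of each other. *)
Lemma window_prof (a b c : R) K x : window (prof a b c) K x =
  a * window (prof 1 0 0) K x + b * window (prof 0 1 0) K x + c * window (prof 0 0 1) K x.
Proof.
have -> : prof a b c = fun y => a * prof 1 0 0 y + (b * prof 0 1 0 y + c * prof 0 0 1 y).
  by apply/funext => y; rewrite /prof; ring.
rewrite (windowD (fun y => a * _)) (windowD (fun y => b * _)) !windowZ; exact: addrA.
Qed.

Lemma PhiE K N : (0 < N)%N -> Phi R K N = N%:R * \sum_(m < K) Ainf R m *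
   (window (prof (Pc R m) (cbe2 R m) (cga R m)) K (log2 N%:R)
    + window (slack m) K (log2 N%:R)).
Proof.
move=> N0; set x := log2 _; have NE : N%:R = two x by rewrite two_log2.
rewrite /Phi mulr_sumr; apply: eq_bigr => m _.
rewrite mulrCA; congr (_ * _); rewrite -windowD /window NE big_split /= mulrDr !mulr_sumr.
congr (_ + _); apply: eq_bigr => k _.
  rewrite -two_sub Gfun_two mulrA two_sub mulrCA divff ?mulr1 ?expf_neq0 //.
rewrite -two_add Gfun_two mulrA two_add mulrCA mulVf ?mulr1 ?expf_neq0 //.
Qed.

Lemma cvg_slack x :
  (fun K => \sum_(m < K) Ainf R m * window (slack m) K x) @ \oo --> wsum (drift R).
Proof.
have h := cvg_wsum (ler0n R 25) drift_le.
suff h0 : (fun K => \sum_(m < K) Ainf R m * window (slack m) K x -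
    \sum_(m < K) Ainf R m * drift R m) @ \oo --> (0 : R).
  have -> : (fun K => \sum_(m < K) Ainf R m * window (slack m) K x) = fun K =>
      (\sum_(m < K) Ainf R m * window (slack m) K x - \sum_(m < K) Ainf R m * drift R m) +
      \sum_(m < K) Ainf R m * drift R m by apply/funext => K; rewrite subrK.
  by rewrite -[wsum _]add0r; apply: cvgD.
set E := two x + (two x)^-1.
have E0 : 0 <= E by rewrite addr_ge0 ?invr_ge0 ?ltW ?two_gt0.
apply: (@cvg_of_rate _ _ _ (100 * (2 * Ca R) * E)) => K.
rewrite subr0 -sumrB; apply: le_trans (ler_norm_sum _ _ _) _.
apply: (@le_trans _ _ (\sum_(m < K) (100 * E * 2 ^- K) * (`|coefa R m| * 8 ^+ m))).
  apply: ler_sum => m _; rewrite -mulrBr normrM.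
  apply: le_trans (ler_pM _ _ (Ainf_le R m) (window_slack m x K)) _ => //.
  by rewrite -/E le_eqVlt; apply/orP; left; apply/eqP; ring.
rewrite -mulr_sumr; have := ler_wpM2l _ (sum_coefa8 R K).
move=> /(_ (100 * E * 2 ^- K) _)/le_trans; apply.
  by rewrite !mulr_ge0 // ltW // exp2V_gt0.
by rewrite le_eqVlt; apply/orP; left; apply/eqP; ring.
Qed.

Let a := wsum (Pc R).
Let b := wsum (cbe2 R).
Let c := wsum (cga R).

Lemma cvg_Phi N : (0 < N)%N -> (fun K => Phi R K N) @ \oo -->
  N%:R * (bisum (prof a b c) (log2 N%:R) + wsum (drift R)).
Proof.
move=> N0; set x := log2 _.
have -> : (fun K => Phi R K N) = (fun K => N%:R *
   (((\sum_(m < K) Ainf R m * Pc R m) * window (prof 1 0 0) K x +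
     (\sum_(m < K) Ainf R m * cbe2 R m) * window (prof 0 1 0) K x +
     (\sum_(m < K) Ainf R m * cga R m) * window (prof 0 0 1) K x)
    + \sum_(m < K) Ainf R m * window (slack m) K x)).
  apply/funext => K; rewrite PhiE //; congr (_ * _).
  rewrite !mulr_suml -!big_split /=; apply: eq_bigr => m _.
  by rewrite window_prof; ring.
have -> : bisum (prof a b c) x = a * bisum (prof 1 0 0) x + b * bisum (prof 0 1 0) x
    + c * bisum (prof 0 0 1) x.
  apply: (cvg_unique _ (@cvg_window_prof a b c x)) => //.
  have -> : (fun K => window (prof a b c) K x) = fun K => a * window (prof 1 0 0) K x
     + b * window (prof 0 1 0) K x + c * window (prof 0 0 1) K x.
    by apply/funext => K; exact: window_prof.
  by apply: cvgD; first apply: cvgD; apply: cvgM; (exact: cvg_cst || exact: cvg_window_prof).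
apply: cvgM; first exact: cvg_cst.
apply: cvgD; last exact: cvg_slack.
apply: cvgD; first apply: cvgD; apply: cvgM; try exact: cvg_window_prof.
- exact: cvg_wsum (ler0n R 20) Pc_le.
- exact: cvg_wsum (ler0n R 10) cbe2_le.
- exact: cvg_wsum (ler0n R 10) cga_le.
Qed.

End Limits.

(** * The coefficients b_m *)

Section SingularTerm.
Variable R : realType.
Implicit Types (x t : R).

Local Notation L := (ln 2 : R).

Lemma ln_taylor3 t : `|t| <= 2^-1 -> `|ln (1 + t) - (t - t ^+ 2 / 2 + t ^+ 3 / 3)| <= 2 * t ^+ 4.
Proof.
move=> t2; pose f z : R := ln (1 + z) - (z - z ^+ 2 / 2 + z ^+ 3 / 3).
have bnd z : `|z| <= `|t| -> - 2^-1 <= z <= 2^-1.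
  by move=> zt; rewrite -ler_norml (le_trans zt).
have := @mvt_bound R f (fun z => - (z ^+ 3 / (1 + z))) 0 t (2 * `|t| ^+ 3).
rewrite add0r /f addr0 ln1 !expr0n /= !mul0r !subr0 addr0 subr0 => h.
have -> : 2 * t ^+ 4 = 2 * `|t| ^+ 3 * `|t| by rewrite -mulrA -exprSr -normrX ger0_norm // exprn_even_ge0.
rewrite -[X in `|X|]subr0; apply: h => z; rewrite subr0 => zt; have /andP[z1 z2] := bnd z zt;
  have z0 : 0 < 1 + z by lra.
  have d0 : is_derive z (1 : R) (fun z => 1 + z) 1.
    by have := is_deriveD (is_derive_cst (1 : R) z 1) (is_derive_id z 1); rewrite add0r.
  have d1 := @is_derive1_comp _ (@ln R) (fun z => 1 + z) z _ _ (is_derive1_ln z0) d0.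
  apply: is_derive_eq; rewrite /GRing.scale /=.
  by field; rewrite lt0r_neq0.
rewrite normrN normrM normrX normfV (gtr0_norm z0) mulrC; apply: ler_pM; rewrite ?invr_ge0 ?exprn_ge0 //; first lra.
  by rewrite -[leRHS]invrK lef_pV2 ?posrE; lra.
by rewrite lerXn2r ?nnegrE.
Qed.

(** B has a zero of order three at 1, which cancels the pole of b. *)
Lemma Bfun_near1 t : `|t| <= 2^-1 -> `|Bfun (1 + t) - (37 / 3 - 16 * L) * t ^+ 3| <= 16 * t ^+ 4.
Proof.
move=> t2; have := ln_taylor3 t2; set r := ln (1 + t) - _ => hr.
have lE : ln (1 + t) = t - t ^+ 2 / 2 + t ^+ 3 / 3 + r by rewrite /r; ring.
have -> : Bfun (1 + t) - (37 / 3 - 16 * L) * t ^+ 3 =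
    t ^+ 4 * (- (10 / 3) + 3 * t + 4 / 3 * t ^+ 3)
    + (4 * t ^+ 4 + 6 * t ^+ 3 + 6 * t ^+ 2 + 2 * t - 2) * r.
  by rewrite /Bfun lE; field.
have p k : `|t ^+ k| <= 2^-1 ^+ k by rewrite normrX lerXn2r ?nnegrE.
have [u1 u2 [u3 u4]] : [/\ `|t| <= 2^-1, `|t ^+ 2| <= 4^-1
    & `|t ^+ 3| <= 8^-1 /\ `|t ^+ 4| <= 16^-1].
  by have := p 2%N; have := p 3%N; have := p 4%N; rewrite !exprS expr0; split; lra.
have t4 : 0 <= t ^+ 4 by rewrite exprn_even_ge0.
have -> : 16 * t ^+ 4 = t ^+ 4 * 5 + 11 / 2 * (2 * t ^+ 4) by field.
apply: le_trans (ler_normD _ _) _; apply: lerD.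
  rewrite normrM (ger0_norm t4) ler_wpM2l //.
  by move: u1 u3; rewrite !ler_norml => /andP[? ?] /andP[? ?]; apply/andP; split; lra.
rewrite normrM; apply: ler_pM => //.
move: u1 u2 u3 u4; rewrite !ler_norml.
move: (t ^+ 2) (t ^+ 3) (t ^+ 4) => p2 p3 p4 u1 u2 u3 u4; lra.
Qed.

Lemma coefb0 : coefb R 0 = 37 / (12 * L) - 4.
Proof.
rewrite /coefb; apply/cvg_lim; first exact: norm_hausdorff.
have L0 := ln2_neq0 R; set l := _ - _; set c4 := `|(4 * L)^-1|; set g := 37 / 3 - 16 * L.
have c40 : 0 <= c4 by exact: normr_ge0.
have near1 x : x != 1 -> `|x - 1| <= 2^-1 ->
    `|bfun x - l| <= c4 * (4 * (16 + 3 * `|g|)) * `|x - 1|.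
  move=> x1 x2; have := Bfun_near1 x2; rewrite (addrC 1) subrK -/g.
  move: x2; have : x - 1 != 0 by rewrite subr_eq0.
  rewrite /bfun -/c4 (_ : x - 2 = x - 1 - 1); last by ring.
  move: (x - 1) (Bfun x) => t B t0 t2 hB.
  have h0 : t - 1 != 0 by apply: ltr0_neq0; move: t2; rewrite ler_norml; lra.
  have h1 : (t - 1) ^+ 2 != 0 by rewrite expf_neq0.
  have -> : (4 * L)^-1 * (B / (t ^+ 3 * (t - 1) ^+ 2)) - l = (4 * L)^-1 *
     (((B - g * t ^+ 3) / t ^+ 3 + g * (t * (2 - t))) / (t - 1) ^+ 2).
    by rewrite /g /l; field; rewrite ?L0 ?t0 ?h0.
  rewrite normrM -!mulrA ler_wpM2l //.
  have q0 : 4^-1 <= (t - 1) ^+ 2.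
    have : (2^-1) ^+ 2 <= (1 - t) ^+ 2 by rewrite lerXn2r ?nnegrE; move: t2; rewrite ler_norml; lra.
    by rewrite -[(1 - t) ^+ 2]sqrrN opprB expr2; lra.
  have h2 : `|(B - g * t ^+ 3) / t ^+ 3| <= 16 * `|t|.
    rewrite normrM normfV ler_pdivrMr ?normr_gt0 ?expf_neq0 // (le_trans hB) //.
    by rewrite normrX -mulrA -exprS -normrX ger0_norm // exprn_even_ge0.
  have h3 : `|g * (t * (2 - t))| <= 3 * `|g| * `|t|.
    have h4 : `|2 - t| <= 3 by rewrite ler_norml; move: t2; rewrite ler_norml; lra.
    have -> : 3 * `|g| * `|t| = `|g| * (`|t| * 3) by ring.
    by rewrite normrM normrM ler_wpM2l // ler_wpM2l.
  rewrite normrM normfV ler_pdivrMr ?normr_gt0 //.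
  rewrite (ger0_norm (sqr_ge0 (t - 1))); apply: le_trans (ler_normD _ _) _.
  have : 0 <= (16 + 3 * `|g|) * `|t| by rewrite mulr_ge0 // addr_ge0 // mulr_ge0.
  have -> : 4 * ((16 + 3 * `|g|) * `|t|) * (t - 1) ^+ 2 = (4 * (t - 1) ^+ 2) * ((16 + 3 * `|g|) * `|t|) by ring.
  move=> z0; have : 1 * ((16 + 3 * `|g|) * `|t|) <= (4 * (t - 1) ^+ 2) * ((16 + 3 * `|g|) * `|t|).
    by rewrite ler_wpM2r //; lra.
  by rewrite mul1r mulrDl; lra.
apply/cvgrPdist_le => e e0.
set M := c4 * (4 * (16 + 3 * `|g|)).
have M0 : 0 <= M by rewrite !mulr_ge0 // addr_ge0 // mulr_ge0.
have M1 : 0 < M + 1 by lra.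
have nb (d : R) : 0 < d -> \forall x \near (1 : R), `|x - 1| <= d.
  move=> d0; have /cvgrPdist_le/(_ d d0) : id @ nbhs (1 : R) --> (1 : R) by exact: cvg_id.
  by apply: filterS => y; rewrite distrC.
rewrite near_withinE; near=> x => x1; rewrite distrC.
have h1 : `|x - 1| <= 2^-1 by near: x; apply: nb; lra.
have h2 : `|x - 1| <= e / (M + 1) by near: x; apply: nb; rewrite divr_gt0.
apply: le_trans (near1 x x1 h1) _; apply: (@le_trans _ _ ((M + 1) * `|x - 1|)).
  by rewrite ler_wpM2r //; rewrite -/M; lra.
by rewrite mulrC -ler_pdivlMr.
Unshelve. all: by end_near. Qed.

(** b_m collects the two sources of linear growth: the mean of the periodized
    profiles and the telescoping part. *)
Lemma coefbE m : coefb R m = (Pc R m + cbe2 R m + cga R m) / L + drift R m.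
Proof.
have L0 := ln2_neq0 R.
case: m => [|m].
  rewrite coefb0 /Pc /drift /cal /cal1 /cbe1 /cbe2 /cga expr0 mul0r.
  have -> : 1 - 2^-1 = 2^-1 :> R by field.
  by field.
have lE : ln (2 ^- m.+1) = - (m.+1%:R * L) :> R.
  by rewrite lnV ?posrE ?exp2_gt0 // lnXn // mulr_natl.
have := @exp2_gt1 R m.
rewrite /coefb /bfun /Bfun lE /Pc /drift /cc /cal /cal1 /cbe /cbe1 /cbe2 /cga.
move: (2 ^+ m.+1) (m.+1%:R) (ln 2) L0 => y n l l0 y2.
have y0 : y != 0 by apply: lt0r_neq0; lra.
have y1 : y - 1 != 0 by apply: lt0r_neq0; lra.
have y3 : y * 2 - 1 != 0 by apply: lt0r_neq0; lra.
have y4 : 1 + -1 * y != 0 by apply: ltr0_neq0; lra.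
have y5 : 1 + -2 * y != 0 by apply: ltr0_neq0; lra.
by field; rewrite l0 y0 y1 y3 y4 y5.
Qed.

End SingularTerm.

(** * Asymptotics of the mean *)

Section Asymptotics.
Variable R : realType.

Local Notation L := (ln 2 : R).

Let a := wsum (Pc R).
Let b := wsum (cbe2 R).
Let c := wsum (cga R).

Lemma coefb_le m : `|coefb R m| <= (40 / L + 25) * 8 ^+ m.
Proof.
rewrite coefbE [leRHS]mulrDl; apply: le_trans (ler_normD _ _) _; apply: lerD; last exact: drift_le.
have L0 := ln2_gt0 R.
rewrite normrM normfV (gtr0_norm L0) [leRHS]mulrAC ler_wpM2r ?invr_ge0 ?(ltW L0) //.
apply: le_trans (ler_normD _ _) _; have := ler_normD (Pc R m) (cbe2 R m).
have := Pc_le R m; have := cbe2_le R m; have := cga_le R m; lra.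
Qed.

Lemma is_cvg_cst_series : cvgn (cst_series R).
Proof.
apply: is_cvg_coefa coefb_le.
by rewrite addr_ge0 // divr_ge0 // ltW // ln2_gt0.
Qed.

Lemma dst_constantE : dst_constant R = L^-1 * (a + b + c) + wsum (drift R).
Proof.
have B0 : 0 <= 40 / L + 25 by rewrite addr_ge0 // divr_ge0 // ltW // ln2_gt0.
apply: (cvg_unique _ (cvg_wsum B0 coefb_le)) => //.
have -> : (fun K => \sum_(m < K) Ainf R m * coefb R m) = fun K =>
   L^-1 * (\sum_(m < K) Ainf R m * Pc R m + \sum_(m < K) Ainf R m * cbe2 R m
    + \sum_(m < K) Ainf R m * cga R m) + \sum_(m < K) Ainf R m * drift R m.
  apply/funext => K; rewrite -!big_split /= mulr_sumr -big_split /=.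
  by apply: eq_bigr => m _; rewrite coefbE; ring.
apply: cvgD; last exact: cvg_wsum (ler0n R 25) (drift_le R).
apply: cvgM; first exact: cvg_cst.
apply: cvgD; first apply: cvgD.
- exact: cvg_wsum (ler0n R 20) (Pc_le R).
- exact: cvg_wsum (ler0n R 10) (cbe2_le R).
- exact: cvg_wsum (ler0n R 10) (cga_le R).
Qed.

Definition delta_osc : R -> R := osc a b c.

(** The bound of lseq_Phi is uniform in K, while lseq K N no longer changes once
    K >= N. *)
Lemma lim_lseq : exists C : R, forall N (l : R), (0 < N)%N ->
  (forall K, (N <= K)%N -> lseq R K N = l) ->
  `|l - (N%:R * dst_constant R + N%:R * delta_osc (log2 N%:R))| <= C.
Proof.
have [C hC] := lseq_Phi R; exists C => N l N0 hl.
rewrite distrC; apply: (@lim_dist_le _ _ _ l C N (_ : (fun K => Phi R K N) @ \oo --> _)).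
  have := @cvg_Phi R N N0; rewrite dst_constantE /delta_osc /osc -/a -/b -/c.
  move: (bisum _ _) (wsum (drift R)) (L^-1 * _) => u v w.
  by rewrite -(mulrDr N%:R) (_ : w + v + (u - w) = u + v) //; ring.
by move=> K NK; rewrite distrC -(hl K NK); exact: hC.
Qed.

Lemma mean_asymptotics (d : measure_display) (T : measurableType d)
    (P : probability T R) (X : nat -> nat -> T -> bool) : independent_fair_bits P X ->
  mean_2protected P X = (fun N : nat => N%:R * dst_constant R
                          + N%:R * delta_osc (log2 N%:R) : R^o)
          +O_\oo (fun _ : nat => 1 : R^o).
Proof.
move=> HX; have [C hC] := lim_lseq; apply/eqaddOP; near=> k; near=> N.
rewrite normr1 mulr1 !fctE; apply: (@le_trans _ _ C).
  apply: hC => [|K NK]; first by near: N; exact: nbhs_infty_gt.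
  by rewrite (mean_2protectedE HX NK).
by near: k; apply: nbhs_pinfty_ge; exact: num_real.
Unshelve. all: by end_near. Qed.

End Asymptotics.

(** * Digits of the constant *)

(** Locked, so that large integers are never unfolded in unary. *)
HB.lock Definition Zr (R : realType) (z : BinNums.Z) : R := (int_of_Z z)%:~R.

Section FixedPoint.
Variable R : realType.
Implicit Types (x t : R) (m k M : nat).
Local Notation Z := BinNums.Z.
Implicit Types (z : Z).

Local Notation Zr := (Zr R).

Lemma ZrD z1 z2 : Zr (z1 + z2) = Zr z1 + Zr z2.
Proof. by rewrite Zr.unlock rmorphD intrD. Qed.

Lemma ZrM z1 z2 : Zr (z1 * z2) = Zr z1 * Zr z2.
Proof. by rewrite Zr.unlock rmorphM intrM. Qed.

Lemma ZrN z : Zr (- z) = - Zr z.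
Proof. by rewrite Zr.unlock rmorphN mulrNz. Qed.

Lemma Zr_nat m : Zr m%:R = m%:R.
Proof. by rewrite Zr.unlock rmorph_nat natz. Qed.

Lemma Zr0 : Zr 0 = 0. Proof. exact: (Zr_nat 0). Qed.
Lemma Zr1 : Zr 1 = 1. Proof. exact: (Zr_nat 1). Qed.

Lemma ZrX z m : Zr (z ^+ m) = Zr z ^+ m.
Proof. by rewrite Zr.unlock rmorphXn rmorphXn. Qed.

Lemma Zr_le z1 z2 : BinInt.Z.leb z1 z2 -> Zr z1 <= Zr z2.
Proof.
move=> h; rewrite -subr_ge0 -ZrN -ZrD Zr.unlock ler0z.
have : BinInt.Z.leb 0 (z2 - z1) by move: h; rewrite /GRing.add /GRing.opp /=; lia.
by case: (z2 - z1)%R.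
Qed.

Lemma Zr_lt z1 z2 : BinInt.Z.ltb z1 z2 -> Zr z1 < Zr z2.
Proof.
move=> h; have : Zr (z1 + 1) <= Zr z2 by apply: Zr_le; move: h; rewrite /GRing.add /=; lia.
by rewrite ZrD (Zr_nat 1); lra.
Qed.

(** Values are multiplied by 2 ^ 96 and rounded. The constant exceeds the truncation
    to 23 digits by less than 2 ^ - 83, and the rounding errors here amount to a few
    hundred units. *)
Definition ulp : Z := 2 ^+ 96.

(** Rounding down loses less than one unit per term. *)
Fixpoint fsumZ (n d : nat -> Z) m : Z :=
  if m is m'.+1 then fsumZ n d m' + BinInt.Z.div (ulp * n m') (d m') else 0.

Lemma fsumZP (f : nat -> R) (n d : nat -> Z) M :
  (forall m, 0 < d m) -> (forall m, f m = Zr (n m) / Zr (d m)) ->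
  Zr (fsumZ n d M) <= (\sum_(m < M) f m) * Zr ulp <= Zr (fsumZ n d M + M%:R).
Proof.
move=> d0 fE; elim: M => [|M /andP[IH1 IH2]].
  by rewrite big_ord0 mul0r addr0 Zr0 lexx.
rewrite big_ord_recr /= mulrDl.
set q := BinInt.Z.div _ _.
have dM := d0 M; have /BinInt.Z.ltb_spec0 dM' := dM : BinInt.Z.ltb 0 (d M).
have [h1 h2] : Zr q <= f M * Zr ulp /\ f M * Zr ulp <= Zr q + 1.
  have D0 : 0 < Zr (d M) by rewrite -Zr0; exact: Zr_lt.
  have qE : f M * Zr ulp = Zr (ulp * n M) / Zr (d M) by rewrite fE ZrM; ring.
  rewrite qE /q; move: (ulp * n M) (d M) dM' D0 => u v v0 V0.
  rewrite ler_pdivlMr // ler_pdivrMr // -Zr1 -ZrD -!ZrM.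
  split; apply: Zr_le; rewrite /GRing.add /GRing.mul /=.
    by have := BinInt.Z.mul_div_le u v v0; lia.
  by have := BinInt.Z.mul_succ_div_gt u v v0; lia.
by rewrite !ZrD !Zr_nat -natr1 in IH2 *; apply/andP; split; lra.
Qed.


Fixpoint Dz m : Z := if m is m'.+1 then Dz m' * (2 ^+ m - 1) else 1.

Lemma Dz_gt0 m : 0 < Dz m.
Proof.
by elim: m => //= m IH; rewrite mulr_gt0 // subr_gt0 exprn_egt1.
Qed.

Lemma ZrDz_gt0 m : 0 < Zr (Dz m).
Proof. by rewrite -Zr0; apply: Zr_lt; exact: Dz_gt0. Qed.

(** The power of 2 in a_{m+1} clears the denominators of Q_m. *)
Lemma coefaE m : coefa R m = Zr ((-1) ^+ m) / Zr (Dz m).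
Proof.
have -> : Zr (Dz m) = 2 ^+ 'C(m.+1, 2) * Qfin R m.
  elim: m => [|m IH]; first by rewrite Qfin0 Zr1 expr0 mul1r.
  rewrite /= ZrM IH ZrD ZrN ZrX Zr1 (Zr_nat 2) QfinS (binS m.+1 1) bin1 exprD.
  by field; rewrite expf_neq0.
rewrite /coefa ZrX ZrN Zr1 invfM mulrA //.
Qed.

(** Numerators and denominators of a_{m+1} times Pc + cbe2 + cga and of a_{m+1} times
    drift, where y = 2 ^ m. *)
Definition nV m : Z := if m is 0 then 37 else let y := 2 ^+ m in
  (-1) ^+ m * (8 * y * (y - 1) ^+ 2 + 2 * y * (2 * y - 1) + y * (2 * y - 1) * (y - 1)).
Definition dV m : Z := if m is 0 then 12 else let y := 2 ^+ m in
  4 * (2 * y - 1) * (y - 1) ^+ 2 * Dz m.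
Definition nU m : Z := if m is 0 then -4 else let y := 2 ^+ m in
  (-1) ^+ m * (m%:R * (2 * y * (2 * y - 1) ^+ 2 * (y - 1) ^+ 2 - 8 * y ^+ 2 * (y - 1) ^+ 3
    - y ^+ 2 * (2 * y - 1) ^+ 2) - 8 * y ^+ 2 * (y - 1) ^+ 3).
Definition dU m : Z := if m is 0 then 1 else let y := 2 ^+ m in
  2 * (2 * y - 1) ^+ 2 * (y - 1) ^+ 3 * Dz m.
Definition coefV m : R := Pc R m + cbe2 R m + cga R m.

Lemma coefVE m : coefa R m * coefV m = Zr (nV m) / Zr (dV m).
Proof.
rewrite coefaE /coefV /Pc /cal1 /cbe1 /cbe2 /cga /nV /dV; case: m => [|m].
  rewrite expr0 Zr1 (Zr_nat 37) (Zr_nat 12) expr0.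
  have -> : 1 - 2^-1 = 2^-1 :> R by field.
  by field.
have y2 := @exp2_gt1 R m; have D0 := ZrDz_gt0 m.+1.
move: (Dz m.+1) D0 => D D0; rewrite !(ZrM, ZrD, ZrN, ZrX, Zr1, Zr_nat).
move: (2 ^+ m.+1) y2 (Zr D) D0 ((-1) ^+ m.+1) => y y2 D' D0 s.
have d0 : D' != 0 by apply: lt0r_neq0.
have y1 : y - 1 != 0 by apply: lt0r_neq0; lra.
have y4 : 2 * y - 1 != 0 by apply: lt0r_neq0; lra.
by field; rewrite y1 d0 y4.
Qed.

Lemma driftE m : coefa R m * drift R m = Zr (nU m) / Zr (dU m).
Proof.
rewrite coefaE /drift /cc /cal1 /cbe /cal /nU /dU; case: m => [|m].
  rewrite expr0 !(ZrN, Zr1) (Zr_nat 4) expr0 mul0r.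
  have -> : 1 - 2^-1 = 2^-1 :> R by field.
  by field.
have y2 := @exp2_gt1 R m; have D0 := ZrDz_gt0 m.+1.
move: (Dz m.+1) D0 => D D0; rewrite !(ZrM, ZrD, ZrN, ZrX, Zr1, Zr_nat).
move: (2 ^+ m.+1) y2 (Zr D) D0 ((-1) ^+ m.+1) => y y2 D' D0 s.
have d0 : D' != 0 by apply: lt0r_neq0.
have y1 : y - 1 != 0 by apply: lt0r_neq0; lra.
have y4 : 2 * y - 1 != 0 by apply: lt0r_neq0; lra.
by field; rewrite y1 d0 y4.
Qed.


Lemma dV_gt0 m : 0 < dV m.
Proof.
rewrite /dV; case: m => [//|m].
have y2 : 2 <= 2 ^+ m.+1 :> Z by rewrite exprS ler_peMr // exprn_ege1.
rewrite !mulr_gt0 ?Dz_gt0 ?exprn_gt0 ?subr_gt0 //; move: (2 ^+ m.+1) y2 => y y2; lra.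
Qed.

Lemma dU_gt0 m : 0 < dU m.
Proof.
rewrite /dU; case: m => [//|m].
have y2 : 2 <= 2 ^+ m.+1 :> Z by rewrite exprS ler_peMr // exprn_ege1.
rewrite !mulr_gt0 ?Dz_gt0 ?exprn_gt0 ?subr_gt0 //; move: (2 ^+ m.+1) y2 => y y2; lra.
Qed.

Definition lsum (g : nat -> R) : R := limn (series (fun m => coefa R m * g m)).

(** From m = 2 on the bounds t m at least halve, so the tail is at most twice its
    first term. *)
Lemma lsum_tail g : (forall m, `|g m| <= 50 * 2 ^+ m) ->
  `|lsum g - \sum_(m < 15) coefa R m * g m| * Zr ulp <= 1.
Proof.
move=> gB; pose t m : R := 50 * 2 ^+ m / Zr (Dz m).
have t0 m : 0 <= t m by rewrite divr_ge0 ?mulr_ge0 ?exprn_ge0 // ltW // ZrDz_gt0.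
have tg m : `|coefa R m * g m| <= t m.
  rewrite normrM coefaE normrM ZrX ZrN Zr1 normrX normrN1 expr1n mul1r.
  rewrite normfV (gtr0_norm (ZrDz_gt0 m)) mulrC ler_wpM2r //.
  by rewrite invr_ge0 ltW // ZrDz_gt0.
have tS m : (2 <= m)%N -> t m <= 2 * t m - 2 * t m.+1.
  move=> m2; rewrite /t /= ZrM ZrD ZrN ZrX Zr1 (Zr_nat 2) !exprS.
  have p8 : 4 <= 2 ^+ m :> R.
    by rewrite -[leLHS](_ : 2 ^+ 2 = _) ?ler_weXn2l ?ler1n // !exprS expr0; lra.
  have D0 := ZrDz_gt0 m; move: (2 ^+ m) p8 => y y4.
  rewrite invfM.
  have h : 2 * y * (2 * y - 1)^-1 <= 2 * y * 4^-1.
    by rewrite ler_wpM2l ?lef_pV2 ?posrE; lra.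
  have : 0 <= (Zr (Dz m))^-1 by rewrite invr_ge0 ltW.
  move=> v0; have := ler_wpM2l v0 h.
  have -> : 50 * (2 * y) * ((Zr (Dz m))^-1 / (2 * y - 1)) =
    50 * ((Zr (Dz m))^-1 * (2 * y / (2 * y - 1))) by ring.
  lra.
have part n : (15 <= n)%N -> \sum_(15 <= m < n) t m <= 2 * t 15%N - 2 * t n.
  elim: n => // n IH; rewrite leq_eqVlt => /orP[/eqP <-|n15].
    by rewrite big_geq // subrr.
  rewrite big_nat_recr //=; have := IH n15.
  have := tS n (ltn_trans (isT : (1 < 14)%N) n15); lra.
have u0 : 0 < Zr ulp by rewrite -Zr0; apply: Zr_lt.
suff h : `|lsum g - \sum_(m < 15) coefa R m * g m| <= 2 * t 15%N.
  apply: (@le_trans _ _ (2 * t 15%N * Zr ulp)); first by rewrite ler_wpM2r // ltW.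
  rewrite /t -(Zr_nat 2) -(Zr_nat 50) -ZrX !(mulrA, mulrAC _ (_^-1)) -!ZrM.
  by rewrite ler_pdivrMr ?ZrDz_gt0 // mul1r; apply: Zr_le; vm_compute.
have cv : cvgn (series (fun m => coefa R m * g m)).
  apply: (@is_cvg_coefa _ g 50) => // m; apply: le_trans (gB m) _.
  by rewrite ler_wpM2l // lerXn2r ?nnegrE //; lra.
apply: (@lim_dist_le _ _ _ _ _ 15 cv) => n n15.
rewrite /series /= -(big_mkord predT (fun m => coefa R m * g m)) /=.
rewrite (big_cat_nat (leq0n 15) n15) /= addrC addrK.
apply: le_trans (ler_norm_sum _ _ _) _.
apply: le_trans (_ : _ <= \sum_(15 <= m < n) t m) _; first exact: ler_sum.
by have := part n n15; have := t0 n; lra.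
Qed.

Lemma wsumE g : wsum g = (Qinf R)^-1 * lsum g. Proof. by []. Qed.

(** The weights a_{m+1} / Q_inf add up to 1; this replaces the slowly convergent
    product by a fast series. *)
Lemma Qinf_lsum : Qinf R = lsum (fun=> 1).
Proof.
have B : forall m, `|1 : R| <= 1 * 8 ^+ m.
  by move=> m; rewrite normr1 mul1r exprn_ege1 // ler1n.
have h1 := cvg_wsum ler01 B.
have h2 : (fun K => \sum_(m < K) Ainf R m * 1) @ \oo --> (1 : R).
  apply: (@cvg_of_rate _ _ _ (40 * Ca R)) => K.
  rewrite distrC; under eq_bigr do rewrite mulr1.
  apply: le_trans (sum_Ainf R K) _; rewrite ler_wpM2l ?mulr_ge0 ?Ca_ge0 //.
  by rewrite lef_pV2 ?posrE ?exprn_gt0 // lerXn2r ?nnegrE //; lra.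
have e : wsum (fun=> 1) = 1 :> R by apply: (cvg_unique _ h1 h2).
have -> : lsum (fun=> 1) = Qinf R * wsum (fun=> 1) by rewrite wsumE mulVKf ?Qinf_neq0.
by rewrite e mulr1.
Qed.

(** ln 2 = 2 artanh (1 / 3); the remainder of the series of 2 artanh t has
    derivative 2 t ^ (2 n) / (1 - t ^ 2). *)
Lemma ln2_series n : `|ln 2 - \sum_(k < n) 2 / ((2 * k + 1)%:R * 3 ^+ (2 * k + 1))| <= 3 / 4 * 9 ^- n :> R.
Proof.
pose s x : R := \sum_(k < n) 2 / (2 * k + 1)%:R * x ^+ (2 * k + 1).
pose f x : R := ln (1 + x) - ln (1 - x) - s x.
pose df x : R := 2 * x ^+ (2 * n) / (1 - x ^+ 2).
have ds x : is_derive x 1 s (\sum_(k < n) 2 * x ^+ (2 * k)).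
  rewrite /s; elim: (n) => [|m IH].
    have -> : (fun x : R => \sum_(k < 0) 2 / (2 * k + 1)%:R * x ^+ (2 * k + 1)) = cst 0.
      by apply/funext => y; rewrite big_ord0.
    by rewrite big_ord0; exact: is_derive_cst.
  have -> : (fun x : R => \sum_(k < m.+1) 2 / (2 * k + 1)%:R * x ^+ (2 * k + 1)) =
     (fun x : R => \sum_(k < m) 2 / (2 * k + 1)%:R * x ^+ (2 * k + 1)) +
     (fun x : R => 2 / (2 * m + 1)%:R * x ^+ (2 * m + 1)).
    by apply/funext => y; rewrite big_ord_recr.
  rewrite big_ord_recr /=; apply: is_deriveD.
  have dm : is_derive x (1 : R) (fun y => y ^+ (2 * m + 1)) ((2 * m + 1)%:R * x ^+ (2 * m)).
    have := is_deriveX (2 * m + 1) (is_derive_id x (1 : R)).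
    have -> : (id ^+ (2 * m + 1) : R -> R) = fun y => y ^+ (2 * m + 1).
      by apply/funext => y; rewrite exprfctE.
    by rewrite /GRing.scale /= mulr1 addn1.
  have := is_deriveZ (2 / (2 * m + 1)%:R) dm.
  rewrite [_ *: (_ * _)](_ : _ = 2 * x ^+ (2 * m)) //.
  by rewrite /GRing.scale /= mulrA divfK // pnatr_eq0 addn1.
have dff x : `|x| <= 3^-1 -> is_derive x 1 f (df x).
  rewrite ler_norml => /andP[x1 x2].
  have p0 : 0 < 1 + x by lra.
  have m0 : 0 < 1 - x by lra.
  have dp : is_derive x (1 : R) (fun x => 1 + x) 1.
    by have := is_deriveD (is_derive_cst (1 : R) x 1) (is_derive_id x 1); rewrite add0r.
  have dm : is_derive x (1 : R) (fun x => 1 - x) (-1).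
    by have := is_deriveB (is_derive_cst (1 : R) x 1) (is_derive_id x 1); rewrite sub0r.
  have d1 := @is_derive1_comp _ (@ln R) (fun x => 1 + x) x _ _ (is_derive1_ln p0) dp.
  have d2 := @is_derive1_comp _ (@ln R) (fun x => 1 - x) x _ _ (is_derive1_ln m0) dm.
  have d3 := is_deriveB (is_deriveB d1 d2) (ds x).
  rewrite (_ : df x = (1 + x)^-1 * 1 - (1 - x)^-1 * -1 - \sum_(k < n) 2 * x ^+ (2 * k)).
    exact: d3.
  have c0 : 1 - x ^+ 2 != 0.
    by rewrite (_ : _ - _ = (1 + x) * (1 - x)) ?mulf_neq0 ?lt0r_neq0 //; ring.
  have -> : \sum_(k < n) 2 * x ^+ (2 * k) = 2 * (1 - x ^+ (2 * n)) / (1 - x ^+ 2).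
    elim: (n) => [|m IH]; first by rewrite big_ord0 muln0 expr0 subrr mulr0 mul0r.
    rewrite big_ord_recr /= IH mulnS exprD; field.
    by rewrite c0.
  by rewrite /df; field; rewrite c0 !lt0r_neq0.
have n3 : `|3^-1 : R| = 3^-1 by rewrite ger0_norm.
have := @mvt_bound R f df 0 (3^-1) (9 / 4 * 9 ^- n).
rewrite add0r n3 => /(_ _ _)/= h.
have -> : ln 2 - \sum_(k < n) 2 / ((2 * k + 1)%:R * 3 ^+ (2 * k + 1)) = f 3^-1 - f 0.
  have -> : f 0 = 0.
    rewrite /f /s addr0 subr0 ln1 big1 ?subrr // => k _.
    by rewrite addn1 expr0n /= mulr0.
  rewrite /f subr0 (_ : 1 + 3^-1 = 4 / 3); last by field.
  rewrite (_ : 1 - 3^-1 = 2 / 3) ?ln_div ?posrE //; last by field.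
  rewrite (_ : 4 = 2 ^+ 2) ?lnXn //; last by rewrite expr2; lra.
  rewrite (_ : ln 2 *+ 2 - ln 3 - (ln 2 - ln 3) = ln 2); last by rewrite mulr2n; ring.
  congr (_ - _); apply: eq_bigr => k _; rewrite exprVn invfM mulrA //.
rewrite (_ : 3 / 4 * 9 ^- n = 9 / 4 * 9 ^- n * 3^-1); last by field; rewrite expf_neq0.
apply: h => z; rewrite subr0 => z3; first exact: dff.
have z9 : `|z| ^+ 2 <= 9^-1 by rewrite (_ : 9^-1 = 3^-1 ^+ 2) ?lerXn2r ?nnegrE //; field.
rewrite /df normrM normfV normrM normrX (ger0_norm (_ : 0 <= 2 :> R)) //.
have e9 : 9 ^- n = 9^-1 ^+ n :> R by rewrite exprVn.
have h1 : 8 / 9 <= `|1 - z ^+ 2|.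
  have z2 : z ^+ 2 = `|z| ^+ 2 by rewrite -normrX ger0_norm // sqr_ge0.
  by rewrite z2 ger0_norm; lra.
have h2 : `|z| ^+ (2 * n) <= 9^-1 ^+ n by rewrite exprM lerXn2r ?nnegrE ?exprn_ge0.
rewrite e9 ler_pdivrMr; last by lra.
have : 0 <= 9^-1 ^+ n :> R by rewrite exprn_ge0.
move: (9^-1 ^+ n) (`|z| ^+ _) (`|1 - _|) h1 h2 => u v w; nra.
Qed.

Lemma decimalE (s : seq nat) :
  decimal R s * 10 ^+ size s = Zr (foldl (fun z d => 10 * z + d%:R) 0 s).
Proof.
elim/last_ind: s => [|s d IH]; first by rewrite /decimal big_ord0 mul0r Zr0.
rewrite foldl_rcons /= ZrD ZrM -IH !Zr_nat size_rcons /decimal size_rcons big_ord_recr /=.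
rewrite nth_rcons ltnn eqxx mulrDl divfK ?expf_neq0 //; congr (_ + _).
rewrite exprS mulrCA; congr (_ * (_ * _)); apply: eq_bigr => i _.
by rewrite nth_rcons ltn_ord.
Qed.

Lemma ulp_gt0 : 0 < Zr ulp. Proof. by rewrite -Zr0; apply: Zr_lt. Qed.

(** One unit for the neglected tail and 15 for the roundings. *)
Lemma lsumP g (n d : nat -> Z) : (forall m, `|g m| <= 50 * 2 ^+ m) ->
  (forall m, 0 < d m) -> (forall m, coefa R m * g m = Zr (n m) / Zr (d m)) ->
  Zr (fsumZ n d 15 - 1) <= lsum g * Zr ulp <= Zr (fsumZ n d 15 + 16).
Proof.
move=> gB d0 gE; have := lsum_tail gB; have /andP[] := fsumZP 15 d0 gE.
have u0 := ulp_gt0.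
have nu x : `|x| * Zr ulp = `|x * Zr ulp| by rewrite normrM (gtr0_norm u0).
rewrite nu ler_norml mulrBl; move: (fsumZ n d 15) (Zr ulp) => F s.
rewrite !(ZrD, ZrN, Zr1, Zr_nat) => h1 h2 /andP[h3 h4].
by apply/andP; split; lra.
Qed.

Lemma coefV_le m : `|coefV m| <= 50 * 2 ^+ m.
Proof.
have [_ _ _ h1 [h2 h3 h4]] := coef_le10 R m; have m1 := @exp2_ge1 R m.
apply: le_trans (_ : _ <= 40) _; last by lra.
apply: le_trans (ler_normD _ _) _; rewrite /Pc.
have := ler_normD (- (cal1 R m + cbe1 R m)) (cbe2 R m); rewrite normrN.
have := ler_normD (cal1 R m) (cbe1 R m); lra.
Qed.

(** By ccE the factor cc m * 2 ^ m is bounded, and drift grows only linearly. *)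
Lemma drift_le2 m : `|drift R m| <= 50 * 2 ^+ m.
Proof.
have [h1 h0 _ h2 [h3 _ _]] := coef_le10 R m.
have [m1 m2] : 1 <= 2 ^+ m :> R /\ m.+1%:R <= 2 ^+ m :> R.
  by rewrite exp2_ge1 -natrX ler_nat ltn_expl.
have m0 : 0 <= m%:R :> R by [].
rewrite -natr1 in m2; rewrite /drift ccE.
have c0 : `|cal1 R m - 2^-1 * cal R m + cbe1 R m - cbe R m| <= 35.
  by move: h0 h1 h2 h3; rewrite !ler_norml => /andP[? ?] /andP[? ?] /andP[? ?] /andP[? ?];
    apply/andP; split; lra.
have c1 : `|m%:R * (cal1 R m - 2^-1 * cal R m + cbe1 R m - cbe R m)| <= m%:R * 35.
  by rewrite normrM ger0_norm // ler_wpM2l.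
move: c1 h1 h2; rewrite !ler_norml => /andP[? ?] /andP[? ?] /andP[? ?].
by apply/andP; split; lra.
Qed.

Definition nL k : Z := 2.
Definition dL k : Z := (2 * k + 1)%:R * 3 ^+ (2 * k + 1).

Lemma ln2P : Zr (fsumZ nL dL 31 - 1) <= ln 2 * Zr ulp <= Zr (fsumZ nL dL 31 + 32).
Proof.
have u0 := ulp_gt0.
have d0 k : 0 < dL k by rewrite /dL mulr_gt0 ?exprn_gt0 // ltr0n addn1.
have fE k : 2 / ((2 * k + 1)%:R * 3 ^+ (2 * k + 1)) = Zr (nL k) / Zr (dL k) :> R.
  by rewrite /nL /dL ZrM ZrX !Zr_nat.
have /andP[] := fsumZP 31 d0 fE; have := ln2_series 31.
have h9 : 3 / 4 * 9 ^- 31 * Zr ulp <= 1 :> R.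
  rewrite mulrAC ler_pdivrMr ?exprn_gt0 // mul1r -(Zr_nat 9) -ZrX.
  apply: (@le_trans _ _ (Zr ulp)); last by apply: Zr_le; vm_compute.
  by rewrite ler_piMl ?(ltW u0) //; lra.
rewrite -(ler_pM2r u0) -{1}(gtr0_norm u0) -normrM ler_norml mulrBl => /andP[h3 h4] h1 h2.
move: (fsumZ nL dL 31) h1 h2 => F h1 h2.
rewrite !(ZrD, ZrN, Zr1, Zr_nat) in h2 *.
by apply/andP; split; lra.
Qed.

Lemma dst_constant_lsum :
  dst_constant R = (Qinf R)^-1 * (lsum coefV / ln 2 + lsum (drift R)).
Proof.
rewrite /dst_constant; congr (_ * _); apply/cvg_lim; first exact: norm_hausdorff.
have -> : cst_series R = fun n => series (fun m => coefa R m * coefV m) n / ln 2 +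
    series (fun m => coefa R m * drift R m) n.
  apply/funext => n; rewrite /cst_series /series /= mulr_suml -big_split /=.
  by apply: eq_bigr => m _; rewrite coefbE /coefV; ring.
apply: cvgD; last by apply: (@is_cvg_coefa _ _ 25); [|exact: drift_le].
apply: cvgM; last exact: cvg_cst.
apply: (@is_cvg_coefa _ _ 50) => // m; apply: le_trans (coefV_le m) _.
by rewrite ler_wpM2l // lerXn2r ?nnegrE //; lra.
Qed.

Lemma ratio_bounds (q q1 q2 l l1 l2 v v1 v2 u u1 u2 s t k k' : R) :
  0 < s -> 0 < t -> 0 < q1 -> 0 < l1 -> u1 <= 0 -> u2 <= 0 -> 0 <= k -> 0 <= k' ->
  q1 <= q <= q2 -> l1 <= l <= l2 -> v1 <= v <= v2 -> u1 <= u <= u2 ->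
  k * (q2 * l2) <= (v1 * s + u1 * l2) * t -> (v2 * s + u2 * l1) * t < k' * (q1 * l1) ->
  k / t <= (v * s + u * l) / (q * l) < k' / t.
Proof.
move=> s0 t0 q0 l0 u10 u20 k0 k'0 /andP[ql qr] /andP[ll lr] /andP[vl vr] /andP[ul ur] h1 h2.
have Q0 : 0 < q by lra.
have L0 : 0 < l by lra.
have a1 : q * l <= q2 * l2 by apply: ler_pM => //; lra.
have a2 : q1 * l1 <= q * l by apply: ler_pM => //; lra.
have a3 := ler_wpM2l k0 a1; have a4 := ler_wpM2l k'0 a2.
have b1 : v1 * s <= v * s by rewrite ler_wpM2r // ltW.
have b2 : v * s <= v2 * s by rewrite ler_wpM2r // ltW.
rewrite ler_pdivlMr ?mulr_gt0 // [k / t * _]mulrAC ler_pdivrMr //.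
rewrite ltr_pdivrMr ?mulr_gt0 // [k' / t * _]mulrAC ltr_pdivlMr //.
have c1 : u1 * l <= u * l by rewrite ler_wpM2r // ltW.
have c2 : u1 * l2 <= u1 * l by rewrite ler_wnM2l.
have c3 : u * l <= u2 * l by rewrite ler_wpM2r // ltW.
have c4 : u2 * l <= u2 * l1 by rewrite ler_wnM2l.
apply/andP; split.
  apply: le_trans a3 (le_trans h1 _); rewrite ler_wpM2r ?(ltW t0) //; lra.
apply: lt_le_trans a4; apply: le_lt_trans h2; rewrite ler_wpM2r ?(ltW t0) //; lra.
Qed.

Definition Kdigits : seq nat := [:: 3; 0; 7; 0; 7; 9; 8; 1; 3; 9; 3; 6; 0; 5; 9; 2;
                                1; 8; 2; 8; 5; 4; 9]%N.
Definition Kz : Z := foldl (fun z d => 10 * z + d%:R) 0 Kdigits.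

Lemma dst_constant_bounds :
  decimal R Kdigits <= dst_constant R < decimal R Kdigits + 10 ^- 23.
Proof.
have p0 : 0 < 10 ^+ 23 :> R by rewrite exprn_gt0.
have KE : decimal R Kdigits = Zr Kz / 10 ^+ 23.
  by rewrite -[LHS](mulfK (lt0r_neq0 p0)); congr (_ / _); exact: decimalE.
have K1E : decimal R Kdigits + 10 ^- 23 = Zr (Kz + 1) / 10 ^+ 23.
  by rewrite KE ZrD Zr1 mulrDl mul1r.
have q1g n : `|1 : R| <= 50 * 2 ^+ n.
  by rewrite normr1; have := @exp2_ge1 R n; lra.
have qE m : coefa R m * 1 = Zr ((-1) ^+ m) / Zr (Dz m) by rewrite mulr1 coefaE.
have hq := lsumP q1g Dz_gt0 qE; rewrite -Qinf_lsum in hq.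
have hv := lsumP coefV_le dV_gt0 coefVE.
have hu := lsumP drift_le2 dU_gt0 driftE.
have hl := ln2P.
have s0 := ulp_gt0.
have -> : dst_constant R = (lsum coefV * Zr ulp * Zr ulp + lsum (drift R) * Zr ulp * (ln 2 * Zr ulp))
     / (Qinf R * Zr ulp * (ln 2 * Zr ulp)).
  rewrite dst_constant_lsum; have := Qinf_neq0 R; have := ln2_neq0 R; have := lt0r_neq0 s0.
  move: (Zr ulp) (ln 2) (Qinf R) => s l q s1 l1 q1.
  by field; rewrite s1 l1 q1.
rewrite K1E KE.
have pE : 10 ^+ 23 = Zr (10 ^+ 23) by rewrite ZrX (Zr_nat 10).
apply: (ratio_bounds s0 p0 _ _ _ _ _ _ hq hl hv hu).
- by rewrite -Zr0; apply: Zr_lt; vm_compute.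
- by rewrite -Zr0; apply: Zr_lt; vm_compute.
- by rewrite -Zr0; apply: Zr_le; vm_compute.
- by rewrite -Zr0; apply: Zr_le; vm_compute.
- by rewrite -Zr0; apply: Zr_le; vm_compute.
- by rewrite -Zr0; apply: Zr_le; vm_compute.
- by rewrite pE -!(ZrM, ZrD); apply: Zr_le; vm_compute.
- by rewrite pE -!(ZrM, ZrD); apply: Zr_lt; vm_compute.
Qed.

End FixedPoint.

Theorem theorem2 (R : realType) (d : measure_display) (T : measurableType d)
    (P : probability T R) (X : nat -> nat -> T -> bool)
    (HX : independent_fair_bits P X) :
  (exists (delta : R -> R) (c : int -> R[i]),
    [/\ forall x, delta (x + 1) = delta x,
        fourier_expansion0 delta c
      & mean_2protected P X
        = (fun N : nat => N%:R * dst_constant R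
                          + N%:R * delta (log2 N%:R) : R^o)
          +O_\oo (fun _ : nat => 1 : R^o)])
  /\ (cvgn (cst_series R)
      /\ let K := decimal R [:: 3; 0; 7; 0; 7; 9; 8; 1; 3; 9; 3; 6; 0; 5; 9; 2;
                                1; 8; 2; 8; 5; 4; 9]%N in
         K <= dst_constant R < K + 10 ^- 23).
Proof.
split; last by split; [exact: is_cvg_cst_series|exact: dst_constant_bounds].
exists (@delta_osc R), (fourier_coef (@delta_osc R)); split.
- exact: osc_periodic.
- exact: osc_fourier.
- exact: mean_asymptotics.
Qed.
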